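(* Let $\eta\in\mathbb{R}^3$ be a unit vector, let $z\in\mathbb{R}$, and let $P_{\eta,z}=\{x\in\mathbb{R}^3 : x\cdot\eta=z\}$. Let $B$ be a vector field on $\mathbb{R}^3$ with values in $\mathbb{R}^3$ such that the restriction $B|_{P_{\eta,z}}$ is smooth with compact support. Then the data $S\left(\frac{\gamma_N}{v}H(B)\right)(x,\xi)$, given for all $x\in P_{\eta,z}$ and all unit vectors $\xi\in\mathbb{R}^3$ with $\eta\cdot\xi=0$, uniquely determines $B|_{P_{\eta,z}}$. That is, if $B$ and $B'$ are two vector fields whose restrictions to $P_{\eta,z}$ are smooth with compact support and $S\left(\frac{\gamma_N}{v}H(B)\right)(x,\xi)=S\left(\frac{\gamma_N}{v}H(B')\right)(x,\xi)$ for all $x\in P_{\eta,z}$ and all unit $\xi$ with $\eta\cdot\xi=0$, then $B|_{P_{\eta,z}}=B'|_{P_{\eta,z}}$.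
   Context: Here $\gamma_N\neq 0$ is a fixed real constant (the gyromagnetic ratio of the neutron) and $v>0$ is a fixed constant (the neutron speed). For $b=(b_1,b_2,b_3)\in\mathbb{R}^3$, $H(b)$ is the skew-symmetric matrix $$H(b)=\begin{pmatrix} 0 & b_3 & -b_2 \\ -b_3 & 0 & b_1 \\ b_2 & -b_1 & 0 \end{pmatrix},$$ so that $\sigma\times b=H(b)\sigma$ for all $\sigma\in\mathbb{R}^3$. Let $A(x)=\frac{\gamma_N}{v}H(B(x))$. For a line $s\mapsto x+s\xi$ in $P_{\eta,z}$ (with $x\in P_{\eta,z}$, $|\xi|=1$, $\xi\cdot\eta=0$), let $\Sigma$ be the $3\times 3$ matrix-valued solution of $$\frac{\partial}{\partial s}\Sigma(x+s\xi,\xi)=A(x+s\xi)\,\Sigma(x+s\xi,\xi),\qquad \lim_{s\to-\infty}\Sigma(x+s\xi,\xi)=I,$$ where $I$ is the identity matrix. The non-Abelian Radon transform of $A$ restricted to the plane is $$S(A)(x,\xi)=\lim_{s\to\infty}\Sigma(x+s\xi,\xi).$$ *)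

(* Defs.v *)
From HB Require Import structures.
From mathcomp Require Import all_boot all_order all_algebra.
From mathcomp Require Import all_classical all_reals all_analysis.

Set Implicit Arguments.
Unset Strict Implicit.
Unset Printing Implicit Defensive.

Import Order.TTheory GRing.Theory Num.Theory.
Import numFieldNormedType.Exports.

Local Open Scope classical_set_scope.
Local Open Scope ring_scope.

(* The library norm `|x| on matrices is the sup norm, hence the explicit
   Euclidean structure on column vectors. *)
Definition dot {R : realType} (u v : 'cV[R]_3) : R := \sum_i u i 0 * v i 0.

Definition enorm {R : realType} (u : 'cV[R]_3) : R := Num.sqrt (dot u u).

Definition plane {R : realType} (eta : 'cV[R]_3) (z : R) : set 'cV[R]_3 :=
  [set x | dot x eta = z].

(* Iterated directional derivative D_{u_1} ( ... (D_{u_k} f)). When the u_i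
   are orthogonal to eta, its values on [plane eta z] depend only on the values
   of f on that plane. *)
Definition iter_derive {R : realType} (us : seq 'cV[R]_3)
    (f : 'cV[R]_3 -> 'cV[R]_3) : 'cV[R]_3 -> 'cV[R]_3 :=
  foldr (fun u g => 'D_u g) f us.

(* The restriction of f to the plane is C^infinity: all its iterated derivatives
   in directions tangent to the plane exist and are continuous on the plane.
   Nothing is required of f off the plane, nor in the normal direction. *)
Definition smooth_on_plane {R : realType} (eta : 'cV[R]_3) (z : R)
    (f : 'cV[R]_3 -> 'cV[R]_3) : Prop :=
  forall us : seq 'cV[R]_3, (forall u, u \in us -> dot u eta = 0) ->
    {within plane eta z, continuous (iter_derive us f)} /\
    (forall x u, plane eta z x -> dot u eta = 0 ->
       derivable (iter_derive us f) x u).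

(* The plane is closed, so this closure is also the one relative to it. *)
Definition compact_support_on_plane {R : realType} (eta : 'cV[R]_3) (z : R)
    (f : 'cV[R]_3 -> 'cV[R]_3) : Prop :=
  compact (closure (plane eta z `&` [set x | f x != 0])).

Definition Hmx {R : realType} (b : 'cV[R]_3) : 'M[R]_3 :=
  let b1 := b 0 0 in let b2 := b 1 0 in let b3 := b 2 0 in
  \matrix_(i < 3, j < 3)
    nth 0 (nth [::] [:: [::   0;  b3; - b2];
                        [:: - b3;  0;   b1];
                        [::  b2; - b1;   0]] i) j.

Definition is_transport {R : realType} (A : 'cV[R]_3 -> 'M[R]_3)
    (x xi : 'cV[R]_3) (Sigma : R -> 'M[R]_3) : Prop :=
  (forall s : R, is_derive s 1 Sigma (A (x + s *: xi) *m Sigma s)) /\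
  Sigma s @[s --> -oo] --> (1%:M : 'M[R]_3).

(* The solution s |-> Sigma(x + s xi, xi). When A is continuous and compactly
   supported along the line, exactly one function satisfies [is_transport];
   otherwise the value chosen by [get] may be arbitrary. *)
Definition transport {R : realType} (A : 'cV[R]_3 -> 'M[R]_3)
    (x xi : 'cV[R]_3) : R -> 'M[R]_3 :=
  get [set Sigma | is_transport A x xi Sigma].

Definition nonabelian_radon {R : realType} (A : 'cV[R]_3 -> 'M[R]_3)
    (x xi : 'cV[R]_3) : 'M[R]_3 :=
  lim (transport A x xi s @[s --> +oo]).

(* Main.v *)
(* Fix coordinates of the plane with z = x + i y and the direction
   (cos t, sin t). If S and S' are the fundamental solutions for A and A' along
   lines, then u = S S'^T - 1 satisfies X u = A u - u A' + (A - A') with X the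
   derivative along the line; equality of the data makes u compactly supported.
   As A and A' are skew, this is an equation X u + Phi u = f with Phi skew for
   the Frobenius product and with f = A - A' independent of t.
   Fourier modes u_m of u in t satisfy d u_(m-1) + dbar u_(m+1) + Phi u_m = 0 for
   m <> 0. Multiplying u by exp (k (|z|^2 - zbar^2 e^{2it})), which has only
   modes of nonnegative index, turns d and dbar into eta_+ = d + k zbar and
   eta_- = dbar - k z, for which |eta_- g|^2 = |eta_+ g|^2 + 2k |g|^2 in L^2. In
   the recursion for the energies |eta_- v_m|^2 the only terms not dominated by
   k |v_m|^2 are Re (eta_+ v_(m-1), Phi v_m), and by skewness of Phi two
   consecutive ones cancel up to O(|v_m|^2 + |v_(m-1)|^2). For k large this
   forces the modes of negative index to vanish, and since u is real only the
   mode 0 survives; it is constant, hence zero, and so is f. *)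
Require Import Defs.
From mathcomp Require Import all_boot all_order all_algebra.
From mathcomp Require Import all_classical all_reals all_analysis.
From mathcomp Require Import ring lra.

Import Order.TTheory GRing.Theory Num.Theory.
Import numFieldNormedType.Exports.

Local Open Scope classical_set_scope.
Local Open Scope ring_scope.

(** * One-variable calculus *)

(** The matrices [S] are differentiated in the position of the line, never in its angle, so [u] is
    C^1 in the point and merely continuous in [t]. This shapes three steps. The norm identity for
    eta_+ and eta_- would need second derivatives if proved by commuting them; it is reduced to the
    vanishing integral of a Jacobian, established for C^1 maps. The energies tend to zero by
    Riemann-Lebesgue, uniformly on a square, not by integration by parts in [t]. The Fourier series
    of [u] is never summed: once the modes of nonzero index are gone, the transport equation
    integrated over [t] expresses 2 pi f through modes 0 and 1. The exponential factor mixes the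
    modes, so their vanishing for large [k] has to be carried back to [k = 0]; this is done by a
    differential equation in [k] that couples each index only to higher ones. The cross terms in the
    energies have no sign of their own and cancel only in consecutive pairs, which is why the
    recursion concerns sums of two neighbouring energies. *)

Section PointwiseDerivatives.
Context {R : realType}.
Implicit Types (f g : R -> R) (x : R).

Lemma is_derive_add f g x a b : is_derive x 1 f a -> is_derive x 1 g b ->
  is_derive x 1 (fun t => f t + g t) (a + b).
Proof. exact: is_deriveD. Qed.

Lemma is_derive_opp f x a : is_derive x 1 f a ->
  is_derive x 1 (fun t => - f t) (- a).
Proof. exact: is_deriveN. Qed.

Lemma is_derive_mul f g x a b : is_derive x 1 f a -> is_derive x 1 g b ->
  is_derive x 1 (fun t => f t * g t) (a * g x + f x * b).
Proof.
move=> df dg; have := is_deriveM df dg => h.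
by apply: (is_derive_eq h); rewrite /GRing.scale /= addrC mulrC.
Qed.

Lemma is_derive_const (c x : R) : is_derive x 1 (fun _ : R => c) 0.
Proof. exact: is_derive_cst. Qed.

Lemma is_derive_var (x : R) : is_derive x 1 (fun t : R => t) 1.
Proof. exact: is_derive_id. Qed.

Lemma is_derive_comp_fun (F f : R -> R) x a b : is_derive (f x) 1 F b ->
  is_derive x 1 f a -> is_derive x 1 (fun t => F (f t)) (b * a).
Proof.
move=> dF df; have h := @is_derive1_comp _ F f x _ _ dF df.
exact: (is_derive_eq h).
Qed.

Lemma is_derive_cos_comp f x a : is_derive x 1 f a ->
  is_derive x 1 (fun t => cos (f t)) (- sin (f x) * a).
Proof. by apply: is_derive_comp_fun. Qed.

Lemma is_derive_sin_comp f x a : is_derive x 1 f a ->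
  is_derive x 1 (fun t => sin (f t)) (cos (f x) * a).
Proof. by apply: is_derive_comp_fun. Qed.

Lemma is_derive_expR_comp f x a : is_derive x 1 f a ->
  is_derive x 1 (fun t => expR (f t)) (expR (f x) * a).
Proof. by apply: is_derive_comp_fun. Qed.

Lemma is_derive_big (I : finType) (f : I -> R -> R) x (a : I -> R) :
  (forall i, is_derive x 1 (f i) (a i)) ->
  is_derive x 1 (fun t => \sum_i f i t) (\sum_i a i).
Proof.
move=> df; suff h s : is_derive x 1 (fun t => \sum_(i <- s) f i t) (\sum_(i <- s) a i).
  exact: h.
elim: s => [|i s IH].
  rewrite big_nil (_ : (fun _ => _) = fun=> 0); first exact: is_derive_const.
  by apply/funext => t; rewrite big_nil.
rewrite big_cons (_ : (fun _ => _) = fun t => f i t + \sum_(j <- s) f j t).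
  exact: is_derive_add.
by apply/funext => t; rewrite big_cons.
Qed.

Lemma is_derive_continuous f f' : (forall x, is_derive x 1 f (f' x)) ->
  continuous f.
Proof.
move=> df x; have [dfx _] := df x.
exact/differentiable_continuous/derivable1_diffP.
Qed.

(** Using [Num.min] and [Num.max] instead of ordered endpoints lets difference quotients be
    estimated on both sides of a point at once. *)
Lemma mean_value f f' (a b : R) : (forall x, is_derive x 1 f (f' x)) ->
  exists c, [/\ f b - f a = f' c * (b - a), Num.min a b <= c & c <= Num.max a b].
Proof.
move=> df; have cf := is_derive_continuous _ _ df.
wlog ab : a b / a <= b.
  move=> h; have /orP[ab|ba] := le_total a b; first exact: h.
  have [c [e1 e2 e3]] := h _ _ ba.
  exists c; split; [|by rewrite minC|by rewrite maxC].
  by rewrite -opprB e1 -mulrN opprB.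
have [c + e] := MVT_segment ab (fun x _ => df x) (continuous_subspaceT cf).
rewrite in_itv /= => /andP[ac cb]; exists c.
by rewrite e (min_idPl ab) (max_idPr ab).
Qed.

Lemma ge0_derive_homo f f' (a b : R) : (forall x, is_derive x 1 f (f' x)) ->
  (forall x, 0 <= f' x) -> a <= b -> f a <= f b.
Proof.
move=> df h ab; have [c [e _ _]] := mean_value _ _ a b df.
by rewrite -subr_ge0 e mulr_ge0 // subr_ge0.
Qed.

Lemma ge0_derive_homo_in f f' (a b : R) : (forall x, is_derive x 1 f (f' x)) ->
  a <= b -> (forall x, a <= x <= b -> 0 <= f' x) -> f a <= f b.
Proof.
move=> df ab h; have [c [e]] := mean_value _ _ a b df.
rewrite (min_idPl ab) (max_idPr ab) => ac cb.
by rewrite -subr_ge0 e mulr_ge0 ?subr_ge0 // h // ac.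
Qed.

Lemma eq_derive_cst f g h (a b : R) : (forall x, is_derive x 1 f (h x)) ->
  (forall x, is_derive x 1 g (h x)) -> f b - f a = g b - g a.
Proof.
move=> df dg; suff: f b - g b = f a - g a by lra.
apply: (@is_derive_0_is_cst _ (fun x => f x - g x)) => x.
by apply: is_derive_eq (subrr (h x)); exact: is_deriveB.
Qed.

(** An integral from a base point [a] is differentiable only to the right of [a]. The base point
    [n x] lies to the left of both [0] and [x], and the increment from [0] to [x] does not depend on
    it ([eqF]), so the pieces glue to one function on the whole line. *)
Lemma continuous_primitive f : continuous f ->
  exists F, forall x, is_derive x 1 F (f x).
Proof.
move=> cf.
pose F (a x : R) := (\int[lebesgue_measure]_(t in `[a, x]) f t)%R.
have dF a x : a < x -> is_derive x 1 (F a) (f x).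
  move=> ax; have intf : lebesgue_measure.-integrable `[a, x + 1] (EFin \o f).
    apply: continuous_compact_integrable; first exact: segment_compact.
    exact: continuous_subspaceT.
  have x1 : x < x + 1 by rewrite ltrDl.
  have [h1 h2] := continuous_FTC1_closed x1 intf ax (cf x).
  by apply: DeriveDef; [exact: h1|rewrite -derive1E; exact: h2].
have eqF a b x y : a < x -> x <= y -> b < x -> F a y - F a x = F b y - F b x.
  move=> ax xy bx.
  suff: F a y - F b y = F a x - F b x by lra.
  have dG t : x <= t -> is_derive t 1 (fun t => F a t - F b t) 0.
    move=> xt; apply: is_derive_eq (subrr (f t)).
    by apply: is_derive_add; [|apply: is_derive_opp]; apply: dF; apply: lt_le_trans xt.
  have cG : {within `[x, y], continuous (fun t => F a t - F b t)}.
    apply: continuous_in_subspaceT => t; rewrite inE /= in_itv /= => /andP[xt _].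
    have [d _] := dG t xt.
    exact/differentiable_continuous/derivable1_diffP.
  have dG' t : t \in `]x, y[%R -> is_derive t 1 (fun t => F a t - F b t) 0.
    by rewrite in_itv /= => /andP[/ltW xt _]; exact: dG.
  have [c _] := MVT_segment xy dG' cG.
  by rewrite mul0r => /eqP; rewrite subr_eq0 => /eqP.
pose n (x : R) : R := - (`|x| + 1).
have nx x : n x < x /\ n x < 0.
  rewrite /n; have := ler_norm (- x); rewrite normrN => h.
  by have := normr_ge0 x; split; lra.
pose H x := F (n x) x - F (n x) 0.
exists H => x.
have [n1 n2] : n x - 1 < x /\ n x - 1 < 0 by have [] := nx x; split; lra.
apply: (@near_eq_is_derive R R^o R^o (fun y => F (n x - 1) y - F (n x - 1) 0)).
  near=> y.
  have [ny1 ny2] := nx y.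
  have yx : n x - 1 < y.
    by near: y; exact: lt_nbhsr.
  rewrite /H; have [y0|y0] := leP 0 y.
    exact: eqF.
  have := eqF (n y) (n x - 1) y 0 ny1 (ltW y0) yx.
  by move=> h; lra.
apply: is_derive_eq; first by apply: is_derive_add (is_derive_const _ _); exact: dF.
by rewrite addr0.
Unshelve. all: by end_near. Qed.

End PointwiseDerivatives.

(** * Continuity of composite expressions *)

Section JointContinuity.
Context {R : realType} {T : topologicalType}.
Implicit Types f g h : T -> R.

Lemma continuous_add f g : continuous f -> continuous g ->
  continuous (fun t => f t + g t).
Proof. by move=> cf cg t; apply: cvgD; [exact: cf|exact: cg]. Qed.

Lemma continuous_opp f : continuous f -> continuous (fun t => - f t).
Proof. by move=> cf t; apply: cvgN; exact: cf. Qed.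

Lemma continuous_mul f g : continuous f -> continuous g ->
  continuous (fun t => f t * g t).
Proof. by move=> cf cg t; apply: cvgM; [exact: cf|exact: cg]. Qed.

Lemma continuous_const (S : topologicalType) (c : S) : continuous (fun _ : T => c).
Proof. by move=> t; exact: cvg_cst. Qed.

Lemma continuous_comp_fun (F : R -> R) f : continuous F -> continuous f ->
  continuous (fun t => F (f t)).
Proof. by move=> cF cf t; apply: (cvg_comp _ _ (cf t)); exact: cF. Qed.

Lemma continuous_pair (S1 S2 : topologicalType) (a : T -> S1) (b : T -> S2) :
  continuous a -> continuous b -> continuous (fun t => (a t, b t)).
Proof. by move=> ca cb t; apply: cvg_pair; [exact: ca|exact: cb]. Qed.

Lemma continuous_comp_top (S1 S2 : topologicalType) (F : S1 -> S2) (a : T -> S1) :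
  continuous F -> continuous a -> continuous (fun t => F (a t)).
Proof. by move=> cF cf t; apply: (cvg_comp _ _ (cf t)); exact: cF. Qed.

Lemma continuous_comp2 (S1 S2 : topologicalType) (F : S1 -> S2 -> R)
    (a : T -> S1) (b : T -> S2) :
  continuous (fun z : S1 * S2 => F z.1 z.2) ->
  continuous a -> continuous b -> continuous (fun t => F (a t) (b t)).
Proof.
by move=> cF ca cb; exact: (continuous_comp_top _ _ _ _ cF (continuous_pair _ _ _ _ ca cb)).
Qed.

Lemma continuous_comp3 (S1 S2 S3 : topologicalType) (F : S1 -> S2 -> S3 -> R)
    (a : T -> S1) (b : T -> S2) (c : T -> S3) :
  continuous (fun z : S1 * S2 * S3 => F z.1.1 z.1.2 z.2) ->
  continuous a -> continuous b -> continuous c ->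
  continuous (fun t => F (a t) (b t) (c t)).
Proof.
move=> cF ca cb cc.
exact: (continuous_comp_top _ _ _ _ cF
  (continuous_pair _ _ _ _ (continuous_pair _ _ _ _ ca cb) cc)).
Qed.

Lemma continuous_big (I : finType) (f : I -> T -> R) :
  (forall i, continuous (f i)) -> continuous (fun t => \sum_i f i t).
Proof.
move=> cf; suff h s : continuous (fun t => \sum_(i <- s) f i t) by exact: h.
elim: s => [|i s IH].
  rewrite (_ : (fun _ => _) = fun=> 0); first exact: continuous_const.
  by apply/funext => t; rewrite big_nil.
rewrite (_ : (fun _ => _) = fun t => f i t + \sum_(j <- s) f j t).
  exact: continuous_add.
by apply/funext => t; rewrite big_cons.
Qed.

End JointContinuity.

Lemma continuous_fst_comp (T S1 S2 : topologicalType) (a : T -> S1 * S2) :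
  continuous a -> continuous (fun t => (a t).1).
Proof. by move=> ca; apply: (continuous_comp_top _ _ _ _ _ ca) => z; exact: cvg_fst. Qed.

Lemma continuous_snd_comp (T S1 S2 : topologicalType) (a : T -> S1 * S2) :
  continuous a -> continuous (fun t => (a t).2).
Proof. by move=> ca; apply: (continuous_comp_top _ _ _ _ _ ca) => z; exact: cvg_snd. Qed.

Lemma continuous_idfun (T : topologicalType) : continuous (fun t : T => t).
Proof. by move=> t; exact: cvg_id. Qed.

Lemma continuous_eta (T S : topologicalType) (f : T -> S) :
  continuous (fun t => f t) -> continuous f.
Proof. by []. Qed.

Lemma continuous_expn (R : realType) (T : topologicalType) (f : T -> R) n :
  continuous f -> continuous (fun t => f t ^+ n).
Proof.
move=> cf; elim: n => [|n IH].
  by rewrite (_ : (fun _ => _) = fun=> 1); [exact: continuous_const|].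
rewrite (_ : (fun _ => _) = fun t => f t * f t ^+ n); first exact: continuous_mul.
by apply/funext => t; rewrite exprS.
Qed.

(** Continuity in several real variables is always stated jointly, on a product, as
    [fun z => F z.1.1 z.1.2 z.2]. The hypothesis cases recognize this form, with up to three finite
    indices before the real variables. *)
Ltac cont_step :=
  match goal with
  | |- continuous (fun _ => ?c) => exact: continuous_const
  | |- continuous (fun t => t) => exact: continuous_idfun
  | |- continuous (fun t => (@?a t).1) => apply: (@continuous_fst_comp _ _ _ a)
  | |- continuous (fun t => (@?a t).2) => apply: (@continuous_snd_comp _ _ _ a)
  | |- continuous (fun t => (@?a t, @?b t)) => apply: (@continuous_pair _ _ _ a b)
  | |- continuous (fun t => @?a t + @?b t) => apply: (@continuous_add _ _ a b)
  | |- continuous (fun t => - @?a t) => apply: (@continuous_opp _ _ a)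
  | |- continuous (fun t => @?a t * @?b t) => apply: (@continuous_mul _ _ a b)
  | |- continuous (fun t => @?a t ^+ ?n) => apply: (@continuous_expn _ _ a n)
  | |- continuous (fun t => \sum_i (@?a t i)) =>
      apply: continuous_big => ?
  | |- continuous (fun t => cos (@?a t)) =>
      apply: (@continuous_comp_fun _ _ cos a (@continuous_cos _))
  | |- continuous (fun t => sin (@?a t)) =>
      apply: (@continuous_comp_fun _ _ sin a (@continuous_sin _))
  | |- continuous (fun t => expR (@?a t)) =>
      apply: (@continuous_comp_fun _ _ expR a (@continuous_expR _))
  | H : context [continuous (fun z => ?F z.1.1 z.1.2 z.2)]
    |- continuous (fun t => ?F (@?a t) (@?b t) (@?c t)) =>
      apply: (@continuous_comp3 _ _ _ _ _ F a b c); first by apply: H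
  | H : context [continuous (fun z => ?F z.1 z.2)]
    |- continuous (fun t => ?F (@?a t) (@?b t)) =>
      apply: (@continuous_comp2 _ _ _ _ F a b); first by apply: H
  | H : context [continuous (fun z => ?F _ z.1.1 z.1.2 z.2)]
    |- continuous (fun t => ?F ?i (@?a t) (@?b t) (@?c t)) =>
      apply: (@continuous_comp3 _ _ _ _ _ (F i) a b c); first by apply: H
  | H : context [continuous (fun z => ?F _ z.1 z.2)]
    |- continuous (fun t => ?F ?i (@?a t) (@?b t)) =>
      apply: (@continuous_comp2 _ _ _ _ (F i) a b); first by apply: H
  | H : context [continuous (fun z => ?F _ _ z.1.1 z.1.2 z.2)]
    |- continuous (fun t => ?F ?i ?j (@?a t) (@?b t) (@?c t)) =>
      apply: (@continuous_comp3 _ _ _ _ _ (F i j) a b c); first by apply: H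
  | H : context [continuous (fun z => ?F _ _ z.1 z.2)]
    |- continuous (fun t => ?F ?i ?j (@?a t) (@?b t)) =>
      apply: (@continuous_comp2 _ _ _ _ (F i j) a b); first by apply: H
  | H : context [continuous (fun z => ?F _ _ _ z.1.1 z.1.2 z.2)]
    |- continuous (fun t => ?F ?i ?j ?k (@?a t) (@?b t) (@?c t)) =>
      apply: (@continuous_comp3 _ _ _ _ _ (F i j k) a b c); first by apply: H
  | H : context [continuous (fun z => ?F _ _ _ z.1 z.2)]
    |- continuous (fun t => ?F ?i ?j ?k (@?a t) (@?b t)) =>
      apply: (@continuous_comp2 _ _ _ _ (F i j k) a b); first by apply: H
  | H : context [continuous ?F] |- continuous (fun t => ?F (@?a t)) =>
      apply: (@continuous_comp_fun _ _ F a); first by apply: H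
  | H : context [continuous (?F _)] |- continuous (fun t => ?F ?i (@?a t)) =>
      apply: (@continuous_comp_fun _ _ (F i) a); first by apply: H
  | H : _ |- continuous _ => solve [apply: H]
  end.
Ltac cont :=
  try match goal with |- continuous ?f => apply: (@continuous_eta _ _ f) end;
  repeat cont_step; try by [].

(* [notypeclasses] keeps instance search from instantiating the derivatives. *)
Ltac der_step :=
  match goal with
  | |- is_derive _ _ (fun _ => ?c) _ => notypeclasses refine (is_derive_const _ _)
  | |- is_derive _ _ (fun t => t) _ => notypeclasses refine (is_derive_var _)
  | |- is_derive _ _ (fun t => @?a t + @?b t) _ =>
      notypeclasses refine (@is_derive_add _ a b _ _ _ _ _)
  | |- is_derive _ _ (fun t => - @?a t) _ =>
      notypeclasses refine (@is_derive_opp _ a _ _ _)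
  | |- is_derive _ _ (fun t => @?a t * @?b t) _ =>
      notypeclasses refine (@is_derive_mul _ a b _ _ _ _ _)
  | |- is_derive _ _ (fun t => cos (@?a t)) _ =>
      notypeclasses refine (@is_derive_cos_comp _ a _ _ _)
  | |- is_derive _ _ (fun t => sin (@?a t)) _ =>
      notypeclasses refine (@is_derive_sin_comp _ a _ _ _)
  | |- is_derive _ _ (fun t => expR (@?a t)) _ =>
      notypeclasses refine (@is_derive_expR_comp _ a _ _ _)
  | |- is_derive _ _ (fun t => \sum_i (@?a t i)) _ =>
      notypeclasses refine (@is_derive_big _ _ (fun i t => a t i) _ _ _); intro
  | H : _ |- _ => solve [notypeclasses refine (H _) | notypeclasses refine (H _ _)
                        | notypeclasses refine (H _ _ _)
                        | notypeclasses refine (H _ _ _ _) | notypeclasses refine H]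
  end.
Ltac der :=
  notypeclasses refine (@is_derive_eq _ _ _ _ _ _ _ _ _ _);
  [repeat der_step | cbv beta].

(** * Uniformity over compact sets *)

Section Tube.
Context {R : realType}.

(** Tube lemma: joint continuity at every [(t0, s)] becomes uniform in [s] because [K] is compact.
    It underlies differentiation under the integral, parameter dependence of differential equations
    and the Riemann-Lebesgue lemma. *)
Lemma near_uniform (T S : topologicalType) (K : set S) (f : T * S -> R) (t0 : T) (e : R) :
  compact K -> continuous f -> 0 < e ->
  \forall t \near t0, forall s, K s -> `|f (t, s) - f (t0, s)| < e.
Proof.
move=> /compact_near_coveringP cK cf e0.
apply: (cK _ (nbhs t0) (fun t s => `|f (t, s) - f (t0, s)| < e)) => s Ks.
have e2 : 0 < e / 2 by rewrite divr_gt0.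
have /cvgr_distC_lt/(_ _ e2) h := cf (t0, s).
have h1 : \forall z \near (s, t0), `|f (z.2, z.1) - f (t0, s)| < e / 2.
  have c : ((z.2, z.1) @[z --> (s, t0)]) --> (t0, s).
    by apply: cvg_pair; [exact: cvg_snd|exact: cvg_fst].
  exact: (c _ h).
have h2 : \forall z \near (s, t0), `|f (t0, z.1) - f (t0, s)| < e / 2.
  have c : ((t0, z.1) @[z --> (s, t0)]) --> (t0, s).
    by apply: cvg_pair; [exact: cvg_cst|exact: cvg_fst].
  exact: (c _ h).
suff: \forall z \near (s, t0), `|f (z.2, z.1) - f (t0, z.1)| < e by [].
apply: filterS2 h1 h2 => -[s' t] /= h1 h2.
rewrite (splitr e) (_ : _ - _ = (f (t, s') - f (t0, s)) - (f (t0, s') - f (t0, s))); last by ring.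
by rewrite (le_lt_trans (ler_normB _ _)) // ltrD.
Qed.

Lemma is_derive_approx (f : R -> R) (x d : R) :
  (forall e, 0 < e -> \forall y \near x, `|f y - f x - (y - x) * d| <= e * `|y - x|) ->
  is_derive x 1 f d.
Proof.
move=> h.
have H : h^-1 *: (f (h *: 1 + x) - f x) @[h --> 0^'] --> (d : R).
  apply/cvgrPdist_le => e e0.
  have c : (k + x) @[k --> (0:R)] --> x.
    by rewrite -[X in _ --> X]add0r; apply: cvgD; [exact: cvg_id|exact: cvg_cst].
  have h0 : \forall k \near (0:R), `|f (k + x) - f x - (k + x - x) * d| <= e * `|k + x - x|.
    exact: (c _ (h _ e0)).
  have h1 : \forall k \near 0^', `|f (k + x) - f x - k * d| <= e * `|k|.
    by apply: nbhs_dnbhs; apply: filterS h0 => k; rewrite addrK.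
  near=> k.
  have k0 : k != 0 by near: k; exact: nbhs_dnbhs_neq.
  rewrite distrC (_ : _ - d = k^-1 * (f (k + x) - f x - k * d)); last first.
    by rewrite /GRing.scale /= mulr1 [RHS]mulrBr mulKf.
  rewrite normrM normfV ler_pdivrMl ?normr_gt0 // [leRHS]mulrC.
  by near: k.
apply: DeriveDef; first by apply/cvg_ex; exists d.
exact: (cvg_lim _ H).
Unshelve. all: by end_near. Qed.

End Tube.

(** Taking the integral to be the increment of a chosen primitive makes the fundamental theorem and
    additivity immediate for any order of the endpoints. The choice does not matter when a primitive
    exists; otherwise the value is arbitrary. *)
Definition primitive {R : realType} (h : R -> R) : R -> R :=
  get [set F | forall x : R, is_derive x 1 F (h x)].

Definition integ {R : realType} (a b : R) (h : R -> R) : R :=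
  primitive h b - primitive h a.

Section Integral.
Context {R : realType}.
Implicit Types (f g h F : R -> R) (a b c x y : R).

Lemma primitive_derive h : continuous h ->
  forall x : R, is_derive x 1 (primitive h) (h x).
Proof. by move=> /continuous_primitive h0; exact: (getPex h0). Qed.

Lemma integ_FTC F h a b : (forall x, is_derive x 1 F (h x)) ->
  integ a b h = F b - F a.
Proof.
move=> dF; apply: (eq_derive_cst _ _ h) => //.
by apply: (@getPex _ [set F | forall x : R, is_derive x 1 F (h x)]); exists F.
Qed.

Lemma integD f g a b : continuous f -> continuous g ->
  integ a b (fun x => f x + g x) = integ a b f + integ a b g.
Proof.
move=> /primitive_derive df /primitive_derive dg.
have d x : is_derive x 1 (fun x => primitive f x + primitive g x) (f x + g x) by der.
by rewrite (integ_FTC _ _ _ _ d) /integ; ring.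
Qed.

Lemma integZ c f a b : continuous f ->
  integ a b (fun x => c * f x) = c * integ a b f.
Proof.
move=> /primitive_derive df.
have d x : is_derive x 1 (fun x => c * primitive f x) (c * f x).
  by der; rewrite mul0r add0r.
by rewrite (integ_FTC _ _ _ _ d) /integ; ring.
Qed.

Lemma integN f a b : continuous f ->
  integ a b (fun x => - f x) = - integ a b f.
Proof.
move=> cf; rewrite -mulN1r -integZ //; congr integ.
by apply/funext => x; rewrite mulN1r.
Qed.

Lemma integB f g a b : continuous f -> continuous g ->
  integ a b (fun x => f x - g x) = integ a b f - integ a b g.
Proof. by move=> cf cg; rewrite integD ?integN //; cont. Qed.

Lemma integ_cst c a b : integ a b (fun=> c) = c * (b - a).
Proof.
have d x : is_derive x 1 (fun x => c * x) c.
  by der; rewrite mul0r add0r mulr1.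
by rewrite (integ_FTC _ _ _ _ d); ring.
Qed.

Lemma integ0 a b : integ a b (fun=> 0) = 0.
Proof. by rewrite integ_cst mul0r. Qed.

Lemma integ_sum (I : finType) (f : I -> R -> R) a b :
  (forall i, continuous (f i)) ->
  integ a b (fun x => \sum_i f i x) = \sum_i integ a b (f i).
Proof.
move=> cf; have df i := primitive_derive _ (cf i).
have d x : is_derive x 1 (fun x => \sum_i primitive (f i) x) (\sum_i f i x) by der.
by rewrite (integ_FTC _ _ _ _ d) /integ -sumrB.
Qed.

Lemma integ_le f g a b : continuous f -> continuous g -> a <= b ->
  (forall x, a <= x <= b -> f x <= g x) -> integ a b f <= integ a b g.
Proof.
move=> cf cg ab fg; rewrite /integ.
suff: primitive g a - primitive f a <= primitive g b - primitive f b by lra.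
apply: (ge0_derive_homo_in (fun x => primitive g x - primitive f x) (fun x => g x - f x)) => //.
  by move: cf cg => /primitive_derive df /primitive_derive dg x; der.
by move=> x /fg; rewrite subr_ge0.
Qed.

Lemma integ_ge0 f a b : continuous f -> a <= b ->
  (forall x, a <= x <= b -> 0 <= f x) -> 0 <= integ a b f.
Proof. by move=> cf ab f0; rewrite -(integ0 a b); apply: integ_le => //; cont. Qed.

Lemma integ_norm_le f a b c : continuous f -> a <= b ->
  (forall x, a <= x <= b -> `|f x| <= c) -> `|integ a b f| <= c * (b - a).
Proof.
move=> cf ab fc; rewrite ler_norml -mulNr -!integ_cst.
by apply/andP; split; apply: integ_le => //; cont; move=> x /fc; rewrite ler_norml => /andP[].
Qed.

Lemma integ_split f a b c : integ a b f + integ b c f = integ a c f.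
Proof. by rewrite /integ; ring. Qed.

Lemma integ_shift f a b c : continuous f ->
  integ a b (fun x => f (x + c)) = integ (a + c) (b + c) f.
Proof.
move=> cf; have d x : is_derive x 1 (fun x => primitive f (x + c)) (f (x + c)).
  have d : is_derive x 1 (fun x => x + c) 1 by der; rewrite addr0.
  have := is_derive_comp_fun _ (fun x => x + c) x _ _ (primitive_derive _ cf (x + c)) d.
  by rewrite mulr1.
by rewrite (integ_FTC _ _ _ _ d).
Qed.

(** A primitive of a nonnegative function is nondecreasing; with equal values at both ends it is
    constant, so its derivative vanishes inside. *)
Lemma integ_eq0 f a b : continuous f -> (forall x, a <= x <= b -> 0 <= f x) ->
  integ a b f = 0 -> forall x, a < x < b -> f x = 0.
Proof.
move=> cf f0 i0 x /andP[ax xb].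
pose F := primitive f.
have dF := primitive_derive f cf.
have mono u w : a <= u -> u <= w -> w <= b -> F u <= F w.
  move=> au uw wb; apply: (ge0_derive_homo_in _ _ _ _ dF) => // t /andP[ut tw].
  by apply: f0; rewrite (le_trans au ut) (le_trans tw wb).
have eqFx : forall y, a < y < b -> F y = F x.
  move=> y /andP[ay yb].
  have m1 := mono a y (lexx a) (ltW ay) (ltW yb).
  have m2 := mono y b (ltW ay) (ltW yb) (lexx b).
  have m3 := mono a x (lexx a) (ltW ax) (ltW xb).
  have m4 := mono x b (ltW ax) (ltW xb) (lexx b).
  have : F b - F a = 0 by [].
  by lra.
have nF : \forall y \near x, F y = cst (F x) y.
  by near=> y; apply: eqFx; apply/andP; split; near: y; [exact: lt_nbhsr|exact: lt_nbhsl].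
have h := @near_eq_is_derive R R^o R^o F (fun=> F x) x 1 (f x) nF (dF x).
have [_ <-] := h.
by have [_ ->] := is_derive_const (F x) x.
Unshelve. all: by end_near. Qed.

Lemma continuous_integ (T : topologicalType) (h : T -> R -> R) a b : a <= b ->
  continuous (fun z : T * R => h z.1 z.2) -> continuous (fun t => integ a b (h t)).
Proof.
move=> ab ch t0; apply/cvgrPdist_le => e e0.
have ct t : continuous (h t) by cont.
have d0 : 0 < e / (b - a + 1) by rewrite divr_gt0 // ltr_wpDl // subr_ge0.
have /= := near_uniform _ _ `[a, b]%classic _ t0 _ (@segment_compact R a b) ch d0.
apply: filterS => t /= ht.
rewrite -integB //.
have := integ_norm_le (fun x => h t0 x - h t x) a b (e / (b - a + 1)) _ ab.
move=> /(_ _ _)/le_trans; apply.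
- by cont.
- by move=> x xab; rewrite distrC; apply: ltW; apply: ht; rewrite /= in_itv.
- by rewrite mulrAC ler_pdivrMr ?ltr_wpDl ?subr_ge0 // ler_pM2l //; lra.
Qed.

(** The mean value theorem turns each difference quotient into [hx] at an intermediate point; joint
    continuity of [hx] over the compact segment makes the error uniform in the integration
    variable. *)
Lemma is_derive_integ (h hx : R -> R -> R) a b x : a <= b ->
  (forall x y, is_derive x 1 (h^~ y) (hx x y)) ->
  (forall x, continuous (h x)) ->
  continuous (fun z : R * R => hx z.1 z.2) ->
  is_derive x 1 (fun x => integ a b (h x)) (integ a b (hx x)).
Proof.
move=> ab dh ch chx; apply: is_derive_approx => e e0.
have chx' t : continuous (hx t) by cont.
have d0 : 0 < e / (b - a + 1) by rewrite divr_gt0 // ltr_wpDl // subr_ge0.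
have /= := near_uniform _ _ `[a, b]%classic _ x _ (@segment_compact R a b) chx d0.
move=> /nbhs_ballP[r /= r0 hr].
near=> y.
have yx : `|x - y| < r by near: y; apply: nbhsx_ballx.
rewrite -integZ // -!integB //; try by cont.
have H := integ_norm_le (fun t => h y t - h x t - (y - x) * hx x t) a b
   (e / (b - a + 1) * `|y - x|) _ ab _.
apply: (le_trans (H _ _)).
- by cont.
- move=> t tab.
  have [c [-> c1 c2]] := mean_value _ _ x y (fun x => dh x t).
  rewrite [X in _ - X]mulrC -mulrBl normrM ler_wpM2r //.
  apply: ltW; apply: hr => /=; last by rewrite in_itv.
  move: c1 c2 yx; rewrite /ball /= /Num.min /Num.max; case: ltP => xy c1 c2.
    by rewrite !ltr_norml; lra.
  by rewrite !ltr_norml; lra.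
- rewrite [_ * `|_|]mulrC -mulrA [leRHS]mulrC ler_wpM2l //.
  by rewrite mulrAC ler_pdivrMr ?ltr_wpDl ?subr_ge0 // ler_pM2l //; lra.
Unshelve. all: by end_near. Qed.

End Integral.

(** * Linear differential equations with parameters *)

Section FiniteSums.
Context {R : realType} {I : finType}.
Implicit Types (y : I -> R).

Lemma sqr_sum_le y : (\sum_i y i) ^+ 2 <= #|I|%:R * \sum_i y i ^+ 2.
Proof.
have h : (\sum_i y i) ^+ 2 = \sum_i \sum_j y i * y j.
  rewrite expr2 mulr_suml; apply: eq_bigr => i _; by rewrite mulr_sumr.
have h2 : \sum_i \sum_j (y i ^+ 2 + y j ^+ 2) = 2 * (#|I|%:R * \sum_i y i ^+ 2).
  under eq_bigr => i _ do rewrite big_split /= sumr_const -mulr_natl.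
  rewrite big_split /= -mulr_sumr sumr_const -mulr_natl; ring.
rewrite -(ler_pM2l (x := 2)) // -h2 h mulr_sumr; apply: ler_sum => i _.
rewrite mulr_sumr; apply: ler_sum => j _.
have := sqr_ge0 (y i - y j); nra.
Qed.

Lemma norm_sum_mul_le (a b : I -> R) (M : R) : (forall i, `|a i| <= M) ->
  `|\sum_i a i * b i| <= M * \sum_i `|b i|.
Proof.
move=> aM; rewrite mulr_sumr (le_trans (ler_norm_sum _ _ _)) //.
by apply: ler_sum => i _; rewrite normrM ler_wpM2r.
Qed.

End FiniteSums.

Section Sequences.
Context {R : realType}.

Lemma halves_eq0 (x C : R) : (forall n, `|x| <= C * 2^-1 ^+ n) -> x = 0.
Proof.
move=> h; apply/eqP; rewrite -normr_le0 leNgt; apply/negP => x0.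
have C0 : 0 < C by have := h 0%N; rewrite expr0 mulr1; apply: lt_le_trans.
have c : (C * 2^-1 ^+ n @[n --> \oo]) --> (C * 0 : R).
  by apply: cvgMr; apply: cvg_expr; rewrite ger0_norm ?invr_ge0 // invf_lt1 // ltr1n.
rewrite mulr0 in c.
have /cvgr_lt/(_ _ x0) := c.
case=> n _ /(_ n (leqnn n)) /=.
by rewrite ltNge h.
Qed.

(** The limit is the supremum of the nondecreasing lower bounds [a n], which lie below all the
    nonincreasing upper bounds [b m]; this yields the rate together with the limit. *)
Lemma halves_cvg (u : nat -> R) (C : R) :
  (forall n, `|u n.+1 - u n| <= C * 2^-1 ^+ n) ->
  exists l, forall n, `|u n - l| <= 2 * C * 2^-1 ^+ n.
Proof.
move=> h.
pose a n := u n - 2 * C * 2^-1 ^+ n; pose b n := u n + 2 * C * 2^-1 ^+ n.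
have C0 n : 0 <= C * 2^-1 ^+ n by apply: le_trans (h n).
have am n m : a n <= a (n + m)%N.
  elim: m => [|m IH]; first by rewrite addn0.
  rewrite addnS (le_trans IH) // /a exprS.
  by have := h (n + m)%N; rewrite ler_norml => /andP[]; lra.
have bm n m : b (n + m)%N <= b n.
  elim: m => [|m IH]; first by rewrite addn0.
  rewrite addnS (le_trans _ IH) // /b exprS.
  by have := h (n + m)%N; rewrite ler_norml => /andP[]; lra.
have ab n m : a n <= b m.
  apply: (le_trans (am n m)); rewrite (le_trans _ (bm m n)) // addnC /a /b.
  by have := C0 (m + n)%N; lra.
exists (sup (range a)) => n.
have ub : has_ubound (range a) by exists (b 0%N) => _ [k _ <-].
have l1 : a n <= sup (range a) by apply: ub_le_sup => //; exists n.
have l2 : sup (range a) <= b n.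
  by apply: ge_sup; [exists (a 0%N), 0%N|move=> _ [k _ <-]].
by rewrite ler_norml; move: l1 l2; rewrite /a /b; lra.
Qed.

(** The convergence is only locally uniform: near [t0] the factor [w] stays below [w t0 + 1]. *)
Lemma halves_continuous (T : topologicalType) (y : T -> R) (yn : nat -> T -> R) (w : T -> R) :
  (forall n, continuous (yn n)) -> continuous w ->
  (forall n t, `|yn n t - y t| <= w t * 2^-1 ^+ n) -> continuous y.
Proof.
move=> cy cw h t0; apply/cvgrPdist_le => e e0.
have w0 t : 0 <= w t by have := h 0%N t; rewrite expr0 mulr1; apply: le_trans.
pose D := w t0 + 1.
have D0 : 0 < D by rewrite ltr_wpDl.
have c : (D * 2^-1 ^+ n @[n --> \oo]) --> (D * 0 : R).
  by apply: cvgMr; apply: cvg_expr; rewrite ger0_norm ?invr_ge0 // invf_lt1 // ltr1n.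
rewrite mulr0 in c.
have e3 : 0 < e / 3 by rewrite divr_gt0.
have /cvgr_lt/(_ _ e3) := c.
case=> n _ /(_ n (leqnn n)) /= hn.
have /cvgrPdist_lt/(_ _ e3) h1 := cy n t0.
have w1 : w t0 < D by rewrite /D ltrDl.
have /cvgr_lt/(_ _ w1) h2 := cw t0.
apply: filterS2 h1 h2 => t h1 h2.
have p0 : 0 <= 2^-1 ^+ n :> R by rewrite exprn_ge0 ?invr_ge0.
have a1 : `|yn n t0 - y t0| <= D * 2^-1 ^+ n.
  by apply: le_trans (h n t0) _; rewrite ler_wpM2r // ltW.
have a2 : `|yn n t - y t| <= D * 2^-1 ^+ n.
  by apply: le_trans (h n t) _; rewrite ler_wpM2r // ltW.
move: h1 a1 a2 hn; rewrite !ler_norml !ltr_norml; lra.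
Qed.

End Sequences.

Section Weights.
Context {R : realType}.
Implicit Types (s t x : R).

(** This is 2 cosh (K t). In the sup norm with this weight, integration from [t0] has norm at most
    1/K ([weight_bound]), so for large [K] a Picard iteration contracts on the whole line at
    once. *)
Definition weight (K t : R) : R := expR (K * t) + expR (- (K * t)).

Lemma weight_ge1 K t : 1 <= weight K t.
Proof.
rewrite /weight; have := expR_ge1Dx (K * t); have := expR_ge1Dx (- (K * t)).
by have := expR_gt0 (K * t); have := expR_gt0 (- (K * t)); lra.
Qed.

Lemma continuous_weight K t0 : continuous (fun t => weight K (t - t0)).
Proof. by rewrite /weight; cont. Qed.

Lemma weight_bound (K C t0 : R) (f f' : R -> R) : 0 < K -> f t0 = 0 ->
  (forall t, is_derive t 1 f (f' t)) ->
  (forall t, `|f' t| <= C * weight K (t - t0)) ->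
  forall t, `|f t| <= C / K * weight K (t - t0).
Proof.
move=> K0 f0 df hf t.
have C0 : 0 <= C.
  have := hf t; have := weight_ge1 K (t - t0); have := normr_ge0 (f' t); nra.
have CK : 0 <= C / K by rewrite divr_ge0 // ltW.
pose g t := C / K * (expR (K * (t - t0)) - expR (- (K * (t - t0)))).
have dg x : is_derive x 1 g (C * weight K (x - t0)).
  by rewrite /g; der; rewrite /weight; field; rewrite gt_eqF.
have g0 : g t0 = 0 by rewrite /g subrr mulr0 oppr0 subrr mulr0.
have dp x : is_derive x 1 (fun x => g x + f x) (C * weight K (x - t0) + f' x) by der.
have dm x : is_derive x 1 (fun x => g x - f x) (C * weight K (x - t0) - f' x) by der.
have pp x : 0 <= C * weight K (x - t0) + f' x.
  by have := hf x; rewrite ler_norml; lra.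
have pm x : 0 <= C * weight K (x - t0) - f' x.
  by have := hf x; rewrite ler_norml; lra.
have e1 := expR_gt0 (K * (t - t0)); have e2 := expR_gt0 (- (K * (t - t0))).
have : `|g t| <= C / K * weight K (t - t0).
  rewrite /g /weight normrM (ger0_norm CK) ler_wpM2l // ler_norml; lra.
have /orP[tt|tt] := le_total t0 t.
  have := ge0_derive_homo _ _ _ _ dp pp tt; have := ge0_derive_homo _ _ _ _ dm pm tt.
  by rewrite f0 g0 !ler_norml; lra.
have := ge0_derive_homo _ _ _ _ dp pp tt; have := ge0_derive_homo _ _ _ _ dm pm tt.
by rewrite f0 g0 !ler_norml; lra.
Qed.

Lemma derive_le_exp (c : R) (f f' : R -> R) (t0 t : R) : 0 <= c ->
  (forall s, is_derive s 1 f (f' s)) -> (forall s, `|f' s| <= c * f s) ->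
  f t <= f t0 * expR (c * `|t - t0|).
Proof.
move=> c0 df hf.
have /orP[tt|tt] := le_total t0 t.
  rewrite ger0_norm ?subr_ge0 //.
  have d s : is_derive s 1 (fun s => - (f s * expR (- (c * (s - t0)))))
      ((c * f s - f' s) * expR (- (c * (s - t0)))) by der; ring.
  have p s : 0 <= (c * f s - f' s) * expR (- (c * (s - t0))).
    apply: mulr_ge0; last exact: expR_ge0.
    by have := hf s; rewrite ler_norml; lra.
  have := ge0_derive_homo _ _ _ _ d p tt.
  rewrite subrr mulr0 oppr0 expR0 mulr1 lerN2 expRN ler_pdivrMr ?expR_gt0 //.
rewrite ler0_norm ?subr_le0 //.
have d s : is_derive s 1 (fun s => f s * expR (c * (s - t0)))
    ((c * f s + f' s) * expR (c * (s - t0))) by der; ring.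
have p s : 0 <= (c * f s + f' s) * expR (c * (s - t0)).
  apply: mulr_ge0; last exact: expR_ge0.
  by have := hf s; rewrite ler_norml; lra.
have := ge0_derive_homo _ _ _ _ d p tt.
by rewrite subrr mulr0 expR0 mulr1 mulrN expRN ler_pdivlMr ?expR_gt0.
Qed.

End Weights.

(** * Existence and uniqueness for linear systems *)

Section LinearODE.
Context {R : realType} {I : finType}.
Implicit Types (s t x : R).
Let n : R := #|I|%:R.

(** The exponent comes from [E], the sum of [eps ^+ 2] and the squares of the [y i]. With [S] the
    sum of the [|y i|] and [Q] that of their squares, |E'| is at most 2 M S^2 + n eps^2 + Q, and S^2
    <= n Q. The bound is linear in [eps], as needed for estimating differences and difference
    quotients of solutions. *)
Lemma gronwall (y dy : I -> R -> R) (M eps t0 : R) : 0 <= M -> 0 <= eps ->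
  (forall i t, is_derive t 1 (y i) (dy i t)) ->
  (forall i t, `|dy i t| <= M * \sum_j `|y j t| + eps) ->
  (forall i, y i t0 = 0) ->
  forall i t, `|y i t| <= eps * expR ((2 * M * n + n + 1) * `|t - t0|).
Proof.
move=> M0 eps0 dY hY y0 i t.
set c := 2 * M * n + n + 1.
have n0 : 0 <= n by [].
have c0 : 0 <= c by rewrite /c; have := mulr_ge0 M0 n0; nra.
pose E t := eps ^+ 2 + \sum_i y i t * y i t.
have dE s : is_derive s 1 E (\sum_i (dy i s * y i s + y i s * dy i s)).
  by rewrite /E; der; rewrite add0r.
have hE s : `|\sum_i (dy i s * y i s + y i s * dy i s)| <= c * E s.
  set S := \sum_j `|y j s|.
  have S2 : S ^+ 2 <= n * \sum_i y i s * y i s.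
    apply: le_trans (sqr_sum_le _) _; rewrite ler_wpM2l //.
    by apply: ler_sum => j _; rewrite real_normK ?num_real.
  have h1 : `|\sum_i (dy i s * y i s + y i s * dy i s)| <=
     \sum_i (2 * (M * S) * `|y i s| + (eps ^+ 2 + y i s * y i s)).
    apply: le_trans (ler_norm_sum _ _ _) _; apply: ler_sum => j _.
    rewrite (_ : _ + _ = 2 * (dy j s * y j s)); last by ring.
    rewrite !normrM ger0_norm //.
    have h := hY j s; rewrite -/S in h.
    have yy : y j s * y j s = `|y j s| * `|y j s| by rewrite -normrM ger0_norm // -expr2 sqr_ge0.
    rewrite yy; have yj := normr_ge0 (y j s).
    have := ler_wpM2r yj h; have := sqr_ge0 (eps - `|y j s|); nra.
  apply: le_trans h1 _; rewrite !big_split /= sumr_const -mulr_sumr -/S -mulr_natl -/n.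
  rewrite /c /E; set Q := \sum_i _ in S2 *.
  have Q0 : 0 <= Q by apply: sumr_ge0 => j _; rewrite -expr2 sqr_ge0.
  have := ler_wpM2l M0 S2; have := sqr_ge0 eps; have := mulr_ge0 M0 n0.
  move=> a1 a2 a3; have b1 := mulr_ge0 a1 a2; have b2 := mulr_ge0 n0 Q0.
  nra.
have := derive_le_exp _ _ _ t0 t c0 dE hE.
have -> : E t0 = eps ^+ 2.
  by rewrite /E big1 ?addr0 // => j _; rewrite y0 mul0r.
set X := c * `|t - t0|.
have X0 : 0 <= X by rewrite mulr_ge0.
have e1 : 1 <= expR X by have := expR_ge1Dx X; lra.
move=> h; have yE : y i t ^+ 2 <= E t.
  rewrite /E (bigD1 i) //= expr2.
  have : 0 <= \sum_(j | j != i) y j t * y j t by apply: sumr_ge0 => j _; rewrite -expr2 sqr_ge0.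
  by have := sqr_ge0 eps; lra.
rewrite -(ler_pXn2r (n := 2)) ?nnegrE //; last by rewrite mulr_ge0 ?expR_ge0.
rewrite real_normK ?num_real // (le_trans yE) // (le_trans h) //.
rewrite exprMn ler_wpM2l ?sqr_ge0 // expr2 ler_peMr // expR_ge0.
Qed.

Lemma linear_ode_unique (A : I -> I -> R -> R) (y z : I -> R -> R) (M t0 : R) :
  0 <= M -> (forall i j t, `|A i j t| <= M) ->
  (forall i t, is_derive t 1 (y i) (\sum_j A i j t * y j t)) ->
  (forall i t, is_derive t 1 (z i) (\sum_j A i j t * z j t)) ->
  (forall i, y i t0 = z i t0) -> forall i t, y i t = z i t.
Proof.
move=> M0 hA dy dz yz i t.
have d j s : is_derive s 1 (fun s => y j s - z j s) (\sum_k A j k s * (y k s - z k s)).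
  by der; rewrite -sumrB; apply: eq_bigr => k _; rewrite mulrBr.
have b j s : `|\sum_k A j k s * (y k s - z k s)| <= M * (\sum_k `|y k s - z k s|) + 0.
  by rewrite addr0 norm_sum_mul_le.
have e j : y j t0 - z j t0 = 0 by rewrite yz subrr.
have := gronwall (fun j s => y j s - z j s) _ M 0 t0 M0 (lexx _) d b e i t.
by rewrite mul0r normr_le0 subr_eq0 => /eqP.
Qed.

Section Picard.
Variables (A : I -> I -> R -> R) (M t0 : R) (y0 : I -> R).
Hypothesis cA : forall i j, continuous (A i j).
Hypothesis hA : forall i j t, `|A i j t| <= M.

Fixpoint picard (k : nat) (i : I) (t : R) : R :=
  if k is k'.+1 then y0 i + integ t0 t (fun s => \sum_j A i j s * picard k' j s)
  else y0 i.

Lemma continuous_picard k i : continuous (picard k i).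
Proof.
elim: k i => [|k IH] i /=; first by cont.
have c : continuous (fun s => \sum_j A i j s * picard k j s) by cont.
have d := primitive_derive _ c; rewrite /integ.
by move: (is_derive_continuous _ _ d) => cp; cont.
Qed.

Lemma picard_derive k i t :
  is_derive t 1 (picard k.+1 i) (\sum_j A i j t * picard k j t).
Proof.
have cp := continuous_picard k.
have c : continuous (fun s => \sum_j A i j s * picard k j s) by cont.
by rewrite /= /integ; have d := primitive_derive _ c; der; rewrite add0r addr0.
Qed.

Lemma linear_ode_exists : exists y : I -> R -> R,
  (forall i t, is_derive t 1 (y i) (\sum_j A i j t * y j t)) /\
  (forall i, y i t0 = y0 i).
Proof.
have n0 : 0 <= n by [].
pose M' := `|M| + 1.
have M'0 : 0 < M' by rewrite ltr_wpDl.
have hA' i j t : `|A i j t| <= M'.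
  by rewrite (le_trans (hA i j t)) // (le_trans (ler_norm M)) // lerDl.
(* This [K] makes [n * M' / K] at most 1/2, so every Picard step halves the weighted distance. *)
pose K := 2 * (n + 1) * M'.
have K0 : 0 < K by rewrite !mulr_gt0 // ltr_wpDl.
pose C := M' * (\sum_j `|y0 j|) / K.
pose w t := weight K (t - t0).
have w1 t : 1 <= w t by exact: weight_ge1.
have nMK : n * M' / K <= 2^-1.
  rewrite ler_pdivrMr // /K; nra.
have init k i : picard k i t0 = y0 i.
  by case: k => // k /=; rewrite /integ subrr addr0.
have step k i t : `|picard k.+1 i t - picard k i t| <= C * w t * 2^-1 ^+ k.
  elim: k i t => [|k IH] i t.
    have d s : is_derive s 1 (fun s => picard 1 i s - y0 i) (\sum_j A i j s * y0 j).
      by have d := picard_derive 0 i; der; exact: addr0.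
    have z : picard 1 i t0 - y0 i = 0 by rewrite init subrr.
    have b s : `|\sum_j A i j s * y0 j| <= (M' * \sum_j `|y0 j|) * w s.
      rewrite (le_trans (norm_sum_mul_le _ _ M' _)) //.
      rewrite -[X in X <= _]mulr1 ler_wpM2l // mulr_ge0 ?(ltW M'0) //.
      exact: sumr_ge0.
    have := weight_bound _ _ _ (fun s => picard 1 i s - y0 i) _ K0 z d b t.
    by rewrite expr0 mulr1.
  have d s : is_derive s 1 (fun s => picard k.+2 i s - picard k.+1 i s)
      (\sum_j A i j s * (picard k.+1 j s - picard k j s)).
    have d1 := picard_derive k.+1 i; have d2 := picard_derive k i.
    by der; rewrite -sumrB; apply: eq_bigr => j _; rewrite mulrBr.
  have b s : `|\sum_j A i j s * (picard k.+1 j s - picard k j s)| <=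
      (n * M' * C * 2^-1 ^+ k) * w s.
    rewrite (le_trans (norm_sum_mul_le _ _ M' _)) //.
    apply: (@le_trans _ _ (M' * \sum_(j : I) C * w s * 2^-1 ^+ k)).
      by rewrite ler_wpM2l ?(ltW M'0) // ler_sum.
    by rewrite sumr_const -[X in M' * X]mulr_natl -/n le_eqVlt; apply/orP; left; apply/eqP; ring.
  have z : picard k.+2 i t0 - picard k.+1 i t0 = 0 by rewrite !init subrr.
  have := weight_bound _ _ _ (fun s => picard k.+2 i s - picard k.+1 i s) _ K0 z d b t.
  move/le_trans; apply.
  have q0 : 0 <= C * w t * 2^-1 ^+ k by apply: le_trans (IH i t).
  rewrite exprS (_ : _ * weight _ _ = (n * M' / K) * (C * w t * 2^-1 ^+ k)); last by rewrite /w; ring.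
  by rewrite [leRHS](_ : _ = 2^-1 * (C * w t * 2^-1 ^+ k)); [rewrite ler_wpM2r|ring].
have lim i t := halves_cvg (fun k => picard k i t) (C * w t) (fun k => step k i t).
pose y i t := sval (cid (lim i t)).
have hy i t k : `|picard k i t - y i t| <= 2 * (C * w t) * 2^-1 ^+ k.
  exact: (svalP (cid (lim i t)) k).
have cw : continuous (fun t => 2 * (C * w t)).
  by have := continuous_weight K t0; rewrite -/w => ?; cont.
have cy i : continuous (y i).
  exact: (halves_continuous _ _ (fun k => picard k i) _ (continuous_picard ^~ i) cw).
have cAy i : continuous (fun s => \sum_j A i j s * y j s) by cont.
pose z i t := y0 i + integ t0 t (fun s => \sum_j A i j s * y j s).
have dz i t : is_derive t 1 (z i) (\sum_j A i j t * y j t).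
  by rewrite /z /integ; have d := primitive_derive _ (cAy i); der; rewrite add0r addr0.
(* Both the limit [y] and the function [z] obtained by integrating its right-hand side are within
   O(2^-k) of iterate k + 1; hence [y] is itself differentiable. *)
have zy i t : z i t - y i t = 0.
  pose C' := n * M' * (2 * C) / K + C.
  apply: (halves_eq0 _ (C' * w t)) => k.
  have d s : is_derive s 1 (fun s => z i s - picard k.+1 i s)
      (\sum_j A i j s * (y j s - picard k j s)).
    have d2 := picard_derive k i.
    by der; rewrite -sumrB; apply: eq_bigr => j _; rewrite mulrBr.
  have b s : `|\sum_j A i j s * (y j s - picard k j s)| <=
      (n * M' * (2 * C) * 2^-1 ^+ k) * w s.
    rewrite (le_trans (norm_sum_mul_le _ _ M' _)) //.
    apply: (@le_trans _ _ (M' * \sum_(j : I) 2 * (C * w s) * 2^-1 ^+ k)).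
      by rewrite ler_wpM2l ?(ltW M'0) // ler_sum // => j _; rewrite distrC.
    by rewrite sumr_const -[X in M' * X]mulr_natl -/n le_eqVlt; apply/orP; left; apply/eqP; ring.
  have z0 : z i t0 - picard k.+1 i t0 = 0 by rewrite init /z /integ subrr addr0 subrr.
  have h1 := weight_bound _ _ _ (fun s => z i s - picard k.+1 i s) _ K0 z0 d b t.
  have h2 := hy i t k.+1.
  rewrite (_ : _ - _ = (z i t - picard k.+1 i t) + (picard k.+1 i t - y i t)); last by ring.
  rewrite (le_trans (ler_normD _ _)) // (le_trans (lerD h1 h2)) //.
  rewrite exprS /C' le_eqVlt; apply/orP; left; apply/eqP.
  by rewrite /w; field; rewrite gt_eqF.
have ezy i : z i = y i by apply/funext => t; apply/eqP; rewrite -subr_eq0 zy.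
exists y; split => [i t|i]; first by rewrite -ezy.
by rewrite -ezy /z /integ subrr addr0.
Qed.

End Picard.
End LinearODE.

(** * Continuity and differentiability in parameters *)

Section ParameterDependence.
Context {R : realType} {I : finType}.
Implicit Types (q b t : R).

Lemma compact_norm_bounded (S : topologicalType) (K : set S) (f : S -> R) :
  compact K -> continuous f -> exists2 B, 0 <= B & forall s, K s -> `|f s| <= B.
Proof.
move=> cK cf.
have /compact_bounded : compact (f @` K).
  by apply: continuous_compact => //; exact: continuous_subspaceT.
move=> [B0 [_ hB]]; exists (`|B0| + 1) => [|s Ks]; first by rewrite addr_ge0.
by apply: (hB (`|B0| + 1)); [rewrite (le_lt_trans (ler_norm _)) ?ltrDl|exists s].
Qed.

Lemma near_coefficients (T : topologicalType) (A : I -> I -> T -> R -> R)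
    (L d : R) (p0 : T) : 0 < d ->
  (forall i j, continuous (fun z : T * R => A i j z.1 z.2)) ->
  \forall p \near p0, forall i j t, `|t| <= L -> `|A i j p t - A i j p0 t| < d.
Proof.
move=> d0 cA; apply: filter_forall => j; apply: filter_forall => k.
have := near_uniform _ _ `[- L, L]%classic _ p0 _ (@segment_compact _ _ _) (cA j k) d0.
by apply: filterS => p hp t tL; apply: hp; rewrite /= in_itv /= -ler_norml.
Qed.

(** The difference of the solutions for [z.1] and [p0] satisfies the system for [z.1] with an error
    term, the difference of the coefficients applied to the solution for [p0]. The coefficients
    vanish for |t| >= L, so uniform closeness on a compact segment controls this error for all
    times, and Grönwall applies. *)
Lemma continuous_linear_ode (T : topologicalType) (A : I -> I -> T -> R -> R)
    (Y : I -> T -> R -> R) (M L t0 : R) (y0 : I -> R) :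
  (forall i j, continuous (fun z : T * R => A i j z.1 z.2)) ->
  (forall i j p t, `|A i j p t| <= M) ->
  (forall i j p t, L <= `|t| -> A i j p t = 0) ->
  (forall i p t, is_derive t 1 (Y i p) (\sum_j A i j p t * Y j p t)) ->
  (forall i p, Y i p t0 = y0 i) ->
  forall i, continuous (fun z : T * R => Y i z.1 z.2).
Proof.
move=> cA hA sA dY iY i [p0 t1]; apply/cvgrPdist_le => /= e e0.
have [I0|I0] := posnP #|I|.
  by have := fintype0 i; rewrite I0.
have M0 : 0 <= M by apply: le_trans (hA i i p0 0).
have cY j : continuous (Y j p0) by exact: is_derive_continuous (dY j p0).
have cS : continuous (fun t => \sum_j `|Y j p0 t|).
  by apply: continuous_big => j t; apply: cvg_norm; exact: cY.
have [B B0 hB] := compact_norm_bounded _ `[- L, L]%classic _ (@segment_compact _ _ _) cS.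
pose n : R := #|I|%:R.
pose c := 2 * M * n + n + 1.
have c0 : 0 <= c by rewrite /c !addr_ge0 // !mulr_ge0.
(* [X] bounds the Grönwall factor for all times within 1 of [t1]; [d] is then chosen so that d (B +
   1) X = e / 2. *)
pose X := expR (c * (`|t1 - t0| + 1)).
have X0 : 0 < X by exact: expR_gt0.
pose d := e / 2 / ((B + 1) * X).
have B1 : 0 < B + 1 by rewrite ltr_wpDl.
have d0 : 0 < d by rewrite !divr_gt0 // mulr_gt0.
have near_A := near_coefficients _ A L d p0 d0 cA.
have near_t : \forall t \near t1, `|t1 - t| < 1 by apply: nbhsx_ballx.
have e2 : 0 < e / 2 by rewrite divr_gt0.
have near_Y : \forall t \near t1, `|Y i p0 t1 - Y i p0 t| <= e / 2.
  by have /cvgrPdist_le/(_ _ e2) := cY i t1.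
near=> z.
have hz1 : forall j k t, `|t| <= L -> `|A j k z.1 t - A j k p0 t| < d.
  by near: z; apply: cvg_fst near_A.
have hz2 : `|t1 - z.2| < 1 by near: z; apply: cvg_snd near_t.
have hz3 : `|Y i p0 t1 - Y i p0 z.2| <= e / 2 by near: z; apply: cvg_snd near_Y.
have dD j t : is_derive t 1 (fun t => Y j z.1 t - Y j p0 t)
    (\sum_k A j k z.1 t * (Y k z.1 t - Y k p0 t) + \sum_k (A j k z.1 t - A j k p0 t) * Y k p0 t).
  by der; rewrite -sumrB -big_split; apply: eq_bigr => k _ /=; ring.
have bD j t : `|\sum_k A j k z.1 t * (Y k z.1 t - Y k p0 t) + \sum_k (A j k z.1 t - A j k p0 t) * Y k p0 t|
    <= M * (\sum_k `|Y k z.1 t - Y k p0 t|) + d * (B + 1).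
  rewrite (le_trans (ler_normD _ _)) // lerD ?norm_sum_mul_le //.
  have [tL|tL] := leP `|t| L; last first.
    rewrite big1 ?normr0; first by rewrite mulr_ge0 ?(ltW d0) ?(ltW B1).
    by move=> k _; rewrite !sA ?ltW // subrr mul0r.
  apply: (le_trans (norm_sum_mul_le _ _ d _)).
    by move=> k; apply: ltW; exact: hz1.
  rewrite ler_wpM2l ?(ltW d0) // (le_trans (ler_norm _)) //.
  by rewrite (le_trans (hB t _)) ?lerDl //= in_itv /= -ler_norml.
have iD j : Y j z.1 t0 - Y j p0 t0 = 0 by rewrite !iY subrr.
have dB0 : 0 <= d * (B + 1) by rewrite mulr_ge0 ?(ltW d0) ?(ltW B1).
have := gronwall (fun j t => Y j z.1 t - Y j p0 t) _ M _ t0 M0 dB0 dD bD iD i z.2.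
rewrite -/n -/c => h1.
have h2 : expR (c * `|z.2 - t0|) <= X.
  rewrite ler_expR ler_wpM2l //.
  move: hz2; rewrite ltr_norml => /andP[a1 a2].
  have a3 : `|z.2 - t0| <= `|t1 - t0| + `|z.2 - t1|.
    by rewrite (_ : z.2 - t0 = (t1 - t0) + (z.2 - t1)) ?ler_normD //; ring.
  by rewrite (le_trans a3) // lerD2l ler_norml; lra.
have h3 : `|Y i z.1 z.2 - Y i p0 z.2| <= e / 2.
  apply: (le_trans h1); rewrite (le_trans (ler_wpM2l dB0 h2)) //.
  by rewrite /d le_eqVlt; apply/orP; left; apply/eqP; field; rewrite !gt_eqF.
rewrite (_ : _ - _ = (Y i p0 t1 - Y i p0 z.2) - (Y i z.1 z.2 - Y i p0 z.2)); last by ring.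
by rewrite (le_trans (ler_normB _ _)) // (splitr e) lerD.
Unshelve. all: by end_near. Qed.

(** [Z] solves the variational equation. Grönwall is applied to the remainder Y(q) - Y(q0) - h
    Z(q0), whose equation has an error at most d |h| (B + 1) with [d] arbitrarily small; linearity
    of the bound in this error gives o(h). *)
Lemma derive_linear_ode (A Aq : I -> I -> R -> R -> R) (Y Z : I -> R -> R -> R)
    (M L t0 : R) (y0 : I -> R) :
  (forall i j, continuous (fun z : R * R => A i j z.1 z.2)) ->
  (forall i j, continuous (fun z : R * R => Aq i j z.1 z.2)) ->
  (forall i j q t, is_derive q 1 (A i j ^~ t) (Aq i j q t)) ->
  (forall i j q t, `|A i j q t| <= M) ->
  (forall i j q t, L <= `|t| -> A i j q t = 0) ->
  (forall i q t, is_derive t 1 (Y i q) (\sum_j A i j q t * Y j q t)) ->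
  (forall i q, Y i q t0 = y0 i) ->
  (forall i q t, is_derive t 1 (Z i q)
     (\sum_j (Aq i j q t * Y j q t + A i j q t * Z j q t))) ->
  (forall i q, Z i q t0 = 0) ->
  forall i q t, is_derive q 1 (fun q => Y i q t) (Z i q t).
Proof.
move=> cA cAq dA hA sA dY iY dZ iZ i q0 t1; apply: is_derive_approx => e e0.
have M0 : 0 <= M by apply: le_trans (hA i i q0 0).
have cY j : continuous (Y j q0) by exact: is_derive_continuous (dY j q0).
have cZ j : continuous (Z j q0) by exact: is_derive_continuous (dZ j q0).
have sAq j k q t : L <= `|t| -> Aq j k q t = 0.
  move=> tL; have [_ <-] := dA j k q t.
  rewrite (_ : (fun q => _) = fun=> 0); last by apply/funext => r; exact: sA.
  by have [_ ->] := is_derive_const (0 : R) q.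
have cS : continuous (fun t => \sum_j (`|Y j q0 t| + `|Z j q0 t|)).
  by apply: continuous_big => j t; apply: cvgD; apply: cvg_norm; [exact: cY|exact: cZ].
have [B B0 hB] := compact_norm_bounded _ `[- L, L]%classic _ (@segment_compact _ _ _) cS.
pose n : R := #|I|%:R.
pose c := 2 * M * n + n + 1.
pose X := expR (c * `|t1 - t0|).
have X0 : 0 < X by exact: expR_gt0.
have B1 : 0 < B + 1 by rewrite ltr_wpDl.
pose d := e / ((B + 1) * X).
have d0 : 0 < d by rewrite !divr_gt0 // mulr_gt0.
have near_A := near_coefficients _ A L d q0 d0 cA.
have near_Aq := near_coefficients _ Aq L d q0 d0 cAq.
move: near_Aq => /nbhs_ballP[r /= r0 hr].
near=> q.
have hq1 : forall j k t, `|t| <= L -> `|A j k q t - A j k q0 t| < d by near: q.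
have hq2 : `|q0 - q| < r by near: q; apply: nbhsx_ballx.
have hq3 j k t : `|t| <= L -> `|A j k q t - A j k q0 t - (q - q0) * Aq j k q0 t| <= d * `|q - q0|.
  move=> tL; have [a [-> a1 a2]] := mean_value _ _ q0 q (fun x => dA j k x t).
  rewrite [X in _ - X]mulrC -mulrBl normrM ler_wpM2r //.
  apply: ltW; apply: hr => //.
  move: a1 a2 hq2; rewrite /ball /= /Num.min /Num.max; case: ltP => _ a1 a2.
    by rewrite !ltr_norml; lra.
  by rewrite !ltr_norml; lra.
pose h := q - q0.
pose rest j t := \sum_k (A j k q t - A j k q0 t - h * Aq j k q0 t) * Y k q0 t +
  \sum_k (h * (A j k q t - A j k q0 t)) * Z k q0 t.
have dD j t : is_derive t 1 (fun t => Y j q t - Y j q0 t - h * Z j q0 t)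
    (\sum_k A j k q t * (Y k q t - Y k q0 t - h * Z k q0 t) + rest j t).
  der; rewrite /rest mul0r add0r mulr_sumr -!big_split /= -sumrB -sumrB.
  by apply: eq_bigr => k _ /=; ring.
have bD j t : `|\sum_k A j k q t * (Y k q t - Y k q0 t - h * Z k q0 t) + rest j t|
    <= M * (\sum_k `|Y k q t - Y k q0 t - h * Z k q0 t|) + d * `|h| * (B + 1).
  rewrite (le_trans (ler_normD _ _)) // lerD ?norm_sum_mul_le //.
  have dh : 0 <= d * `|h| by rewrite mulr_ge0 // ltW.
  have [tL|tL] := leP `|t| L; last first.
    rewrite /rest !big1 ?addr0 ?normr0; first by rewrite mulr_ge0 ?(ltW B1).
      by move=> k _; rewrite !sA ?ltW // subrr mulr0 mul0r.
    by move=> k _; rewrite !sA ?sAq ?ltW // mulr0 !subr0 mul0r.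
  apply: (@le_trans _ _ (d * `|h| * (\sum_k `|Y k q0 t|) + d * `|h| * (\sum_k `|Z k q0 t|))).
    rewrite /rest (le_trans (ler_normD _ _)) // lerD // norm_sum_mul_le // => k.
      exact: hq3.
    by rewrite normrM mulrC ler_wpM2r // ltW // hq1.
  rewrite -mulrDr -big_split ler_wpM2l //= (le_trans (ler_norm _)) //.
  by rewrite (le_trans (hB t _)) ?lerDl //= in_itv /= -ler_norml.
have iD j : Y j q t0 - Y j q0 t0 - h * Z j q0 t0 = 0 by rewrite !iY iZ mulr0 !subrr.
have dB0 := mulr_ge0 (mulr_ge0 (ltW d0) (normr_ge0 h)) (ltW B1).
have := gronwall (fun j t => Y j q t - Y j q0 t - h * Z j q0 t) _ M _ t0 M0 dB0 dD bD iD i t1.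
rewrite -/n -/c -/X => /le_trans; apply.
rewrite /d -/h le_eqVlt; apply/orP; left; apply/eqP; field.
by rewrite !gt_eqF.
Unshelve. all: by end_near. Qed.

End ParameterDependence.

Section Family.
Context {R : realType} {I : finType}.
Implicit Types (q b t : R).

(** The parameter derivative is obtained together with the solution, as the second half of the
    doubled system on [I + I] with blocks A, 0 above Aq, A. Joint continuity of both halves then has
    a single proof. The system is differentiated in [q], while [b] is a continuous parameter. *)
Lemma linear_ode_family (A Aq : I -> I -> R -> R -> R -> R) (M L t0 : R) (y0 : I -> R) :
  (forall i j, continuous (fun z : R * R * R => A i j z.1.1 z.1.2 z.2)) ->
  (forall i j, continuous (fun z : R * R * R => Aq i j z.1.1 z.1.2 z.2)) ->
  (forall i j q b t, is_derive q 1 (fun q => A i j q b t) (Aq i j q b t)) ->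
  (forall i j q b t, `|A i j q b t| <= M) ->
  (forall i j q b t, `|Aq i j q b t| <= M) ->
  (forall i j q b t, L <= `|t| -> A i j q b t = 0) ->
  exists Y Z : I -> R -> R -> R -> R,
  [/\ forall i, continuous (fun z : R * R * R => Y i z.1.1 z.1.2 z.2),
      forall i, continuous (fun z : R * R * R => Z i z.1.1 z.1.2 z.2),
      forall i q b t, is_derive t 1 (Y i q b) (\sum_j A i j q b t * Y j q b t),
      forall i q b t, is_derive q 1 (fun q => Y i q b t) (Z i q b t) &
      forall i q b, Y i q b t0 = y0 i].
Proof.
move=> cA cAq dA hA hAq sA.
have sAq j k q b t : L <= `|t| -> Aq j k q b t = 0.
  move=> tL; have [_ <-] := dA j k q b t.
  rewrite (_ : (fun q => _) = fun=> 0); last by apply/funext => r; exact: sA.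
  by have [_ ->] := is_derive_const (0 : R) q.
pose A2 (i j : I + I) (z : R * R) t : R :=
  match i, j with
  | inl i, inl j => A i j z.1 z.2 t
  | inl i, inr j => 0
  | inr i, inl j => Aq i j z.1 z.2 t
  | inr i, inr j => A i j z.1 z.2 t
  end.
pose z0 (i : I + I) : R := if i is inl i then y0 i else 0.
have cA2 i j : continuous (fun z : (R * R) * R => A2 i j z.1 z.2).
  by case: i => i; case: j => j /=; [exact: cA|exact: continuous_const|exact: cAq|exact: cA].
have hA2 i j z t : `|A2 i j z t| <= `|M|.
  by case: i => i; case: j => j /=; rewrite ?normr0 // (le_trans _ (ler_norm M)).
have sA2 i j z t : L <= `|t| -> A2 i j z t = 0.
  by case: i => i; case: j => j /= h; rewrite ?sA ?sAq.
have cA2' i j z : continuous (A2 i j z).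
  exact: (continuous_comp_top _ _ _ _ (cA2 i j) (continuous_pair _ _ _ _
    (continuous_const _ z) (continuous_idfun _))).
have ex z := linear_ode_exists (fun i j => A2 i j z) _ t0 z0 (fun i j => cA2' i j z) (fun i j t => hA2 i j z t).
pose W i z t := sval (cid (ex z)) i t.
have dW i z t : is_derive t 1 (W i z) (\sum_j A2 i j z t * W j z t).
  exact: (proj1 (svalP (cid (ex z)))).
have iW i z : W i z t0 = z0 i by exact: (proj2 (svalP (cid (ex z)))).
have cW := continuous_linear_ode _ A2 W _ L t0 z0 cA2 hA2 sA2 dW iW.
pose Y (i : I) q b t := W (inl i) (q, b) t.
pose Z (i : I) q b t := W (inr i) (q, b) t.
have dY i q b t : is_derive t 1 (Y i q b) (\sum_j A i j q b t * Y j q b t).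
  have := dW (inl i) (q, b) t; rewrite big_sumType /= [X in _ + X]big1 ?addr0 //.
  by move=> j _; rewrite mul0r.
exists Y, Z; split=> //.
- move=> i.
  apply: (continuous_comp_top _ _ (fun w => W (inl i) w.1 w.2)
    (fun z : R * R * R => ((z.1.1, z.1.2), z.2)) (cW (inl i))).
  by cont.
- move=> i.
  apply: (continuous_comp_top _ _ (fun w => W (inr i) w.1 w.2)
    (fun z : R * R * R => ((z.1.1, z.1.2), z.2)) (cW (inr i))).
  by cont.
- move=> i q b t.
  apply: (derive_linear_ode (fun i j q t => A i j q b t) (fun i j q t => Aq i j q b t)
    (fun i q t => Y i q b t) (fun i q t => Z i q b t) M L t0 y0) => //.
  + by move=> j k; cont.
  + by move=> j k; cont.
  + by move=> j k r s; exact: sA.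
  + by move=> j r; rewrite /Y iW.
  + move=> j r s; have := dW (inr j) (r, b) s.
    by rewrite big_sumType big_split.
  + by move=> j r; rewrite /Z iW.
- by move=> i q b; rewrite /Y iW.
Qed.

End Family.

(** * Integrals over a square *)

Definition integ2 {R : realType} (r : R) (g : R -> R -> R) : R :=
  integ (- r) r (fun x => integ (- r) r (g x)).

Section DoubleIntegral.
Context {R : realType} (r : R) (r0 : 0 <= r).
Implicit Types (f g gx : R -> R -> R) (x y h : R).

Let rr : - r <= r. Proof. by rewrite ge0_cp. Qed.

Lemma continuous_integ2_inner (T : topologicalType) (g : T -> R -> R -> R) :
  continuous (fun z : T * R * R => g z.1.1 z.1.2 z.2) ->
  continuous (fun z : T * R => integ (- r) r (g z.1 z.2)).
Proof.
by move=> cg; apply: (continuous_integ (T * R)%type (fun z => g z.1 z.2)).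
Qed.

Lemma continuous_integ2_slice g : continuous (fun z : R * R => g z.1 z.2) ->
  continuous (fun x => integ (- r) r (g x)).
Proof. by move=> cg; apply: continuous_integ. Qed.

Lemma integ2D f g : continuous (fun z : R * R => f z.1 z.2) ->
  continuous (fun z : R * R => g z.1 z.2) ->
  integ2 r (fun x y => f x y + g x y) = integ2 r f + integ2 r g.
Proof.
move=> cf cg; rewrite /integ2 -integD; try exact: continuous_integ2_slice.
congr integ; apply/funext => x; rewrite -integD //; cont.
Qed.

Lemma integ2Z (c : R) f : continuous (fun z : R * R => f z.1 z.2) ->
  integ2 r (fun x y => c * f x y) = c * integ2 r f.
Proof.
move=> cf; rewrite /integ2 -integZ; try exact: continuous_integ2_slice.
congr integ; apply/funext => x; rewrite -integZ //; cont.
Qed.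

Lemma integ2_sum (I : finType) (f : I -> R -> R -> R) :
  (forall i, continuous (fun z : R * R => f i z.1 z.2)) ->
  integ2 r (fun x y => \sum_i f i x y) = \sum_i integ2 r (f i).
Proof.
move=> cf; rewrite /integ2 -integ_sum.
  congr integ; apply/funext => x; rewrite -integ_sum // => i; cont.
by move=> i; exact: continuous_integ2_slice.
Qed.

Lemma integ2_le_in f g : continuous (fun z : R * R => f z.1 z.2) ->
  continuous (fun z : R * R => g z.1 z.2) ->
  (forall x y, - r <= x <= r -> - r <= y <= r -> f x y <= g x y) ->
  integ2 r f <= integ2 r g.
Proof.
move=> cf cg fg; apply: integ_le => //; try exact: continuous_integ2_slice.
move=> x xr; apply: integ_le => //; try by cont.
by move=> y yr; exact: fg.
Qed.

Lemma integ2_le f g : continuous (fun z : R * R => f z.1 z.2) ->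
  continuous (fun z : R * R => g z.1 z.2) ->
  (forall x y, f x y <= g x y) -> integ2 r f <= integ2 r g.
Proof. by move=> cf cg fg; apply: integ2_le_in. Qed.

Lemma integ2_cst (c : R) : integ2 r (fun _ _ => c) = c * (r + r) ^+ 2.
Proof. by rewrite /integ2 !integ_cst; ring. Qed.

Lemma integ2_0 : integ2 r (fun _ _ => 0) = 0.
Proof. by rewrite /integ2 integ0 integ0. Qed.

Lemma integ2_ge0 g : continuous (fun z : R * R => g z.1 z.2) ->
  (forall x y, 0 <= g x y) -> 0 <= integ2 r g.
Proof. by move=> cg g0; rewrite -integ2_0; apply: integ2_le => //; cont. Qed.

Lemma integ2_eq0 g : continuous (fun z : R * R => g z.1 z.2) ->
  (forall x y, 0 <= g x y) -> integ2 r g = 0 ->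
  forall x y, - r < x < r -> - r < y < r -> g x y = 0.
Proof.
move=> cg g0 ig x y xr yr.
apply: (integ_eq0 (g x) (- r) r _ _ _ y yr) => //; first by cont.
apply: (integ_eq0 (fun x => integ (- r) r (g x)) (- r) r _ _ _ x xr) => //.
  exact: continuous_integ2_slice.
by move=> t _; apply: integ_ge0 => //; cont.
Qed.

Lemma integ2_dx g gx : continuous (fun z : R * R => g z.1 z.2) ->
  continuous (fun z : R * R => gx z.1 z.2) ->
  (forall x y, is_derive x 1 (g^~ y) (gx x y)) ->
  (forall x y, r <= `|x| -> g x y = 0) -> integ2 r gx = 0.
Proof.
move=> cg cgx dg sg.
have d x : is_derive x 1 (fun x => integ (- r) r (g x)) (integ (- r) r (gx x)).
  by apply: is_derive_integ => // t; cont.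
have z x : r <= `|x| -> integ (- r) r (g x) = 0.
  move=> rx; rewrite -[RHS](integ0 (- r) r); congr integ; apply/funext => y; exact: sg.
rewrite /integ2 (integ_FTC _ _ _ _ d) !z ?subr0 //.
  by rewrite normrN ger0_norm.
by rewrite ger0_norm.
Qed.

Lemma integ2_dy g gy : (forall x y, is_derive y 1 (g x) (gy x y)) ->
  (forall x y, r <= `|y| -> g x y = 0) -> integ2 r gy = 0.
Proof.
move=> dg sg; rewrite /integ2 -[RHS](integ0 (- r) r); congr integ.
apply/funext => x; rewrite (integ_FTC _ _ _ _ (dg x)) !sg ?subr0 //.
  by rewrite normrN ger0_norm.
by rewrite ger0_norm.
Qed.

Lemma is_derive_integ2 (H Hh : R -> R -> R -> R) h :
  continuous (fun z : R * R * R => H z.1.1 z.1.2 z.2) ->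
  continuous (fun z : R * R * R => Hh z.1.1 z.1.2 z.2) ->
  (forall h x y, is_derive h 1 (fun h => H h x y) (Hh h x y)) ->
  is_derive h 1 (fun h => integ2 r (H h)) (integ2 r (Hh h)).
Proof.
move=> cH cHh dH.
have cI : continuous (fun z : R * R => integ (- r) r (Hh z.1 z.2)).
  exact: continuous_integ2_inner.
have cI0 k : continuous (fun x => integ (- r) r (H k x)).
  by apply: continuous_integ => //; cont.
apply: (is_derive_integ (fun h x => integ (- r) r (H h x))
  (fun h x => integ (- r) r (Hh h x))) => // k x.
by apply: (is_derive_integ (fun h => H h x) (fun h => Hh h x)) => // [t|]; cont.
Qed.

End DoubleIntegral.

(** * Vanishing integral of a Jacobian and the commutator identity *)

Section NullLagrangian.
Context {R : realType} (r : R) (r0 : 0 <= r).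
Implicit Types (x y h : R).
Variables (P Px Py Q Qx Qy : R -> R -> R).
Hypothesis cP : continuous (fun z : R * R => P z.1 z.2).
Hypothesis cPx : continuous (fun z : R * R => Px z.1 z.2).
Hypothesis cPy : continuous (fun z : R * R => Py z.1 z.2).
Hypothesis cQ : continuous (fun z : R * R => Q z.1 z.2).
Hypothesis cQx : continuous (fun z : R * R => Qx z.1 z.2).
Hypothesis cQy : continuous (fun z : R * R => Qy z.1 z.2).
Hypothesis dPx : forall x y, is_derive x 1 (fun x => P x y) (Px x y).
Hypothesis dPy : forall x y, is_derive y 1 (fun y => P x y) (Py x y).
Hypothesis dQx : forall x y, is_derive x 1 (fun x => Q x y) (Qx x y).
Hypothesis dQy : forall x y, is_derive y 1 (fun y => Q x y) (Qy x y).
Hypothesis sP : forall x y, r <= `|x| \/ r <= `|y| -> P x y = 0.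
Hypothesis sQ : forall x y, r <= `|x| \/ r <= `|y| -> Q x y = 0.

Let r10 : 0 <= r + 1. Proof. by rewrite addr_ge0. Qed.

Lemma integ_zero_in (f : R -> R) (a b : R) : continuous f ->
  (forall x, Num.min a b <= x -> x <= Num.max a b -> f x = 0) -> integ a b f = 0.
Proof.
move=> cf h; have [c [e c1 c2]] := mean_value _ _ a b (primitive_derive _ cf).
by rewrite /integ e h // mul0r.
Qed.

(* The Jacobian of a C^1 compactly supported map has zero integral. With only
   C^1 regularity one differentiates at [h = 0] the identity
   [J(Px(x,y) Q(x,y+h)) + J(P(x,y) Qx(x,y+h)) = 0], after moving the shift of
   the second term to [P]. *)
Lemma integ2_jacobian :
  integ2 (r + 1) (fun x y => Px x y * Qy x y - Py x y * Qx x y) = 0.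
Proof.
pose F h := integ2 (r + 1) (fun x y => Px x y * Q x (y + h)).
pose G h := integ2 (r + 1) (fun x y => P x y * Qx x (y + h)).
pose G' h := integ2 (r + 1) (fun x y => P x (y - h) * Qx x y).
have FG h : F h + G h = 0.
  rewrite /F /G -integ2D //; try by cont.
  apply: (integ2_dx _ r10 (fun x y => P x y * Q x (y + h))); try by cont.
    by move=> x y; der.
  move=> x y xr; rewrite sP ?mul0r //; left.
  by apply: le_trans xr; rewrite lerDl.
have dF : is_derive (0 : R) 1 F (integ2 (r + 1) (fun x y => Px x y * Qy x (y + 0))).
  apply: (is_derive_integ2 _ r10 (fun h x y => Px x y * Q x (y + h))
    (fun h x y => Px x y * Qy x (y + h))); try by cont.
  move=> h x y.
  have d : is_derive h 1 (fun h => Q x (y + h)) (Qy x (y + h)).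
    have d0 : is_derive h 1 (fun h => y + h) 1 by der; rewrite add0r.
    by have := is_derive_comp_fun (Q x) (fun h => y + h) h _ _ (dQy x (y + h)) d0; rewrite mulr1.
  by der; rewrite mul0r add0r.
have dG' : is_derive (0 : R) 1 G' (integ2 (r + 1) (fun x y => - Py x (y - 0) * Qx x y)).
  apply: (is_derive_integ2 _ r10 (fun h x y => P x (y - h) * Qx x y)
    (fun h x y => - Py x (y - h) * Qx x y)); try by cont.
  move=> h x y.
  have d : is_derive h 1 (fun h => P x (y - h)) (- Py x (y - h)).
    have d0 : is_derive h 1 (fun h => y - h) (-1) by der; rewrite add0r.
    by have := is_derive_comp_fun (P x) (fun h => y - h) h _ _ (dPy x (y - h)) d0; rewrite mulrN1.
  by der; rewrite mulr0 addr0.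
have sQx x y : r <= `|y| -> Qx x y = 0.
  move=> yr; have [_ <-] := dQx x y.
  rewrite (_ : (fun x => _) = fun=> 0); last by apply/funext => t; apply: sQ; right.
  by have [_ ->] := is_derive_const (0 : R) x.
(* The margin between the support radius [r] and the square of half-side [r + 1] is used here: a
   shift by |h| < 1 changes the window of integration only where [Qx] vanishes. *)
have GG' h : `|h| < 1 -> G h = G' h.
  rewrite ltr_norml => /andP[h1 h2]; rewrite /G /G' /integ2; congr integ; apply/funext => x.
  pose f y := P x (y - h) * Qx x y.
  have cf : continuous f by rewrite /f; cont.
  have -> : (fun y => P x y * Qx x (y + h)) = (fun y => f (y + h)).
    by apply/funext => y; rewrite /f addrK.
  rewrite integ_shift // -(integ_split f (- (r + 1) + h) (- (r + 1))).
  rewrite -(integ_split f (- (r + 1)) (r + 1)) [X in X + _]integ_zero_in //; last first.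
    move=> y y1 y2; rewrite /f sQx ?mulr0 // ler_normr; apply/orP; right.
    by move: y1 y2; rewrite ge_min le_max => _ /orP[] ?; lra.
  rewrite add0r [X in _ + X]integ_zero_in ?addr0 //.
  move=> y y1 y2; rewrite /f sQx ?mulr0 // ler_normr; apply/orP; left.
  by move: y1 y2; rewrite ge_min le_max => /orP[] ? _; lra.
have nG : \forall h \near (0 : R), G' h = G h.
  have : \forall h \near (0 : R), `|h| < 1.
    have := nbhsx_ballx (0 : R) 1 ltr01.
    by apply: filterS => h; rewrite /ball /= sub0r normrN.
  by apply: filterS => h /GG'.
have dG := @near_eq_is_derive R R^o R^o G' G 0 1 _ nG dG'.
have dFG := is_derive_add _ _ _ _ _ dF dG.
have e : (fun h => F h + G h) = (fun=> 0) by apply/funext.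
rewrite e in dFG.
have [_ e1] := dFG; have [_ e2] := is_derive_const (0 : R) 0.
rewrite e2 in e1.
rewrite [RHS]e1 -integ2D //; try by cont.
by congr integ2; apply/funext => x; apply/funext => y; rewrite addr0 subr0 mulNr.
Qed.

(* Commutator identity for [eta_- = dbar - kap z] and [eta_+ = d + kap zbar]
   applied to [P + i Q]: [|2 eta_-|^2 = |2 eta_+|^2 + 8 kap |P + i Q|^2]. *)
Lemma integ2_commutator (kap : R) :
  integ2 (r + 1) (fun x y =>
     (Px x y - Qy x y - 2 * kap * (x * P x y - y * Q x y)) ^+ 2 +
     (Qx x y + Py x y - 2 * kap * (x * Q x y + y * P x y)) ^+ 2) =
  integ2 (r + 1) (fun x y =>
     (Px x y + Qy x y + 2 * kap * (x * P x y + y * Q x y)) ^+ 2 +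
     (Qx x y - Py x y + 2 * kap * (x * Q x y - y * P x y)) ^+ 2) +
  8 * kap * integ2 (r + 1) (fun x y => P x y ^+ 2 + Q x y ^+ 2).
Proof.
pose S x y := P x y * P x y + Q x y * Q x y.
pose Sx x y := Px x y * P x y + P x y * Px x y + (Qx x y * Q x y + Q x y * Qx x y).
pose Sy x y := Py x y * P x y + P x y * Py x y + (Qy x y * Q x y + Q x y * Qy x y).
have S0 x y : r + 1 <= `|x| \/ r + 1 <= `|y| -> S x y = 0.
  move=> h; rewrite /S sP ?sQ ?mul0r ?addr0 //; case: h => h; [left|right|left|right];
  by apply: le_trans h; rewrite lerDl.
have h1 : integ2 (r + 1) (fun x y => S x y + x * Sx x y) = 0.
  apply: (integ2_dx _ r10 (fun x y => x * S x y)); rewrite /S /Sx; try by cont.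
    by move=> x y; der; ring.
  by move=> x y xr; rewrite -/(S x y) S0 ?mulr0 //; left.
have h2 : integ2 (r + 1) (fun x y => S x y + y * Sy x y) = 0.
  apply: (integ2_dy _ r10 (fun x y => y * S x y)); rewrite /S /Sy; try by cont.
    by move=> x y; der; ring.
  by move=> x y yr; rewrite -/(S x y) S0 ?mulr0 //; right.
have h3 := integ2_jacobian.
rewrite -integ2Z //; try by cont.
rewrite -integ2D //; try by cont.
(* The two integrands differ pointwise by E1 + E2 + E3: a multiple of the Jacobian, and the
   derivatives of x |P + iQ|^2 in [x] and of y |P + iQ|^2 in [y]. Each has zero integral. *)
pose E1 x y := -4 * (Px x y * Qy x y - Py x y * Qx x y).
pose E2 x y := -4 * kap * (S x y + x * Sx x y).
pose E3 x y := -4 * kap * (S x y + y * Sy x y).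
have z1 : integ2 (r + 1) E1 = 0 by rewrite /E1 integ2Z ?h3 ?mulr0 //; cont.
have z2 : integ2 (r + 1) E2 = 0 by rewrite /E2 integ2Z ?h1 ?mulr0 //; rewrite /S /Sx; cont.
have z3 : integ2 (r + 1) E3 = 0 by rewrite /E3 integ2Z ?h2 ?mulr0 //; rewrite /S /Sy; cont.
rewrite -[RHS]addr0 -z1 -integ2D //; try by rewrite /E1; cont.
rewrite -[RHS]addr0 -z2 -integ2D //; try by rewrite /E1 /E2 /S /Sx; cont.
rewrite -[RHS]addr0 -z3 -integ2D //; try by rewrite /E1 /E2 /E3 /S /Sx /Sy; cont.
congr integ2; apply/funext => x; apply/funext => y.
by rewrite /E1 /E2 /E3 /S /Sx /Sy; ring.
Qed.

End NullLagrangian.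

(** * The energy estimate for Fourier modes *)

Section Recursion.
Context {R : realType}.

(** The recursion gives W(m+1) - W(m) >= (lam - 2C) N(m+2) + lam N(m+3), which is where 2C < lam is
    needed. Once W(m) <= 0, the bound lam N <= a leaves 2 lam N(m+1) <= C N(m+1), so N(m+1) = 0. *)
Lemma energy_recursion (a N : nat -> R) (lam C : R) :
  0 <= C -> 2 * C < lam -> (forall m, 0 <= N m) -> (forall m, lam * N m <= a m) ->
  (forall m, a m + a m.+1 <= a m.+2 + a m.+3 - lam * (N m.+2 + N m.+3) +
     C * (N m.+1 + N m.+2)) ->
  a m @[m --> \oo] --> (0 : R) -> forall m, N m.+1 = 0.
Proof.
move=> C0 lamC N0 aN rec a0.
have an m : 0 <= a m by apply: le_trans (aN m); rewrite mulr_ge0 //; lra.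
(* [W] is nondecreasing and bounded above by a sequence tending to 0. *)
pose W m := a m + a m.+1 + (a m.+1 + a m.+2) - C * N m.+1.
have WS m : W m <= W m.+1.
  rewrite /W; have := rec m; have := rec m.+1; have := N0 m.+1; have := N0 m.+2.
  by have := N0 m.+3; nra.
have Wmono m k : W m <= W (k + m)%N.
  by elim: k => // k IH; apply: le_trans IH _; rewrite addSn.
have cS (u : nat -> R) : u m @[m --> \oo] --> (0 : R) -> u m.+1 @[m --> \oo] --> (0 : R).
  by move=> h; rewrite (cvg_shiftS u).
have c1 := cS _ a0; have c2 := cS _ c1.
have cV : (a m + a m.+1 + (a m.+1 + a m.+2)) @[m --> \oo] --> (0 : R).
  rewrite -[X in _ --> X](_ : 0 + 0 + (0 + 0) = 0); last by rewrite !addr0.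
  by apply: cvgD; apply: cvgD.
have W0 m : W m <= 0.
  rewrite leNgt; apply/negP => Wm.
  have /cvgr_lt/(_ _ Wm) [k _ /(_ (k + m)%N (leq_addr _ _))] := cV.
  have := Wmono m k; rewrite {2}/W /= => h1 h2.
  have := mulr_ge0 C0 (N0 (k + m).+1); lra.
move=> m; apply/le_anti; rewrite N0 andbT.
have := W0 m; rewrite /W; have := an m; have := an m.+2; have := aN m.+1.
by have := N0 m.+1; nra.
Qed.

Lemma bilinear_bound (I : finType) (c : I -> I -> R) (p s : I -> R) (M : R) :
  0 <= M -> (forall i j, `|c i j| <= M) ->
  2 * `|\sum_i p i * \sum_j c i j * s j| <=
    M * #|I|%:R * (\sum_i p i ^+ 2 + \sum_i s i ^+ 2).
Proof.
move=> M0 hc.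
have -> : M * #|I|%:R * (\sum_i p i ^+ 2 + \sum_i s i ^+ 2) =
    \sum_i \sum_j M * (p i ^+ 2 + s j ^+ 2).
  under [RHS]eq_bigr => i _ do rewrite -mulr_sumr big_split /= sumr_const -mulr_natl.
  rewrite -mulr_sumr big_split /= -mulr_sumr sumr_const -mulr_natl; ring.
apply: (@le_trans _ _ (\sum_i \sum_j 2 * `|p i * (c i j * s j)|)).
  rewrite -[leLHS](ger0_norm (x := 2 * _)) ?mulr_ge0 // normrM normr_id -normrM mulr_sumr.
  apply: (le_trans (ler_norm_sum _ _ _)); apply: ler_sum => i _.
  rewrite !mulr_sumr; apply: (le_trans (ler_norm_sum _ _ _)); apply: ler_sum => j _.
  by rewrite normrM (ger0_norm (x := 2)).
apply: ler_sum => i _; apply: ler_sum => j _; rewrite !normrM.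
have h : `|p i| * `|s j| * 2 <= p i ^+ 2 + s j ^+ 2.
  rewrite -(real_normK (num_real (p i))) -(real_normK (num_real (s j))).
  by have := sqr_ge0 (`|p i| - `|s j|); nra.
have h0 : 0 <= `|p i| * `|s j| by rewrite mulr_ge0.
apply: (@le_trans _ _ (M * (`|p i| * `|s j| * 2))); last by rewrite ler_wpM2l.
rewrite (_ : 2 * _ = `|c i j| * (`|p i| * `|s j| * 2)); last by ring.
by rewrite ler_wpM2r ?mulr_ge0.
Qed.

Lemma sum_skew (I : finType) (c : I -> I -> R) (p s : I -> R) :
  (forall i j, c i j = - c j i) ->
  \sum_i p i * \sum_j c i j * s j = - \sum_i (\sum_j c i j * p j) * s i.
Proof.
move=> hc; rewrite -sumrN.
under eq_bigr => i _ do rewrite mulr_sumr.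
rewrite exchange_big; apply: eq_bigr => j _ /=.
rewrite mulr_suml -sumrN; apply: eq_bigr => i _; rewrite hc; ring.
Qed.

End Recursion.

(** * Vanishing of the conjugated modes *)

Section Energy.
Context {R : realType} {I : finType}.
Implicit Types (x y : R) (m : nat) (i j : I).
Variables (r kap M : R) (P Px Py Q Qx Qy : nat -> I -> R -> R -> R).
Variables (Phi Phix Phiy : I -> I -> R -> R -> R).
Hypothesis r0 : 0 <= r.
Hypothesis cP : forall m i, continuous (fun z : R * R => P m i z.1 z.2).
Hypothesis cPx : forall m i, continuous (fun z : R * R => Px m i z.1 z.2).
Hypothesis cPy : forall m i, continuous (fun z : R * R => Py m i z.1 z.2).
Hypothesis cQ : forall m i, continuous (fun z : R * R => Q m i z.1 z.2).
Hypothesis cQx : forall m i, continuous (fun z : R * R => Qx m i z.1 z.2).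
Hypothesis cQy : forall m i, continuous (fun z : R * R => Qy m i z.1 z.2).
Hypothesis dPx : forall m i x y, is_derive x 1 (fun x => P m i x y) (Px m i x y).
Hypothesis dPy : forall m i x y, is_derive y 1 (fun y => P m i x y) (Py m i x y).
Hypothesis dQx : forall m i x y, is_derive x 1 (fun x => Q m i x y) (Qx m i x y).
Hypothesis dQy : forall m i x y, is_derive y 1 (fun y => Q m i x y) (Qy m i x y).
Hypothesis sP : forall m i x y, r <= `|x| \/ r <= `|y| -> P m i x y = 0.
Hypothesis sQ : forall m i x y, r <= `|x| \/ r <= `|y| -> Q m i x y = 0.
Hypothesis cPhi : forall i j, continuous (fun z : R * R => Phi i j z.1 z.2).
Hypothesis cPhix : forall i j, continuous (fun z : R * R => Phix i j z.1 z.2).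
Hypothesis cPhiy : forall i j, continuous (fun z : R * R => Phiy i j z.1 z.2).
Hypothesis dPhix : forall i j x y, is_derive x 1 (fun x => Phi i j x y) (Phix i j x y).
Hypothesis dPhiy : forall i j x y, is_derive y 1 (fun y => Phi i j x y) (Phiy i j x y).
Hypothesis skew : forall i j x y, Phi i j x y = - Phi j i x y.
Hypothesis M0 : 0 <= M.
Hypothesis bPhi : forall i j x y, `|Phi i j x y| <= M.
Hypothesis bPhix : forall i j x y, `|Phix i j x y| <= M.
Hypothesis bPhiy : forall i j x y, `|Phiy i j x y| <= M.

(* With [v_m = P m + i Q m], the Fourier mode of index [- m], these are the real
   and imaginary parts of [2 (d + kap zbar) v_m] and [2 (dbar - kap z) v_m]. *)
Definition eta_plus_re m i x y :=
  Px m i x y + Qy m i x y + 2 * kap * (x * P m i x y + y * Q m i x y).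
Definition eta_plus_im m i x y :=
  Qx m i x y - Py m i x y + 2 * kap * (x * Q m i x y - y * P m i x y).
Definition eta_minus_re m i x y :=
  Px m i x y - Qy m i x y - 2 * kap * (x * P m i x y - y * Q m i x y).
Definition eta_minus_im m i x y :=
  Qx m i x y + Py m i x y - 2 * kap * (x * Q m i x y + y * P m i x y).

Hypothesis mode_re : forall m i x y, eta_plus_re m.+2 i x y +
  eta_minus_re m i x y + 2 * \sum_j Phi i j x y * P m.+1 j x y = 0.
Hypothesis mode_im : forall m i x y, eta_plus_im m.+2 i x y +
  eta_minus_im m i x y + 2 * \sum_j Phi i j x y * Q m.+1 j x y = 0.

Let n : R := #|I|%:R.
(** With v_m = P m + i Q m, pointwise and summed over components: [am], [ap], [nn] are |2 eta_-
    v_m|^2, |2 eta_+ v_m|^2, |v_m|^2; [ff] is |Phi v_(m+1)|^2; [tt] is the cross term Re (2 eta_+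
    v_(m+2), Phi v_(m+1)); [xi] is Re (v_(m+2), 2 (dbar Phi) v_(m+1)), the remainder when the
    derivative falls on Phi. *)
Let am m x y := \sum_i (eta_minus_re m i x y ^+ 2 + eta_minus_im m i x y ^+ 2).
Let ap m x y := \sum_i (eta_plus_re m i x y ^+ 2 + eta_plus_im m i x y ^+ 2).
Let nn m x y := \sum_i (P m i x y ^+ 2 + Q m i x y ^+ 2).
Let ff m x y := \sum_i ((\sum_j Phi i j x y * P m.+1 j x y) ^+ 2 +
  (\sum_j Phi i j x y * Q m.+1 j x y) ^+ 2).
Let tt m x y := \sum_i
  (eta_plus_re m.+2 i x y * (\sum_j Phi i j x y * P m.+1 j x y) +
   eta_plus_im m.+2 i x y * (\sum_j Phi i j x y * Q m.+1 j x y)).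
Let xi m x y := \sum_i
  (P m.+2 i x y * (\sum_j Phix i j x y * P m.+1 j x y - \sum_j Phiy i j x y * Q m.+1 j x y) +
   Q m.+2 i x y * (\sum_j Phix i j x y * Q m.+1 j x y + \sum_j Phiy i j x y * P m.+1 j x y)).
Let J := @integ2 R (r + 1).
Let r10 : 0 <= r + 1. Proof. by rewrite addr_ge0. Qed.

Let cam m : continuous (fun z : R * R => am m z.1 z.2).
Proof. by rewrite /am /eta_minus_re /eta_minus_im; cont. Qed.
Let cap m : continuous (fun z : R * R => ap m z.1 z.2).
Proof. by rewrite /ap /eta_plus_re /eta_plus_im; cont. Qed.
Let cnn m : continuous (fun z : R * R => nn m z.1 z.2).
Proof. by rewrite /nn; cont. Qed.
Let cff m : continuous (fun z : R * R => ff m z.1 z.2).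
Proof. by rewrite /ff; cont. Qed.
Let ctt m : continuous (fun z : R * R => tt m z.1 z.2).
Proof. by rewrite /tt /eta_plus_re /eta_plus_im; cont. Qed.
Let cxi m : continuous (fun z : R * R => xi m z.1 z.2).
Proof. by rewrite /xi; cont. Qed.

Hypothesis decay : J (am m) @[m --> \oo] --> (0 : R).

Let commutator m : J (am m) = J (ap m) + 8 * kap * J (nn m).
Proof.
rewrite /J /am /ap /nn !integ2_sum //; try by move=> i; rewrite /eta_plus_re /eta_plus_im
  /eta_minus_re /eta_minus_im; cont.
rewrite mulr_sumr -big_split; apply: eq_bigr => i _ /=.
by apply: integ2_commutator => //; move=> ? ? ?; [exact: sP|exact: sQ].
Qed.

(** The mode equation reads 2 eta_- v_m = - 2 eta_+ v_(m+2) - 2 Phi v_(m+1); the right-hand side is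
    squared. *)
Let expand m : J (am m) = J (ap m.+2) + 4 * J (tt m) + 4 * J (ff m).
Proof.
rewrite /J -!integ2Z // -!integ2D //; try by cont.
congr integ2; apply/funext => x; apply/funext => y.
rewrite /am /ap /tt /ff !mulr_sumr -!big_split; apply: eq_bigr => i _ /=.
have := mode_re m i x y; have := mode_im m i x y.
set p := \sum_j _; set q := \sum_j _ => h1 h2.
have -> : eta_minus_re m i x y = - eta_plus_re m.+2 i x y - 2 * q by lra.
have -> : eta_minus_im m i x y = - eta_plus_im m.+2 i x y - 2 * p by lra.
by ring.
Qed.

(* Integrating [eta_+] by parts against [Phi v_(m+1)] and using the mode equation
   for [eta_- v_(m+1)] reproduces, by skewness of [Phi], the same term for
   [m + 1] with the opposite sign. *)
Let cross m : J (tt m) + J (tt m.+1) + J (xi m) + 2 * J (ff m.+1) = 0.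
Proof.
pose g1 i x y := P m.+2 i x y * (\sum_j Phi i j x y * P m.+1 j x y) +
  Q m.+2 i x y * (\sum_j Phi i j x y * Q m.+1 j x y).
pose g1x i x y :=
  Px m.+2 i x y * (\sum_j Phi i j x y * P m.+1 j x y) +
  P m.+2 i x y * (\sum_j (Phix i j x y * P m.+1 j x y + Phi i j x y * Px m.+1 j x y)) +
  (Qx m.+2 i x y * (\sum_j Phi i j x y * Q m.+1 j x y) +
  Q m.+2 i x y * (\sum_j (Phix i j x y * Q m.+1 j x y + Phi i j x y * Qx m.+1 j x y))).
pose g2 i x y := Q m.+2 i x y * (\sum_j Phi i j x y * P m.+1 j x y) -
  P m.+2 i x y * (\sum_j Phi i j x y * Q m.+1 j x y).
pose g2y i x y :=
  Qy m.+2 i x y * (\sum_j Phi i j x y * P m.+1 j x y) +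
  Q m.+2 i x y * (\sum_j (Phiy i j x y * P m.+1 j x y + Phi i j x y * Py m.+1 j x y)) -
  (Py m.+2 i x y * (\sum_j Phi i j x y * Q m.+1 j x y) +
  P m.+2 i x y * (\sum_j (Phiy i j x y * Q m.+1 j x y + Phi i j x y * Qy m.+1 j x y))).
have z1 i : J (g1x i) = 0.
  apply: (integ2_dx _ r10 (g1 i)); rewrite /g1 /g1x; try by cont.
    by move=> x y; der.
  move=> x y xr; have xr' : r <= `|x| by apply: le_trans xr; rewrite lerDl.
  by rewrite sP ?sQ ?mul0r ?addr0 //; left.
have z2 i : J (g2y i) = 0.
  apply: (integ2_dy _ r10 (g2 i)); rewrite /g2 /g2y; try by cont.
    by move=> x y; der.
  move=> x y xr; have xr' : r <= `|y| by apply: le_trans xr; rewrite lerDl.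
  by rewrite sP ?sQ ?mul0r ?subr0 //; right.
have c1 i : continuous (fun z : R * R => g1x i z.1 z.2) by rewrite /g1x; cont.
have c2 i : continuous (fun z : R * R => g2y i z.1 z.2) by rewrite /g2y; cont.
have -> : (0 : R) = J (fun x y => \sum_i (g1x i x y + g2y i x y)).
  rewrite /J integ2_sum //; last by move=> i; cont.
  by rewrite big1 // => i _; rewrite integ2D // [integ2 _ (g1x i)]z1 [integ2 _ (g2y i)]z2 addr0.
rewrite /J -integ2Z // -!integ2D //; try by cont.
congr integ2; apply/funext => x; apply/funext => y.
have e3 : tt m.+1 x y + 2 * ff m.+1 x y =
    \sum_i (P m.+2 i x y * (\sum_j Phi i j x y * eta_minus_re m.+1 j x y) +
            Q m.+2 i x y * (\sum_j Phi i j x y * eta_minus_im m.+1 j x y)).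
  rewrite big_split /= !(sum_skew _ (fun i j => Phi i j x y)) //.
  rewrite -!sumrN -big_split /tt /ff mulr_sumr -big_split; apply: eq_bigr => i _ /=.
  have := mode_re m.+1 i x y; have := mode_im m.+1 i x y.
  set p := \sum_j _; set q := \sum_j _ => h1 h2.
  have -> : eta_minus_re m.+1 i x y = - eta_plus_re m.+3 i x y - 2 * q by lra.
  have -> : eta_minus_im m.+1 i x y = - eta_plus_im m.+3 i x y - 2 * p by lra.
  by ring.
rewrite (_ : _ + _ = tt m x y + xi m x y + (tt m.+1 x y + 2 * ff m.+1 x y)); last by ring.
rewrite e3 /tt /xi -!big_split; apply: eq_bigr => i _ /=.
have -> : \sum_j Phi i j x y * eta_minus_re m.+1 j x y =
   \sum_j Phi i j x y * Px m.+1 j x y - \sum_j Phi i j x y * Qy m.+1 j x y -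
   2 * kap * (x * (\sum_j Phi i j x y * P m.+1 j x y) - y * (\sum_j Phi i j x y * Q m.+1 j x y)).
  by rewrite !mulr_sumr -!sumrB mulr_sumr -sumrB; apply: eq_bigr => j _; rewrite /eta_minus_re; ring.
have -> : \sum_j Phi i j x y * eta_minus_im m.+1 j x y =
   \sum_j Phi i j x y * Qx m.+1 j x y + \sum_j Phi i j x y * Py m.+1 j x y -
   2 * kap * (x * (\sum_j Phi i j x y * Q m.+1 j x y) + y * (\sum_j Phi i j x y * P m.+1 j x y)).
  by rewrite !mulr_sumr -!big_split mulr_sumr -sumrB; apply: eq_bigr => j _ /=; rewrite /eta_minus_im; ring.
rewrite /g1x /g2y !big_split /= /eta_plus_re /eta_plus_im; ring.
Qed.

Let C : R := 4 * M * n + 4 * (M ^+ 2 * n ^+ 2).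

Let n0 : 0 <= n. Proof. by []. Qed.
Let C0 : 0 <= C.
Proof. by rewrite /C addr_ge0 // !mulr_ge0 // ?exprn_ge0. Qed.

Let ff_bound m x y : ff m x y <= M ^+ 2 * n ^+ 2 * nn m.+1 x y.
Proof.
have h (p : I -> R) i : (\sum_j Phi i j x y * p j) ^+ 2 <= M ^+ 2 * n * \sum_j p j ^+ 2.
  have h1 := norm_sum_mul_le (fun j => Phi i j x y) p M (fun j => bPhi i j x y).
  rewrite -(real_normK (num_real (\sum_j _))).
  apply: (@le_trans _ _ ((M * \sum_j `|p j|) ^+ 2)).
    by rewrite ler_pXn2r // ?nnegrE // mulr_ge0 // sumr_ge0.
  rewrite exprMn -mulrA ler_wpM2l ?sqr_ge0 // (le_trans (sqr_sum_le _)) // ler_wpM2l //.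
  by apply: ler_sum => j _; rewrite real_normK ?num_real.
rewrite /ff /nn (le_trans (ler_sum _ (fun i _ => lerD (h _ i) (h _ i)))) //.
rewrite sumr_const -[leLHS]mulr_natl -/n -mulrDr -big_split /= le_eqVlt; apply/orP; left; apply/eqP; ring.
Qed.

Let xi_bound m x y : - xi m x y <= M * n * (nn m.+1 x y + nn m.+2 x y).
Proof.
pose p i := P m.+2 i x y; pose q i := Q m.+2 i x y.
pose s i := P m.+1 i x y; pose t i := Q m.+1 i x y.
have b1 := bilinear_bound _ (fun i j => Phix i j x y) p s M M0 (fun i j => bPhix i j x y).
have b2 := bilinear_bound _ (fun i j => Phiy i j x y) p t M M0 (fun i j => bPhiy i j x y).
have b3 := bilinear_bound _ (fun i j => Phix i j x y) q t M M0 (fun i j => bPhix i j x y).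
have b4 := bilinear_bound _ (fun i j => Phiy i j x y) q s M M0 (fun i j => bPhiy i j x y).
have -> : xi m x y = \sum_i p i * (\sum_j Phix i j x y * s j) - \sum_i p i * (\sum_j Phiy i j x y * t j)
  + (\sum_i q i * (\sum_j Phix i j x y * t j) + \sum_i q i * (\sum_j Phiy i j x y * s j)).
  by rewrite -sumrB -!big_split; apply: eq_bigr => i _ /=; rewrite /p /q /s /t; ring.
have -> : nn m.+1 x y + nn m.+2 x y = \sum_i p i ^+ 2 + \sum_i q i ^+ 2 +
   (\sum_i s i ^+ 2 + \sum_i t i ^+ 2).
  by rewrite /nn /p /q /s /t !big_split /=; ring.
move: b1 b2 b3 b4; rewrite -/n.
set x1 := \sum_i p i * _; set x2 := \sum_i p i * _; set x3 := \sum_i q i * _; set x4 := \sum_i q i * _.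
have := ler_norm (- x1); have := ler_norm x2; have := ler_norm (- x3); have := ler_norm (- x4).
rewrite !normrN => ? ? ? ? ? ? ? ?.
nra.
Qed.

(** Adding [expand] for m and m + 1 produces [tt m] and [tt m.+1], which [cross] trades for [xi m]
    and [ff m.+1]; [commutator] turns [ap] back into [am] at the cost of 8 kap |v|^2. This is the
    recursion with lam = 8 kap, and its requirement 2C < lam is C < 4 kap. *)
Lemma modes_eq0 : C < 4 * kap -> forall m i x y,
  P m.+1 i x y = 0 /\ Q m.+1 i x y = 0.
Proof.
move=> hk.
have N0 m : 0 <= J (nn m).
  by apply: integ2_ge0 => // x y; apply: sumr_ge0 => i _; rewrite addr_ge0 // sqr_ge0.
have ap0 m : 0 <= J (ap m).
  by apply: integ2_ge0 => // x y; apply: sumr_ge0 => i _; rewrite addr_ge0 // sqr_ge0.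
have ff0 m : 0 <= J (ff m).
  by apply: integ2_ge0 => // x y; apply: sumr_ge0 => i _; rewrite addr_ge0 // sqr_ge0.
have bff m : J (ff m) <= M ^+ 2 * n ^+ 2 * J (nn m.+1).
  by rewrite /J -integ2Z //; apply: integ2_le => //; cont.
have bxi m : - J (xi m) <= M * n * (J (nn m.+1) + J (nn m.+2)).
  rewrite -mulN1r /J -integ2D // -!integ2Z //; try by cont.
  apply: integ2_le => //; try by cont.
  by move=> x y; rewrite mulN1r.
have NE m : J (nn m.+1) = 0.
  apply: (energy_recursion (fun m => J (am m)) (fun m => J (nn m)) (8 * kap) C) => //.
  - by lra.
  - by move=> k; rewrite commutator; have := ap0 k; lra.
  move=> k; rewrite (expand k) (expand k.+1) (commutator k.+2) (commutator k.+3).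
  have := cross k; have := bxi k; have := bff k; have := bff k.+1; have := ff0 k.+1.
  have := N0 k.+1; have := N0 k.+2; rewrite /C.
  have Mn : 0 <= M ^+ 2 * n ^+ 2 by rewrite mulr_ge0 ?exprn_ge0.
  move=> h1 h2 h3 h4 h5 h6 h7.
  have := mulr_ge0 Mn h1.
  nra.
move=> m i x y.
have [[xr yr]|out] : (- (r + 1) < x < r + 1 /\ - (r + 1) < y < r + 1) \/ (r <= `|x| \/ r <= `|y|).
  rewrite -!ltr_norml; have [xr|xr] := ltP `|x| (r + 1); last first.
    by right; left; apply: le_trans xr; rewrite lerDl.
  have [yr|yr] := ltP `|y| (r + 1); first by left.
  by right; right; apply: le_trans yr; rewrite lerDl.
- have h := integ2_eq0 _ r10 _ (cnn m.+1) _ (NE m) x y xr yr.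
  have {h} : nn m.+1 x y = 0.
    by apply: h => u v; apply: sumr_ge0 => k _; rewrite addr_ge0 // sqr_ge0.
  rewrite /nn => /eqP; rewrite psumr_eq0; last by move=> k _; rewrite addr_ge0 // sqr_ge0.
  move=> /allP/(_ i (mem_index_enum _)) /=; rewrite paddr_eq0 ?sqr_ge0 //.
  by rewrite !sqrf_eq0 => /andP[/eqP -> /eqP ->].
- by rewrite sP // sQ.
Qed.

End Energy.

(** * Conjugated Fourier modes and the linear transport equation *)

Section Periodic.
Context {R : realType}.
Implicit Types (t h : R) (m : nat).
Notation "'tau'" := ((pi : R) *+ 2) (at level 0).

Lemma tau_ge0 : 0 <= tau. Proof. by rewrite mulrn_wge0 // pi_ge0. Qed.

Lemma integ_periodic (f : R -> R) h : continuous f -> (forall t, f (t + tau) = f t) ->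
  integ 0 tau (fun t => f (t + h)) = integ 0 tau f.
Proof.
move=> cf pf; rewrite integ_shift // add0r.
rewrite -(integ_split f h 0) -(integ_split f 0 tau).
suff -> : integ tau (tau + h) f = - integ h 0 f by ring.
have := integ_shift f 0 h tau cf.
rewrite add0r [h + _]addrC => <-.
have -> : (fun t => f (t + tau)) = f by apply/funext.
by rewrite /integ; ring.
Qed.

(** Shifting [t] by h = pi/m changes the sign of c(m t), so twice the integral is that of c(m t)
    (F(t) - F(t + h)), small by continuity. Compactness of [K] makes the threshold uniform in the
    parameter, and no derivative in [t] enters. *)
Lemma riemann_lebesgue (S : topologicalType) (K : set S) (F : S -> R -> R)
    (c : R -> R) (e : R) : compact K ->
  continuous (fun z : S * R => F z.1 z.2) ->
  (forall s t, F s (t + tau) = F s t) ->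
  continuous c -> (forall t, `|c t| <= 1) -> (forall t, c (t + pi) = - c t) ->
  0 < e -> exists N : nat, forall m, (N <= m)%N -> forall s, K s ->
    `|integ 0 tau (fun t => c (m%:R * t) * F s t)| <= e.
Proof.
move=> cK cF pF cc c1 ac e0.
have tau0 := tau_ge0.
pose d := e / (tau + 1).
have t1 : 0 < tau + 1 by rewrite ltr_wpDl.
have d0 : 0 < d by rewrite divr_gt0.
have cf : continuous (fun z : R * (S * R) => F z.2.1 (z.2.2 + z.1)) by cont.
have cK2 : compact (K `*` `[0, tau]%classic).
  by apply: compact_setX => //; exact: segment_compact.
have := near_uniform _ _ _ _ 0 _ cK2 cf d0.
move=> /nbhs_ballP[r /= r0 hr].
exists (Num.truncn (pi / r)).+1 => m Nm s Ks.
have m0 : 0 < m%:R :> R by rewrite ltr0n; apply: leq_trans Nm.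
pose h : R := pi / m%:R.
have mh : m%:R * h = pi by rewrite /h mulrC divfK // gt_eqF.
have hr' : `|h| < r.
  rewrite ger0_norm; last by rewrite divr_ge0 ?pi_ge0.
  rewrite /h ltr_pdivrMr // mulrC -ltr_pdivrMr //.
  have : pi / r < (Num.truncn (pi / r)).+1%:R by exact: Num.Theory.truncnS_gt.
  by move=> /lt_le_trans; apply; rewrite ler_nat.
have cFs : continuous (F s) by cont.
pose f t := c (m%:R * t) * F s t.
have cfs : continuous f by rewrite /f; cont.
have pc t : c (t + tau) = c t by rewrite mulr2n addrA !ac opprK.
have pf t : f (t + tau) = f t.
  rewrite /f pF mulrDr; congr (_ * _).
  by rewrite [X in c (_ + X)]mulr_natl (periodicn (f := c) (T := tau)).
have e1 : integ 0 tau f = - integ 0 tau (fun t => c (m%:R * t) * F s (t + h)).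
  rewrite -(integ_periodic f h cfs pf) -integN; last by cont.
  congr integ; apply/funext => t; rewrite /f mulrDr mh ac; ring.
have e2 : 2 * integ 0 tau f = integ 0 tau (fun t => c (m%:R * t) * (F s t - F s (t + h))).
  transitivity (integ 0 tau f + integ 0 tau f); first by ring.
  rewrite {2}e1 -integB //; last by cont.
  by congr integ; apply/funext => t; rewrite /f mulrBr.
rewrite -/f -(ler_pM2l (x := 2)) // -[X in X * `|_|](ger0_norm (x := 2)) // -normrM e2.
have h1 : `|integ 0 tau (fun t => c (m%:R * t) * (F s t - F s (t + h)))| <= d * (tau - 0).
  apply: integ_norm_le => //; first by cont.
  move=> t t01; rewrite normrM -[leRHS]mul1r ler_pM // distrC ltW //.
  have := hr h _ (s, t); rewrite /= addr0; apply=> //.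
    by rewrite /ball /= sub0r normrN.
apply: (le_trans h1); rewrite subr0 /d mulrAC ler_pdivrMr //.
rewrite mulrC -mulrA [e * _]mulrC mulrA ler_wpM2r // ?(ltW e0) //; lra.
Qed.

Lemma cos_natmul_tau m t : cos (m%:R * (t + tau)) = cos (m%:R * t) :> R.
Proof. by rewrite mulrDr [X in _ + X]mulr_natl (periodicn (@cosD2pi R)). Qed.

Lemma sin_natmul_tau m t : sin (m%:R * (t + tau)) = sin (m%:R * t) :> R.
Proof. by rewrite mulrDr [X in _ + X]mulr_natl (periodicn (@sinD2pi R)). Qed.

Lemma integ_cos_natmul m : integ 0 tau (fun t : R => cos (m.+1%:R * t)) = 0.
Proof.
have m0 : m.+1%:R != 0 :> R by rewrite pnatr_eq0.
have d t : is_derive t 1 (fun t => m.+1%:R^-1 * sin (m.+1%:R * t)) (cos (m.+1%:R * t)).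
  by der; rewrite !mul0r !add0r mulr1 mulrCA mulVf // mulr1.
rewrite (integ_FTC _ _ _ _ d) -[X in sin (_ * X)]add0r sin_natmul_tau.
by rewrite subrr.
Qed.

Lemma integ_sin_natmul m : integ 0 tau (fun t : R => sin (m.+1%:R * t)) = 0.
Proof.
have m0 : m.+1%:R != 0 :> R by rewrite pnatr_eq0.
have d t : is_derive t 1 (fun t => - (m.+1%:R^-1 * cos (m.+1%:R * t))) (sin (m.+1%:R * t)).
  by der; field.
rewrite (integ_FTC _ _ _ _ d) -[X in cos (_ * X)]add0r cos_natmul_tau.
by rewrite subrr.
Qed.

End Periodic.

(** * Conjugating weights and their dependence on k *)

Section Modes.
Context {R : realType}.
Implicit Types (k x y t : R) (m : nat).
Notation "'tau'" := ((pi : R) *+ 2) (at level 0).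

(* With [zeta = (x - i y) e^{i t} = pr + i qr], the factor
   [wcos + i wsin = e^{k (|z|^2 - zeta^2)} e^{i m t}] conjugates the transport
   equation into one for a connection of constant curvature. *)
Definition pr x y t : R := x * cos t + y * sin t.
Definition qr x y t : R := x * sin t - y * cos t.
Definition amp k x y t : R := expR (2 * k * (qr x y t * qr x y t)).
Definition phase k m x y t : R := m%:R * t - 2 * k * (pr x y t * qr x y t).
Definition wcos k m x y t : R := amp k x y t * cos (phase k m x y t).
Definition wsin k m x y t : R := amp k x y t * sin (phase k m x y t).
Definition phase_x k x y t : R := - (2 * k * (cos t * qr x y t + pr x y t * sin t)).
Definition phase_y k x y t : R := - (2 * k * (sin t * qr x y t - pr x y t * cos t)).
Definition wcos_x k m x y t : R :=
  4 * k * qr x y t * sin t * wcos k m x y t - phase_x k x y t * wsin k m x y t.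
Definition wcos_y k m x y t : R :=
  - (4 * k * qr x y t * cos t * wcos k m x y t) - phase_y k x y t * wsin k m x y t.
Definition wsin_x k m x y t : R :=
  4 * k * qr x y t * sin t * wsin k m x y t + phase_x k x y t * wcos k m x y t.
Definition wsin_y k m x y t : R :=
  - (4 * k * qr x y t * cos t * wsin k m x y t) + phase_y k x y t * wcos k m x y t.
Definition wcos_k k m x y t : R :=
  2 * (qr x y t * qr x y t) * wcos k m x y t + 2 * (pr x y t * qr x y t) * wsin k m x y t.
Definition wsin_k k m x y t : R :=
  2 * (qr x y t * qr x y t) * wsin k m x y t - 2 * (pr x y t * qr x y t) * wcos k m x y t.

Section Continuity.
Context {T : topologicalType} (a b c d : T -> R).
Hypothesis (ca : continuous a) (cb : continuous b) (cc : continuous c) (cd : continuous d).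

Lemma continuous_wcos m : continuous (fun z => wcos (a z) m (b z) (c z) (d z)).
Proof. by rewrite /wcos /amp /phase /pr /qr; cont. Qed.
Lemma continuous_wsin m : continuous (fun z => wsin (a z) m (b z) (c z) (d z)).
Proof. by rewrite /wsin /amp /phase /pr /qr; cont. Qed.
Lemma continuous_wcos_x m : continuous (fun z => wcos_x (a z) m (b z) (c z) (d z)).
Proof. by rewrite /wcos_x /wcos /wsin /amp /phase_x /phase /pr /qr; cont. Qed.
Lemma continuous_wcos_y m : continuous (fun z => wcos_y (a z) m (b z) (c z) (d z)).
Proof. by rewrite /wcos_y /wcos /wsin /amp /phase_y /phase /pr /qr; cont. Qed.
Lemma continuous_wsin_x m : continuous (fun z => wsin_x (a z) m (b z) (c z) (d z)).
Proof. by rewrite /wsin_x /wcos /wsin /amp /phase_x /phase /pr /qr; cont. Qed.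
Lemma continuous_wsin_y m : continuous (fun z => wsin_y (a z) m (b z) (c z) (d z)).
Proof. by rewrite /wsin_y /wcos /wsin /amp /phase_y /phase /pr /qr; cont. Qed.
Lemma continuous_wcos_k m : continuous (fun z => wcos_k (a z) m (b z) (c z) (d z)).
Proof. by rewrite /wcos_k /wcos /wsin /amp /phase /pr /qr; cont. Qed.
Lemma continuous_wsin_k m : continuous (fun z => wsin_k (a z) m (b z) (c z) (d z)).
Proof. by rewrite /wsin_k /wcos /wsin /amp /phase /pr /qr; cont. Qed.

End Continuity.

Lemma is_derive_wcos_x k m x y t :
  is_derive x 1 (fun x => wcos k m x y t) (wcos_x k m x y t).
Proof. by rewrite /wcos_x /wcos /wsin /amp /phase_x /phase /pr /qr; der; ring. Qed.
Lemma is_derive_wcos_y k m x y t :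
  is_derive y 1 (fun y => wcos k m x y t) (wcos_y k m x y t).
Proof. by rewrite /wcos_y /wcos /wsin /amp /phase_y /phase /pr /qr; der; ring. Qed.
Lemma is_derive_wsin_x k m x y t :
  is_derive x 1 (fun x => wsin k m x y t) (wsin_x k m x y t).
Proof. by rewrite /wsin_x /wcos /wsin /amp /phase_x /phase /pr /qr; der; ring. Qed.
Lemma is_derive_wsin_y k m x y t :
  is_derive y 1 (fun y => wsin k m x y t) (wsin_y k m x y t).
Proof. by rewrite /wsin_y /wcos /wsin /amp /phase_y /phase /pr /qr; der; ring. Qed.
Lemma is_derive_wcos_k k m x y t :
  is_derive k 1 (fun k => wcos k m x y t) (wcos_k k m x y t).
Proof. by rewrite /wcos_k /wcos /wsin /amp /phase /pr /qr; der; ring. Qed.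
Lemma is_derive_wsin_k k m x y t :
  is_derive k 1 (fun k => wsin k m x y t) (wsin_k k m x y t).
Proof. by rewrite /wsin_k /wcos /wsin /amp /phase /pr /qr; der; ring. Qed.

Lemma phaseS k m x y t : phase k m.+1 x y t = phase k m x y t + t.
Proof. by rewrite /phase -natr1; ring. Qed.

Lemma wcosS k m x y t : wcos k m.+1 x y t = wcos k m x y t * cos t - wsin k m x y t * sin t.
Proof. by rewrite /wcos /wsin phaseS cosD; ring. Qed.

Lemma wsinS k m x y t : wsin k m.+1 x y t = wsin k m x y t * cos t + wcos k m x y t * sin t.
Proof. by rewrite /wcos /wsin phaseS sinD; ring. Qed.

(** Inserting cos^2 + sin^2 turns the trigonometric identities below into polynomial identities in
    [cos t] and [sin t]. *)
Lemma sqr_norm_rot x y t :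
  x ^+ 2 + y ^+ 2 = (x ^+ 2 + y ^+ 2) * (cos t ^+ 2 + sin t ^+ 2).
Proof. by rewrite cos2Dsin2 mulr1. Qed.

Lemma wcos_kE k m x y t : wcos_k k m x y t = (x ^+ 2 + y ^+ 2) * wcos k m x y t -
  ((x ^+ 2 - y ^+ 2) * wcos k m.+2 x y t - (- (2 * x * y)) * wsin k m.+2 x y t).
Proof.
rewrite (sqr_norm_rot x y t) /wcos_k !wcosS !wsinS !wcosS.
by rewrite /pr /qr; ring.
Qed.

Lemma wsin_kE k m x y t : wsin_k k m x y t = (x ^+ 2 + y ^+ 2) * wsin k m x y t -
  ((x ^+ 2 - y ^+ 2) * wsin k m.+2 x y t + (- (2 * x * y)) * wcos k m.+2 x y t).
Proof.
rewrite (sqr_norm_rot x y t) /wsin_k !wcosS !wsinS !wcosS.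
by rewrite /pr /qr; ring.
Qed.

Lemma amp_le k k1 x y t : amp k x y t <=
  expR (2 * (x ^+ 2 + y ^+ 2) * `|k1|) * expR (2 * (x ^+ 2 + y ^+ 2) * `|k - k1|).
Proof.
rewrite -expRD /amp ler_expR.
have q2 : qr x y t * qr x y t <= x ^+ 2 + y ^+ 2.
  rewrite (sqr_norm_rot x y t) /qr.
  have := sqr_ge0 (pr x y t); rewrite /pr; nra.
have q0 : 0 <= qr x y t * qr x y t by rewrite -expr2 sqr_ge0.
have k0 : k <= `|k1| + `|k - k1|.
  by rewrite (le_trans (ler_norm k)) // -{1}(subrK k1 k) addrC ler_normD.
have k2 : 0 <= `|k1| + `|k - k1| by rewrite addr_ge0.
rewrite -mulrDr -!mulrA ler_pM2l // (le_trans (ler_wpM2r q0 k0)) // mulrC.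
by rewrite ler_wpM2r.
Qed.

Lemma norm_cos_le1 t : `|cos t| <= 1.
Proof. by rewrite ler_norml cos_geN1 cos_le1. Qed.
Lemma norm_sin_le1 t : `|sin t| <= 1.
Proof. by rewrite ler_norml sin_geN1 sin_le1. Qed.

(* In complex notation [d/dk v_m = |z|^2 v_m - zbar^2 v_(m+2)], so vanishing of
   all the modes of positive index propagates in [k]. *)
Lemma modes_transfer (x y : R) (g : R -> R) (k1 : R) : continuous g ->
  (forall m, integ 0 tau (fun t => wcos k1 m.+1 x y t * g t) = 0 /\
             integ 0 tau (fun t => wsin k1 m.+1 x y t * g t) = 0) ->
  forall k m, integ 0 tau (fun t => wcos k m.+1 x y t * g t) = 0 /\
              integ 0 tau (fun t => wsin k m.+1 x y t * g t) = 0.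
Proof.
move=> cg h0.
have tau0 := tau_ge0 (R := R).
pose rho : R := x ^+ 2 + y ^+ 2.
pose a1 : R := x ^+ 2 - y ^+ 2.
pose a2 : R := - (2 * x * y).
pose P m k := integ 0 tau (fun t => wcos k m x y t * g t).
pose Q m k := integ 0 tau (fun t => wsin k m x y t * g t).
have rho0 : 0 <= rho by rewrite addr_ge0 ?sqr_ge0.
pose A : R := rho + `|a1| + `|a2|.
have A0 : 0 <= A by rewrite /A; have := normr_ge0 a1; have := normr_ge0 a2; lra.
(* [A] bounds the coefficients of the equation in [k], so A/K <= 1/2 and each integration gains a
   factor 2. Also K >= 2 rho, so the weight dominates the growth of [amp] away from [k1]. *)
pose K : R := 2 * A + 1.
have K0 : 0 < K by rewrite ltr_wpDl // mulr_ge0.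
have hc m k : continuous (wcos k m x y).
  by apply: (@continuous_wcos R (fun _ => k) (fun _ => x) (fun _ => y) (fun t => t)); cont.
have hs m k : continuous (wsin k m x y).
  by apply: (@continuous_wsin R (fun _ => k) (fun _ => x) (fun _ => y) (fun t => t)); cont.
have c1 m k : continuous (fun t => wcos k m x y t * g t) by cont.
have c2 m k : continuous (fun t => wsin k m x y t * g t) by cont.
have dP m k : is_derive k 1 (P m) (rho * P m k - (a1 * P m.+2 k - a2 * Q m.+2 k)).
  have -> : rho * P m k - (a1 * P m.+2 k - a2 * Q m.+2 k) =
      integ 0 tau (fun t => wcos_k k m x y t * g t).
    rewrite /P /Q -!integZ // -!integB //; try by cont.
    by congr integ; apply/funext => t; rewrite wcos_kE /rho /a1 /a2; ring.
  apply: (is_derive_integ (fun k t => wcos k m x y t * g t)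
    (fun k t => wcos_k k m x y t * g t)) => //.
    by move=> k' t; have := is_derive_wcos_k k' m x y t => ?; der; rewrite mulr0 addr0.
  have ch : continuous (fun z : R * R => wcos_k z.1 m x y z.2).
    by apply: (@continuous_wcos_k _ (fun z => z.1) (fun _ => x) (fun _ => y) (fun z => z.2)); cont.
  by cont.
have dQ m k : is_derive k 1 (Q m) (rho * Q m k - (a1 * Q m.+2 k + a2 * P m.+2 k)).
  have -> : rho * Q m k - (a1 * Q m.+2 k + a2 * P m.+2 k) =
      integ 0 tau (fun t => wsin_k k m x y t * g t).
    rewrite /P /Q -!integZ // -!integD //; try by cont.
    rewrite -!integB //; try by cont.
    by congr integ; apply/funext => t; rewrite wsin_kE /rho /a1 /a2; ring.
  apply: (is_derive_integ (fun k t => wsin k m x y t * g t)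
    (fun k t => wsin_k k m x y t * g t)) => //.
    by move=> k' t; have := is_derive_wsin_k k' m x y t => ?; der; rewrite mulr0 addr0.
  have ch : continuous (fun z : R * R => wsin_k z.1 m x y z.2).
    by apply: (@continuous_wsin_k _ (fun z => z.1) (fun _ => x) (fun _ => y) (fun z => z.2)); cont.
  by cont.
have [G G0 hG] := compact_norm_bounded _ `[0, tau]%classic g (@segment_compact _ _ _) cg.
pose w k := weight K (k - k1).
pose C := expR (2 * rho * `|k1|) * G * tau.
have ampw k t : amp k x y t <= expR (2 * rho * `|k1|) * w k.
  apply: (le_trans (amp_le k k1 x y t)); rewrite ler_wpM2l ?expR_ge0 // -/rho.
  have := expR_gt0 (K * (k - k1)); have := expR_gt0 (- (K * (k - k1))).
  move=> e1 e2; apply: (@le_trans _ _ (expR (K * `|k - k1|))).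
    rewrite ler_expR ler_wpM2r // /K /A.
    by have := normr_ge0 a1; have := normr_ge0 a2; lra.
  rewrite /w /weight; have [h|h] := lerP 0 (k - k1).
    by rewrite ger0_norm // lerDl ltW.
  by rewrite ltr0_norm // mulrN lerDr ltW.
have init (s : R -> R) k : (forall t, `|s t| <= 1) ->
    continuous (fun t => amp k x y t * s t * g t) ->
    `|integ 0 tau (fun t => amp k x y t * s t * g t)| <= C * w k.
  move=> s1 cs.
  rewrite (_ : C * w k = expR (2 * rho * `|k1|) * w k * 1 * G * (tau - 0)); last by rewrite /C; ring.
  apply: integ_norm_le => // t t01; rewrite !normrM ler_pM ?mulr_ge0 //.
    by rewrite ler_pM // ger0_norm ?ampw // expR_ge0.
  by apply: hG; rewrite /= in_itv.
(* The system for positive indices is infinite but closed, since the derivative of index m involves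
   only m and m + 2. The initial bound is uniform in the index, so the induction on [n] treats all
   indices together. *)
have step n m k : `|P m.+1 k| <= C * w k * 2^-1 ^+ n /\ `|Q m.+1 k| <= C * w k * 2^-1 ^+ n.
  elim: n m k => [|n IH] m k.
    rewrite expr0 mulr1; split.
      by apply: init => [t|]; [exact: norm_cos_le1|exact: c1].
    by apply: init => [t|]; [exact: norm_sin_le1|exact: c2].
  have P0 : P m.+1 k1 = 0 by have [] := h0 m.
  have Q0 : Q m.+1 k1 = 0 by have [] := h0 m.
  have W k' : 0 <= C * w k' * 2^-1 ^+ n.
    by have [] := IH m k' => h _; apply: le_trans h.
  have bnd k' (u v1 v2 : R) : `|u| <= C * w k' * 2^-1 ^+ n -> `|v1| <= C * w k' * 2^-1 ^+ n ->
     `|v2| <= C * w k' * 2^-1 ^+ n ->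
     rho * `|u| + (`|a1| * `|v1| + `|a2| * `|v2|) <= A * C * 2^-1 ^+ n * w k'.
    move=> hu h1 h2; rewrite (_ : A * C * _ * _ = rho * (C * w k' * 2^-1 ^+ n) +
      (`|a1| * (C * w k' * 2^-1 ^+ n) + `|a2| * (C * w k' * 2^-1 ^+ n))); last by rewrite /A; ring.
    by rewrite !lerD // ler_wpM2l.
  have bP k' : `|rho * P m.+1 k' - (a1 * P m.+3 k' - a2 * Q m.+3 k')| <= A * C * 2^-1 ^+ n * w k'.
    have [i1 i2] := IH m k'; have [i3 i4] := IH m.+2 k'.
    apply: le_trans (bnd k' _ _ _ i1 i3 i4).
    rewrite (le_trans (ler_normB _ _)) // lerD //; first by rewrite normrM ger0_norm.
    by rewrite (le_trans (ler_normB _ _)) // !normrM.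
  have bQ k' : `|rho * Q m.+1 k' - (a1 * Q m.+3 k' + a2 * P m.+3 k')| <= A * C * 2^-1 ^+ n * w k'.
    have [i1 i2] := IH m k'; have [i3 i4] := IH m.+2 k'.
    apply: le_trans (bnd k' _ _ _ i2 i4 i3).
    rewrite (le_trans (ler_normB _ _)) // lerD //; first by rewrite normrM ger0_norm.
    by rewrite (le_trans (ler_normD _ _)) // !normrM.
  have le : A * C * 2^-1 ^+ n / K * w k <= C * w k * 2^-1 ^+ n.+1.
    rewrite exprS (_ : _ * w k = A / K * (C * w k * 2^-1 ^+ n)); last by ring.
    rewrite [leRHS](_ : _ = 2^-1 * (C * w k * 2^-1 ^+ n)); last by ring.
    by rewrite ler_wpM2r // ler_pdivrMr // /K; lra.
  split; apply: le_trans le; first exact: (weight_bound _ _ _ (P m.+1) _ K0 P0 (dP m.+1) bP).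
  exact: (weight_bound _ _ _ (Q m.+1) _ K0 Q0 (dQ m.+1) bQ).
move=> k m; split; apply: (halves_eq0 _ (C * w k)) => n; by have [] := step n m k.
Qed.

Lemma wcos0 m x y t : wcos 0 m x y t = cos (m%:R * t).
Proof. by rewrite /wcos /amp /phase mulr0 !mul0r subr0 expR0 mul1r. Qed.

Lemma wsin0 m x y t : wsin 0 m x y t = sin (m%:R * t).
Proof. by rewrite /wsin /amp /phase mulr0 !mul0r subr0 expR0 mul1r. Qed.

(** A weight of positive index has only Fourier modes of positive index. This is clear at [k = 0],
    and [modes_transfer] with the constant function 1 extends it to every [k]. It removes a source
    that does not depend on [t] from the mode equations. *)
Lemma integ_weights (k x y : R) m : integ 0 tau (wcos k m.+1 x y) = 0 /\
  integ 0 tau (wsin k m.+1 x y) = 0.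
Proof.
have c : continuous (fun _ : R => 1 : R) by exact: continuous_const.
have h (m' : nat) : integ 0 tau (fun t => wcos 0 m'.+1 x y t * 1) = 0 /\
    integ 0 tau (fun t => wsin 0 m'.+1 x y t * 1) = 0.
  split; [rewrite -[RHS](integ_cos_natmul m')|rewrite -[RHS](integ_sin_natmul m')];
  by congr integ; apply/funext => t; rewrite mulr1 (wcos0, wsin0).
have [h1 h2] := modes_transfer x y (fun=> 1) 0 c h k m.
by split; [rewrite -[RHS]h1|rewrite -[RHS]h2]; congr integ; apply/funext => t; rewrite mulr1.
Qed.

End Modes.

(** * The linear transport equation with a source independent of direction *)

Section LinearTransport.
Context {R : realType} {I : finType}.
Implicit Types (k x y t : R) (m : nat) (i j : I).
Notation "'tau'" := ((pi : R) *+ 2) (at level 0).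
Variables (r M : R) (u ux uy : I -> R -> R -> R -> R) (f : I -> R -> R -> R).
Variables (Phi Phix Phiy : I -> I -> R -> R -> R).
Hypothesis r0 : 0 <= r.
Hypothesis cu : forall i, continuous (fun z : R * R * R => u i z.1.1 z.1.2 z.2).
Hypothesis cux : forall i, continuous (fun z : R * R * R => ux i z.1.1 z.1.2 z.2).
Hypothesis cuy : forall i, continuous (fun z : R * R * R => uy i z.1.1 z.1.2 z.2).
Hypothesis dux : forall i x y t, is_derive x 1 (fun x => u i x y t) (ux i x y t).
Hypothesis duy : forall i x y t, is_derive y 1 (fun y => u i x y t) (uy i x y t).
Hypothesis su : forall i x y t, r <= `|x| \/ r <= `|y| -> u i x y t = 0.
Hypothesis pu : forall i x y t, u i x y (t + tau) = u i x y t.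
Hypothesis cPhi : forall i j, continuous (fun z : R * R => Phi i j z.1 z.2).
Hypothesis cPhix : forall i j, continuous (fun z : R * R => Phix i j z.1 z.2).
Hypothesis cPhiy : forall i j, continuous (fun z : R * R => Phiy i j z.1 z.2).
Hypothesis dPhix : forall i j x y, is_derive x 1 (fun x => Phi i j x y) (Phix i j x y).
Hypothesis dPhiy : forall i j x y, is_derive y 1 (fun y => Phi i j x y) (Phiy i j x y).
Hypothesis skew : forall i j x y, Phi i j x y = - Phi j i x y.
Hypothesis M0 : 0 <= M.
Hypothesis bPhi : forall i j x y, `|Phi i j x y| <= M.
Hypothesis bPhix : forall i j x y, `|Phix i j x y| <= M.
Hypothesis bPhiy : forall i j x y, `|Phiy i j x y| <= M.
Hypothesis transport_eq : forall i x y t,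
  cos t * ux i x y t + sin t * uy i x y t + \sum_j Phi i j x y * u j x y t = f i x y.

Let tau0 : 0 <= tau. Proof. exact: tau_ge0. Qed.

Definition mode_cos k m i x y := integ 0 tau (fun t => wcos k m x y t * u i x y t).
Definition mode_sin k m i x y := integ 0 tau (fun t => wsin k m x y t * u i x y t).
Definition mode_cos_x k m i x y :=
  integ 0 tau (fun t => wcos_x k m x y t * u i x y t + wcos k m x y t * ux i x y t).
Definition mode_cos_y k m i x y :=
  integ 0 tau (fun t => wcos_y k m x y t * u i x y t + wcos k m x y t * uy i x y t).
Definition mode_sin_x k m i x y :=
  integ 0 tau (fun t => wsin_x k m x y t * u i x y t + wsin k m x y t * ux i x y t).
Definition mode_sin_y k m i x y :=
  integ 0 tau (fun t => wsin_y k m x y t * u i x y t + wsin k m x y t * uy i x y t).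

Let hwc k m : continuous (fun z : R * R * R => wcos k m z.1.1 z.1.2 z.2).
Proof. by apply: (@continuous_wcos _ _ (fun _ => k)) => //; cont. Qed.
Let hws k m : continuous (fun z : R * R * R => wsin k m z.1.1 z.1.2 z.2).
Proof. by apply: (@continuous_wsin _ _ (fun _ => k)) => //; cont. Qed.
Let hwcx k m : continuous (fun z : R * R * R => wcos_x k m z.1.1 z.1.2 z.2).
Proof. by apply: (@continuous_wcos_x _ _ (fun _ => k)) => //; cont. Qed.
Let hwcy k m : continuous (fun z : R * R * R => wcos_y k m z.1.1 z.1.2 z.2).
Proof. by apply: (@continuous_wcos_y _ _ (fun _ => k)) => //; cont. Qed.
Let hwsx k m : continuous (fun z : R * R * R => wsin_x k m z.1.1 z.1.2 z.2).
Proof. by apply: (@continuous_wsin_x _ _ (fun _ => k)) => //; cont. Qed.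
Let hwsy k m : continuous (fun z : R * R * R => wsin_y k m z.1.1 z.1.2 z.2).
Proof. by apply: (@continuous_wsin_y _ _ (fun _ => k)) => //; cont. Qed.

Let cmode (g : R -> R -> R -> R) :
  continuous (fun z : R * R * R => g z.1.1 z.1.2 z.2) ->
  continuous (fun z : R * R => integ 0 tau (g z.1 z.2)).
Proof. by move=> cg; apply: (continuous_integ (R * R)%type (fun z => g z.1 z.2)). Qed.

Let cP k m i : continuous (fun z : R * R => mode_cos k m i z.1 z.2).
Proof. by apply: (cmode (fun x y t => wcos k m x y t * u i x y t)); cont. Qed.
Let cQ k m i : continuous (fun z : R * R => mode_sin k m i z.1 z.2).
Proof. by apply: (cmode (fun x y t => wsin k m x y t * u i x y t)); cont. Qed.
Let cPx k m i : continuous (fun z : R * R => mode_cos_x k m i z.1 z.2).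
Proof. by apply: (cmode (fun x y t => wcos_x k m x y t * u i x y t + wcos k m x y t * ux i x y t)); cont. Qed.
Let cPy k m i : continuous (fun z : R * R => mode_cos_y k m i z.1 z.2).
Proof. by apply: (cmode (fun x y t => wcos_y k m x y t * u i x y t + wcos k m x y t * uy i x y t)); cont. Qed.
Let cQx k m i : continuous (fun z : R * R => mode_sin_x k m i z.1 z.2).
Proof. by apply: (cmode (fun x y t => wsin_x k m x y t * u i x y t + wsin k m x y t * ux i x y t)); cont. Qed.
Let cQy k m i : continuous (fun z : R * R => mode_sin_y k m i z.1 z.2).
Proof. by apply: (cmode (fun x y t => wsin_y k m x y t * u i x y t + wsin k m x y t * uy i x y t)); cont. Qed.

Let dPx k m i x y : is_derive x 1 (fun x => mode_cos k m i x y) (mode_cos_x k m i x y).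
Proof.
apply: (is_derive_integ (fun x t => wcos k m x y t * u i x y t)
  (fun x t => wcos_x k m x y t * u i x y t + wcos k m x y t * ux i x y t)) => //.
- by move=> x' t; have d := is_derive_wcos_x k m x' y t; der.
- by move=> x'; cont.
- by cont.
Qed.
Let dPy k m i x y : is_derive y 1 (fun y => mode_cos k m i x y) (mode_cos_y k m i x y).
Proof.
apply: (is_derive_integ (fun y t => wcos k m x y t * u i x y t)
  (fun y t => wcos_y k m x y t * u i x y t + wcos k m x y t * uy i x y t)) => //.
- by move=> y' t; have d := is_derive_wcos_y k m x y' t; der.
- by move=> y'; cont.
- by cont.
Qed.
Let dQx k m i x y : is_derive x 1 (fun x => mode_sin k m i x y) (mode_sin_x k m i x y).
Proof.
apply: (is_derive_integ (fun x t => wsin k m x y t * u i x y t)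
  (fun x t => wsin_x k m x y t * u i x y t + wsin k m x y t * ux i x y t)) => //.
- by move=> x' t; have d := is_derive_wsin_x k m x' y t; der.
- by move=> x'; cont.
- by cont.
Qed.
Let dQy k m i x y : is_derive y 1 (fun y => mode_sin k m i x y) (mode_sin_y k m i x y).
Proof.
apply: (is_derive_integ (fun y t => wsin k m x y t * u i x y t)
  (fun y t => wsin_y k m x y t * u i x y t + wsin k m x y t * uy i x y t)) => //.
- by move=> y' t; have d := is_derive_wsin_y k m x y' t; der.
- by move=> y'; cont.
- by cont.
Qed.

Let sP k m i x y : r <= `|x| \/ r <= `|y| -> mode_cos k m i x y = 0.
Proof.
move=> h; rewrite -[RHS](integ0 0 tau); congr integ.
by apply/funext => t; rewrite su ?mulr0.
Qed.
Let sQ k m i x y : r <= `|x| \/ r <= `|y| -> mode_sin k m i x y = 0.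
Proof.
move=> h; rewrite -[RHS](integ0 0 tau); congr integ.
by apply/funext => t; rewrite su ?mulr0.
Qed.

Let plus_re k m i x y := eta_plus_re k (mode_cos k) (mode_cos_x k) (mode_sin k) (mode_sin_y k) m i x y.
Let minus_re k m i x y := eta_minus_re k (mode_cos k) (mode_cos_x k) (mode_sin k) (mode_sin_y k) m i x y.
Let plus_im k m i x y := eta_plus_im k (mode_cos k) (mode_cos_y k) (mode_sin k) (mode_sin_x k) m i x y.
Let minus_im k m i x y := eta_minus_im k (mode_cos k) (mode_cos_y k) (mode_sin k) (mode_sin_x k) m i x y.

(* Integrands of the real and imaginary parts of [2 eta_+ v] and [2 eta_- v]. *)
Let gplus_re k m i x y t := (wcos_x k m x y t * u i x y t + wcos k m x y t * ux i x y t)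
  + (wsin_y k m x y t * u i x y t + wsin k m x y t * uy i x y t)
  + 2 * k * (x * (wcos k m x y t * u i x y t) + y * (wsin k m x y t * u i x y t)).
Let gminus_re k m i x y t := (wcos_x k m x y t * u i x y t + wcos k m x y t * ux i x y t)
  - (wsin_y k m x y t * u i x y t + wsin k m x y t * uy i x y t)
  - 2 * k * (x * (wcos k m x y t * u i x y t) - y * (wsin k m x y t * u i x y t)).
Let gplus_im k m i x y t := (wsin_x k m x y t * u i x y t + wsin k m x y t * ux i x y t)
  - (wcos_y k m x y t * u i x y t + wcos k m x y t * uy i x y t)
  + 2 * k * (x * (wsin k m x y t * u i x y t) - y * (wcos k m x y t * u i x y t)).
Let gminus_im k m i x y t := (wsin_x k m x y t * u i x y t + wsin k m x y t * ux i x y t)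
  + (wcos_y k m x y t * u i x y t + wcos k m x y t * uy i x y t)
  - 2 * k * (x * (wsin k m x y t * u i x y t) + y * (wcos k m x y t * u i x y t)).

Let cgplus_re k m i : continuous (fun z : R * R * R => gplus_re k m i z.1.1 z.1.2 z.2).
Proof. by rewrite /gplus_re; cont. Qed.
Let cgminus_re k m i : continuous (fun z : R * R * R => gminus_re k m i z.1.1 z.1.2 z.2).
Proof. by rewrite /gminus_re; cont. Qed.
Let cgplus_im k m i : continuous (fun z : R * R * R => gplus_im k m i z.1.1 z.1.2 z.2).
Proof. by rewrite /gplus_im; cont. Qed.
Let cgminus_im k m i : continuous (fun z : R * R * R => gminus_im k m i z.1.1 z.1.2 z.2).
Proof. by rewrite /gminus_im; cont. Qed.

Let plus_reE k m i x y : plus_re k m i x y = integ 0 tau (gplus_re k m i x y).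
Proof.
rewrite /gplus_re integD; try by cont.
rewrite integD; try by cont.
rewrite integZ; try by cont.
rewrite [X in _ * X]integD; try by cont.
by rewrite !integZ //; cont.
Qed.
Let minus_reE k m i x y : minus_re k m i x y = integ 0 tau (gminus_re k m i x y).
Proof.
rewrite /gminus_re integB; try by cont.
rewrite integB; try by cont.
rewrite integZ; try by cont.
rewrite [X in _ * X]integB; try by cont.
by rewrite !integZ //; cont.
Qed.
Let plus_imE k m i x y : plus_im k m i x y = integ 0 tau (gplus_im k m i x y).
Proof.
rewrite /gplus_im integD; try by cont.
rewrite integB; try by cont.
rewrite integZ; try by cont.
rewrite [X in _ * X]integB; try by cont.
by rewrite !integZ //; cont.
Qed.
Let minus_imE k m i x y : minus_im k m i x y = integ 0 tau (gminus_im k m i x y).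
Proof.
rewrite /gminus_im integB; try by cont.
rewrite integD; try by cont.
rewrite integZ; try by cont.
rewrite [X in _ * X]integD; try by cont.
by rewrite !integZ //; cont.
Qed.

(** Here cos t d/dx + sin t d/dy = e^{it} d + e^{-it} dbar, so the transport equation times the
    weight of index m + 1 yields eta_+ at index m + 2 and eta_- at index m. The derivatives falling
    on the exponential cancel against the terms k zbar and - k z. *)
Let pointwise_re k m i x y t :
  gplus_re k m.+2 i x y t + gminus_re k m i x y t +
  2 * \sum_j Phi i j x y * (wcos k m.+1 x y t * u j x y t) = 2 * f i x y * wcos k m.+1 x y t.
Proof.
have -> : \sum_j Phi i j x y * (wcos k m.+1 x y t * u j x y t) =
    wcos k m.+1 x y t * \sum_j Phi i j x y * u j x y t.
  by rewrite mulr_sumr; apply: eq_bigr => j _; ring.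
rewrite -(transport_eq i x y t).
(* The vanishing factor cos^2 + sin^2 - 1 is kept so that both sides agree as polynomials. *)
have e : gplus_re k m.+2 i x y t + gminus_re k m i x y t =
    2 * wcos k m.+1 x y t * (cos t * ux i x y t + sin t * uy i x y t) +
    4 * k * qr x y t * wsin k m.+1 x y t * u i x y t * (cos t ^+ 2 + sin t ^+ 2 - 1) +
    (cos t ^+ 2 + sin t ^+ 2 - 1) * 0.
  have wcb : wcos k m x y t = wcos k m.+1 x y t * cos t + wsin k m.+1 x y t * sin t.
    rewrite wcosS wsinS -[LHS]mulr1 -(cos2Dsin2 t); ring.
  have wsb : wsin k m x y t = wsin k m.+1 x y t * cos t - wcos k m.+1 x y t * sin t.
    rewrite wcosS wsinS -[LHS]mulr1 -(cos2Dsin2 t); ring.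
  rewrite /gplus_re /gminus_re /wcos_x /wcos_y /wsin_x /wsin_y.
  rewrite wcb wsb (wcosS k m.+1) (wsinS k m.+1) /phase_x /phase_y /pr /qr.
  ring.
rewrite e cos2Dsin2; ring.
Qed.

Let pointwise_im k m i x y t :
  gplus_im k m.+2 i x y t + gminus_im k m i x y t +
  2 * \sum_j Phi i j x y * (wsin k m.+1 x y t * u j x y t) = 2 * f i x y * wsin k m.+1 x y t.
Proof.
have -> : \sum_j Phi i j x y * (wsin k m.+1 x y t * u j x y t) =
    wsin k m.+1 x y t * \sum_j Phi i j x y * u j x y t.
  by rewrite mulr_sumr; apply: eq_bigr => j _; ring.
rewrite -(transport_eq i x y t).
have e : gplus_im k m.+2 i x y t + gminus_im k m i x y t =
    2 * wsin k m.+1 x y t * (cos t * ux i x y t + sin t * uy i x y t) -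
    4 * k * qr x y t * wcos k m.+1 x y t * u i x y t * (cos t ^+ 2 + sin t ^+ 2 - 1).
  have wcb : wcos k m x y t = wcos k m.+1 x y t * cos t + wsin k m.+1 x y t * sin t.
    rewrite wcosS wsinS -[LHS]mulr1 -(cos2Dsin2 t); ring.
  have wsb : wsin k m x y t = wsin k m.+1 x y t * cos t - wcos k m.+1 x y t * sin t.
    rewrite wcosS wsinS -[LHS]mulr1 -(cos2Dsin2 t); ring.
  rewrite /gplus_im /gminus_im /wcos_x /wcos_y /wsin_x /wsin_y.
  rewrite wcb wsb (wcosS k m.+1) (wsinS k m.+1) /phase_x /phase_y /pr /qr.
  ring.
rewrite e cos2Dsin2; ring.
Qed.

(** The source leaves no trace: it is constant in [t], and weights of index m + 1 >= 1 integrate to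
    zero. *)
Let mode_re k m i x y : plus_re k m.+2 i x y + minus_re k m i x y +
  2 * \sum_j Phi i j x y * mode_cos k m.+1 j x y = 0.
Proof.
have [w0 _] := integ_weights k x y m.
have -> : \sum_j Phi i j x y * mode_cos k m.+1 j x y =
    integ 0 tau (fun t => \sum_j Phi i j x y * (wcos k m.+1 x y t * u j x y t)).
  by rewrite integ_sum; [apply: eq_bigr => j _; rewrite integZ //|move=> j]; cont.
rewrite plus_reE minus_reE -integZ; last by cont.
rewrite -!integD; try by cont.
have -> : (fun t => gplus_re k m.+2 i x y t + gminus_re k m i x y t +
    2 * \sum_j Phi i j x y * (wcos k m.+1 x y t * u j x y t)) =
    (fun t => 2 * f i x y * wcos k m.+1 x y t).
  by apply/funext => t; exact: pointwise_re.
by rewrite integZ ?w0 ?mulr0 //; cont.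
Qed.

Let mode_im k m i x y : plus_im k m.+2 i x y + minus_im k m i x y +
  2 * \sum_j Phi i j x y * mode_sin k m.+1 j x y = 0.
Proof.
have [_ w0] := integ_weights k x y m.
have -> : \sum_j Phi i j x y * mode_sin k m.+1 j x y =
    integ 0 tau (fun t => \sum_j Phi i j x y * (wsin k m.+1 x y t * u j x y t)).
  by rewrite integ_sum; [apply: eq_bigr => j _; rewrite integZ //|move=> j]; cont.
rewrite plus_imE minus_imE -integZ; last by cont.
rewrite -!integD; try by cont.
have -> : (fun t => gplus_im k m.+2 i x y t + gminus_im k m i x y t +
    2 * \sum_j Phi i j x y * (wsin k m.+1 x y t * u j x y t)) =
    (fun t => 2 * f i x y * wsin k m.+1 x y t).
  by apply/funext => t; exact: pointwise_im.
by rewrite integZ ?w0 ?mulr0 //; cont.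
Qed.

Let phase_split k m x y t : phase k m x y t = m%:R * t + phase k 0 x y t.
Proof. by rewrite /phase mul0r sub0r. Qed.

Let wcos_split k m x y t : wcos k m x y t =
  cos (m%:R * t) * wcos k 0 x y t - sin (m%:R * t) * wsin k 0 x y t.
Proof. by rewrite /wcos /wsin (phase_split k m) cosD; ring. Qed.

Let wsin_split k m x y t : wsin k m x y t =
  sin (m%:R * t) * wcos k 0 x y t + cos (m%:R * t) * wsin k 0 x y t.
Proof. by rewrite /wcos /wsin (phase_split k m) sinD; ring. Qed.

(** The index enters only through e^{imt}, multiplying a fixed 2 pi-periodic integrand: the form
    required by [riemann_lebesgue]. *)
Let gminus_re_split k m i x y t : gminus_re k m i x y t =
  cos (m%:R * t) * gminus_re k 0 i x y t - sin (m%:R * t) * gminus_im k 0 i x y t.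
Proof.
rewrite /gminus_re /gminus_im /wcos_x /wcos_y /wsin_x /wsin_y !(wcos_split k m) !(wsin_split k m).
ring.
Qed.

Let gminus_im_split k m i x y t : gminus_im k m i x y t =
  sin (m%:R * t) * gminus_re k 0 i x y t + cos (m%:R * t) * gminus_im k 0 i x y t.
Proof.
rewrite /gminus_re /gminus_im /wcos_x /wcos_y /wsin_x /wsin_y !(wcos_split k m) !(wsin_split k m).
ring.
Qed.

Let pux i x y t : ux i x y (t + tau) = ux i x y t.
Proof.
have [_ <-] := dux i x y (t + tau); have [_ <-] := dux i x y t.
by congr ('D_1 _ x); apply/funext => x'; rewrite pu.
Qed.
Let puy i x y t : uy i x y (t + tau) = uy i x y t.
Proof.
have [_ <-] := duy i x y (t + tau); have [_ <-] := duy i x y t.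
by congr ('D_1 _ y); apply/funext => y'; rewrite pu.
Qed.

Let cT t : cos (t + tau) = cos t. Proof. exact: cosD2pi. Qed.
Let sT t : sin (t + tau) = sin t. Proof. exact: sinD2pi. Qed.
Let pT x y t : pr x y (t + tau) = pr x y t. Proof. by rewrite /pr cT sT. Qed.
Let qT x y t : qr x y (t + tau) = qr x y t. Proof. by rewrite /qr cT sT. Qed.
Let wcT k x y t : wcos k 0 x y (t + tau) = wcos k 0 x y t.
Proof. by rewrite /wcos /amp /phase pT qT !mul0r. Qed.
Let wsT k x y t : wsin k 0 x y (t + tau) = wsin k 0 x y t.
Proof. by rewrite /wsin /amp /phase pT qT !mul0r. Qed.

Let pgminus_re k i x y t : gminus_re k 0 i x y (t + tau) = gminus_re k 0 i x y t.
Proof.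
by rewrite /gminus_re /wcos_x /wsin_y /phase_x /phase_y pT qT wcT wsT cT sT pux puy pu.
Qed.
Let pgminus_im k i x y t : gminus_im k 0 i x y (t + tau) = gminus_im k 0 i x y t.
Proof.
by rewrite /gminus_im /wsin_x /wcos_y /phase_x /phase_y pT qT wcT wsT cT sT pux puy pu.
Qed.

Let box : set (R * R) := `[- (r + 1), r + 1]%classic `*` `[- (r + 1), r + 1]%classic.

Let minus_small k i (e : R) : 0 < e -> exists N : nat, forall m, (N <= m)%N ->
  forall x y, box (x, y) -> `|minus_re k m i x y| <= e /\ `|minus_im k m i x y| <= e.
Proof.
move=> e0; have e2 : 0 < e / 2 by rewrite divr_gt0.
have cbox : compact box by apply: compact_setX; exact: segment_compact.
have cre : continuous (fun z : (R * R) * R => gminus_re k 0 i z.1.1 z.1.2 z.2) by exact: cgminus_re.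
have cim : continuous (fun z : (R * R) * R => gminus_im k 0 i z.1.1 z.1.2 z.2) by exact: cgminus_im.
have ap : forall t, cos (t + pi) = - cos t :> R by exact: cosDpi.
have asn : forall t, sin (t + pi) = - sin t :> R by exact: sinDpi.
have RL (c : R -> R) (F : R -> R -> R -> R) := riemann_lebesgue _ box (fun z => F z.1 z.2) c (e / 2) cbox.
have [N1 h1] := RL cos (gminus_re k 0 i) cre (fun s => pgminus_re k i s.1 s.2) (@continuous_cos R) (@norm_cos_le1 R) ap e2.
have [N2 h2] := RL sin (gminus_re k 0 i) cre (fun s => pgminus_re k i s.1 s.2) (@continuous_sin R) (@norm_sin_le1 R) asn e2.
have [N3 h3] := RL cos (gminus_im k 0 i) cim (fun s => pgminus_im k i s.1 s.2) (@continuous_cos R) (@norm_cos_le1 R) ap e2.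
have [N4 h4] := RL sin (gminus_im k 0 i) cim (fun s => pgminus_im k i s.1 s.2) (@continuous_sin R) (@norm_sin_le1 R) asn e2.
exists (maxn (maxn N1 N2) (maxn N3 N4)) => m; rewrite !geq_max => /andP[/andP[m1 m2] /andP[m3 m4]].
move=> x y bxy; rewrite minus_reE minus_imE; split.
  have -> : gminus_re k m i x y = (fun t => cos (m%:R * t) * gminus_re k 0 i x y t -
      sin (m%:R * t) * gminus_im k 0 i x y t) by apply/funext => t; exact: gminus_re_split.
  rewrite integB; try by cont.
  by rewrite (le_trans (ler_normB _ _)) // (splitr e) lerD //; [exact: (h1 m m1 (x, y))|exact: (h4 m m4 (x, y))].
have -> : gminus_im k m i x y = (fun t => sin (m%:R * t) * gminus_re k 0 i x y t +
    cos (m%:R * t) * gminus_im k 0 i x y t) by apply/funext => t; exact: gminus_im_split.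
rewrite integD; try by cont.
by rewrite (le_trans (ler_normD _ _)) // (splitr e) lerD //; [exact: (h2 m m2 (x, y))|exact: (h3 m m3 (x, y))].
Qed.

Let cminus_re k m i : continuous (fun z : R * R => minus_re k m i z.1 z.2).
Proof. by rewrite /minus_re /eta_minus_re; cont. Qed.
Let cminus_im k m i : continuous (fun z : R * R => minus_im k m i z.1 z.2).
Proof. by rewrite /minus_im /eta_minus_im; cont. Qed.

Let decay k : integ2 (r + 1) (fun x y => \sum_i (minus_re k m i x y ^+ 2 +
  minus_im k m i x y ^+ 2)) @[m --> \oo] --> (0 : R).
Proof.
have r10 : 0 <= r + 1 by rewrite addr_ge0.
have cz (e : R) m i : 0 < e -> (forall x y, box (x, y) -> `|minus_re k m i x y| <= e /\ `|minus_im k m i x y| <= e) ->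
  integ2 (r + 1) (fun x y => minus_re k m i x y ^+ 2 + minus_im k m i x y ^+ 2) <=
  (2 * e ^+ 2) * (r + 1 + (r + 1)) ^+ 2.
  move=> e0 h; rewrite -integ2_cst; apply: integ2_le_in => //; try by cont.
  move=> x y xr yr.
  have bxy : box (x, y) by split; rewrite /= in_itv.
  have [h1 h2] := h x y bxy.
  rewrite mulr2n mulrDl mul1r -(real_normK (num_real (minus_re k m i x y))).
  rewrite -(real_normK (num_real (minus_im k m i x y))).
  by rewrite lerD // ler_pXn2r // ?nnegrE // ltW.
have -> : (fun m => integ2 (r + 1) (fun x y => \sum_i (minus_re k m i x y ^+ 2 +
    minus_im k m i x y ^+ 2))) = (fun m => \sum_i integ2 (r + 1) (fun x y =>
    minus_re k m i x y ^+ 2 + minus_im k m i x y ^+ 2)).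
  by apply/funext => m; rewrite integ2_sum // => i; cont.
suff H i : integ2 (r + 1) (fun x y => minus_re k m i x y ^+ 2 + minus_im k m i x y ^+ 2)
    @[m --> \oo] --> (0 : R).
  elim: (index_enum I) => [|i s IH].
    by under eq_fun do rewrite big_nil; exact: cvg_cst.
  under eq_fun do rewrite big_cons.
  by have c := cvgD (H i) IH; rewrite addr0 in c; exact: c.
apply/cvgrPdist_le => e e0.
pose D := (r + 1 + (r + 1)) ^+ 2 + 1.
have D1 : 1 <= D by rewrite lerDr sqr_ge0.
(* The minimum with 1 gives d^2 <= d, so a bound linear in [d] suffices. *)
pose d := Num.min 1 (e / (2 * D)).
have D0 : 0 < D by apply: lt_le_trans D1.
have d0 : 0 < d by rewrite lt_min ltr01 divr_gt0 // mulr_gt0.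
have [N hN] := minus_small k i d d0.
exists N => // m /= Nm; rewrite sub0r normrN ger0_norm; last first.
  by apply: integ2_ge0 => //; [cont|move=> x y; rewrite addr_ge0 ?sqr_ge0].
apply: (le_trans (cz d m i d0 (hN m Nm))).
have d1 : d <= 1 by rewrite ge_min lexx.
have d2 : d * (2 * D) <= e by rewrite -ler_pdivlMr ?mulr_gt0 // ge_min lexx orbT.
have d3 : d ^+ 2 <= d by rewrite expr2 ler_piMl // ltW.
apply: le_trans d2.
have DD : 0 <= (r + 1 + (r + 1)) ^+ 2 by rewrite sqr_ge0.
have DE : (r + 1 + (r + 1)) ^+ 2 <= D by rewrite /D lerDl.
have := ler_wpM2r DD d3; have := ler_wpM2l (ltW d0) DE; lra.
Qed.

(** Conjugation with large [k] removes the modes of nonzero index. The mode equation for the lowest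
    index then shows that mode 0 is constant, and averaging the transport equation over directions
    isolates [f]. *)
Lemma linear_transport_source_eq0 : forall i x y, f i x y = 0.
Proof.
pose n : R := #|I|%:R.
pose C : R := 4 * M * n + 4 * (M ^+ 2 * n ^+ 2).
pose k : R := C / 4 + 1.
have kC : C < 4 * k by rewrite /k; lra.
have Pk m j x y : mode_cos k m.+1 j x y = 0 /\ mode_sin k m.+1 j x y = 0.
  exact: (modes_eq0 r k M (mode_cos k) (mode_cos_x k) (mode_cos_y k) (mode_sin k)
    (mode_sin_x k) (mode_sin_y k) Phi Phix Phiy r0 (cP k) (cPx k) (cPy k) (cQ k) (cQx k)
    (cQy k) (dPx k) (dPy k) (dQx k) (dQy k) (sP k) (sQ k) cPhi cPhix cPhiy dPhix dPhiy
    skew M0 bPhi bPhix bPhiy (mode_re k) (mode_im k) (decay k) kC).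
(* Back to [k = 0], where the weights are plain cosines and sines. *)
have P0 m j x y : mode_cos 0 m.+1 j x y = 0 /\ mode_sin 0 m.+1 j x y = 0.
  apply: (modes_transfer x y (u j x y) k); first by cont.
  by move=> m'; exact: Pk.
have der0 (g : R -> R) (a d : R) : is_derive a 1 g d -> (forall b, g b = 0) -> d = 0.
  move=> dg g0; have [_ <-] := dg.
  rewrite (_ : g = fun=> 0); last by apply/funext.
  by have [_ ->] := is_derive_const (0 : R) a.
have S0 j x y : mode_sin 0 0 j x y = 0.
  rewrite -[RHS](integ0 0 tau); congr integ; apply/funext => t.
  by rewrite wsin0 mul0r sin0 mul0r.
have Z1 m j x y : mode_cos_x 0 m.+1 j x y = 0.
  by apply: (der0 _ _ _ (dPx 0 m.+1 j x y)) => b; have [] := P0 m j b y.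
have Z2 m j x y : mode_sin_y 0 m.+1 j x y = 0.
  by apply: (der0 _ _ _ (dQy 0 m.+1 j x y)) => b; have [] := P0 m j x b.
have Z3 j x y : mode_sin_y 0 0 j x y = 0.
  by apply: (der0 _ _ _ (dQy 0 0 j x y)) => b.
(* In the mode equation with [m = 0], the terms of index 1 and 2 vanish; mode 0 is real, so what
   remains is its derivative in [x]. *)
have X0 j x y : mode_cos_x 0 0 j x y = 0.
  have := mode_re 0 0 j x y.
  rewrite /plus_re /minus_re /eta_plus_re /eta_minus_re Z1 Z2 Z3 mulr0 !mul0r.
  rewrite big1; first by rewrite mulr0 !addr0 add0r !subr0.
  by move=> l _; have [-> _] := P0 0%N l x y; rewrite mulr0.
have U0 j x y : mode_cos 0 0 j x y = 0.
  have d (a : R) : is_derive a 1 (fun x => mode_cos 0 0 j x y) 0.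
    by have := dPx 0 0 j a y; rewrite X0.
  rewrite (@is_derive_0_is_cst _ (fun x => mode_cos 0 0 j x y) x r d).
  by apply: sP; left; exact: ler_norm.
(* Integrated over a period, the transport equation has 2 pi f on the right and only modes 0 and 1
   on the left, all known to vanish. *)
move=> i x y; have E : integ 0 tau (fun t => f i x y) = 0.
  have -> : (fun t => f i x y) = (fun t =>
      (wcos_x 0 1 x y t * u i x y t + wcos 0 1 x y t * ux i x y t) +
      (wsin_y 0 1 x y t * u i x y t + wsin 0 1 x y t * uy i x y t) +
      \sum_j Phi i j x y * (wcos 0 0 x y t * u j x y t)).
    apply/funext => t; rewrite -(transport_eq i x y t).
    rewrite /wcos_x /wsin_y /phase_x /phase_y !wcos0 !wsin0 mul1r mul0r cos0.
    congr (_ + _); first by ring.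
    by apply: eq_bigr => j _; rewrite mul1r.
  rewrite integD; try by cont.
  rewrite integD; try by cont.
  rewrite [X in X + _](_ : _ = mode_cos_x 0 1 i x y + mode_sin_y 0 1 i x y) //.
  rewrite Z1 Z2 addr0 add0r integ_sum; last by move=> j; cont.
  by apply: big1 => j _; rewrite integZ; [rewrite [X in _ * X]U0 mulr0|cont].
move: E; rewrite integ_cst subr0 => /eqP; rewrite mulf_eq0 => /orP[/eqP //|].
by rewrite mulrn_eq0 /= gt_eqF ?pi_gt0.
Qed.

End LinearTransport.

(** * Fundamental solutions along lines *)

Section ChainRule.
Context {R : realType}.
Implicit Types (x y s t : R).

(** The increment is split at (a x, b y): the change in the first argument is handled by the mean
    value theorem and joint continuity of [Fa], the change in the second by the chain rule in one
    variable. *)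
Lemma is_derive_affine2 (F Fa Fb : R -> R -> R) (c1 d1 c2 d2 x : R) :
  (forall s t, is_derive s 1 (fun s => F s t) (Fa s t)) ->
  (forall s t, is_derive t 1 (fun t => F s t) (Fb s t)) ->
  continuous (fun z : R * R => Fa z.1 z.2) ->
  is_derive x 1 (fun x => F (c1 * x + d1) (c2 * x + d2))
    (c1 * Fa (c1 * x + d1) (c2 * x + d2) + c2 * Fb (c1 * x + d1) (c2 * x + d2)).
Proof.
move=> dFa dFb cFa.
pose a y := c1 * y + d1; pose b y := c2 * y + d2.
have da y : is_derive y 1 a c1 by rewrite /a; der; ring.
have db y : is_derive y 1 b c2 by rewrite /b; der; ring.
have ca : continuous a by exact: is_derive_continuous da.
have cb : continuous b by exact: is_derive_continuous db.
have d2' : is_derive x 1 (fun y => F (a x) (b y)) (c2 * Fb (a x) (b x)).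
  by have := is_derive_comp_fun (F (a x)) b x _ _ (dFb (a x) (b x)) (db x); rewrite mulrC.
have d1' : is_derive x 1 (fun y => F (a y) (b y) - F (a x) (b y)) (c1 * Fa (a x) (b x)).
  apply: is_derive_approx => e e0.
  pose e' := e / (`|c1| + 1).
  have c10 : 0 < `|c1| + 1 by rewrite ltr_wpDl.
  have e'0 : 0 < e' by rewrite divr_gt0.
  have /cvgrPdist_lt/(_ _ e'0) /nbhs_ballP [r /= r0 hr] := cFa (a x, b x).
  near=> y.
  have hb : `|b x - b y| < r.
    by near: y; have /cvgrPdist_lt/(_ _ r0) := cb x.
  have ha : `|a x - a y| < r.
    by near: y; have /cvgrPdist_lt/(_ _ r0) := ca x.
  have [c [-> h1 h2]] := mean_value _ _ (a x) (a y) (fun s => dFa s (b y)).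
  rewrite subrr subr0 (_ : a y - a x = c1 * (y - x)); last by rewrite /a; ring.
  have h : `|Fa (a x) (b x) - Fa c (b y)| < e'.
    apply: (hr (c, b y)); split => //=.
    move: h1 h2 ha; rewrite /ball /= /Num.min /Num.max; case: ltP => _ h1 h2.
      by rewrite !ltr_norml; lra.
    by rewrite !ltr_norml; lra.
  rewrite (_ : _ - _ = - (c1 * (Fa (a x) (b x) - Fa c (b y)) * (y - x))); last by ring.
  rewrite normrN normrM ler_wpM2r // normrM.
  apply: (@le_trans _ _ ((`|c1| + 1) * e')); last by rewrite mulrC divfK // gt_eqF.
  by rewrite ler_pM // ?(ltW h) // lerDl.
have := is_derive_add _ _ _ _ _ d1' d2'.
by under eq_fun do rewrite subrK.
Unshelve. all: by end_near. Qed.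

Lemma zero_derive_eq (f f' : R -> R) (a b : R) : (forall x, is_derive x 1 f (f' x)) ->
  (forall x, Num.min a b <= x -> x <= Num.max a b -> f' x = 0) -> f a = f b.
Proof.
move=> df h; have [c [e h1 h2]] := mean_value _ _ a b df.
by apply/esym/eqP; rewrite -subr_eq0 e h // mul0r.
Qed.

End ChainRule.

(** * Solutions along the lines of the plane *)

Section LineODE.
Context {R : realType}.
Implicit Types (x y q b p s t w : R) (i j k l : 'I_3).
Notation "'tau'" := ((pi : R) *+ 2) (at level 0).

(* Lines of the plane are [p |-> (p cos b + q sin b, p sin b - q cos b)]. *)
Definition along_line (A : 'I_3 -> 'I_3 -> R -> R -> R) i j q b p : R :=
  A i j (p * cos b + q * sin b) (p * sin b - q * cos b).

(** The limit condition at minus infinity becomes the value at [- L], before which the coefficients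
    vanish. The index [k] is the column. *)
Definition line_solution (A : 'I_3 -> 'I_3 -> R -> R -> R) (L q b : R)
    (Y : 'I_3 -> 'I_3 -> R -> R) : Prop :=
  (forall i k p, is_derive p 1 (Y i k) (\sum_j along_line A i j q b p * Y j k p)) /\
  (forall i k, Y i k (- L) = (i == k)%:R).

(** [M] and [L] are parameters so that two fields can share the same bound and the same support
    radius. *)
Record plane_field (M L : R) (A Ax Ay : 'I_3 -> 'I_3 -> R -> R -> R) : Prop := PlaneField {
  pf_cont : forall i j, continuous (fun z : R * R => A i j z.1 z.2);
  pf_cont_x : forall i j, continuous (fun z : R * R => Ax i j z.1 z.2);
  pf_cont_y : forall i j, continuous (fun z : R * R => Ay i j z.1 z.2);
  pf_dx : forall i j x y, is_derive x 1 (fun x => A i j x y) (Ax i j x y);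
  pf_dy : forall i j x y, is_derive y 1 (fun y => A i j x y) (Ay i j x y);
  pf_skew : forall i j x y, A i j x y = - A j i x y;
  pf_bound : forall i j x y, `|A i j x y| <= M;
  pf_bound_x : forall i j x y, `|Ax i j x y| <= M;
  pf_bound_y : forall i j x y, `|Ay i j x y| <= M;
  pf_supp : forall i j x y, L ^+ 2 <= x ^+ 2 + y ^+ 2 -> A i j x y = 0 }.

Section OneField.
Variables (M L : R) (A Ax Ay : 'I_3 -> 'I_3 -> R -> R -> R).
Hypothesis L0 : 0 < L.
Hypothesis pfA : plane_field M L A Ax Ay.

Lemma along_line_outside i j q b p : L <= `|p| \/ L <= `|q| -> along_line A i j q b p = 0.
Proof.
move=> h; apply: (pf_supp _ _ _ _ _ pfA).
have -> : (p * cos b + q * sin b) ^+ 2 + (p * sin b - q * cos b) ^+ 2 =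
  (p ^+ 2 + q ^+ 2) * (cos b ^+ 2 + sin b ^+ 2) by ring.
rewrite cos2Dsin2 mulr1.
have pq (a : R) : L <= `|a| -> L ^+ 2 <= a ^+ 2.
  by move=> La; rewrite -(real_normK (num_real a)) ler_pXn2r // nnegrE // ltW.
by have := sqr_ge0 p; have := sqr_ge0 q; case: h => /pq; lra.
Qed.

Lemma line_solution_outside q b (Y : 'I_3 -> 'I_3 -> R -> R) i k p :
  line_solution A L q b Y -> L <= `|q| \/ p <= - L -> Y i k p = (i == k)%:R.
Proof.
move=> [dY iY] h; rewrite -iY; apply: (zero_derive_eq _ _ _ _ (dY i k)) => s s1 s2.
apply: big1 => j _; rewrite along_line_outside ?mul0r //.
case: h => h; first by right.
left; rewrite ler_normr; apply/orP; right.
by move: s2; rewrite le_max => /orP[]; lra.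
Qed.

Lemma line_solution_after q b (Y : 'I_3 -> 'I_3 -> R -> R) i k p :
  line_solution A L q b Y -> L <= p -> Y i k p = Y i k L.
Proof.
move=> [dY iY] h; apply: (zero_derive_eq _ _ _ _ (dY i k)) => s s1 s2.
apply: big1 => j _; rewrite along_line_outside ?mul0r //.
left; rewrite ler_normr; apply/orP; left.
by move: s1; rewrite ge_min => /orP[]; lra.
Qed.

Lemma line_solution_unique q b (Y Y' : 'I_3 -> 'I_3 -> R -> R) :
  line_solution A L q b Y -> line_solution A L q b Y' -> forall i k p, Y i k p = Y' i k p.
Proof.
move=> [dY iY] [dY' iY'] i k p.
have M0 : 0 <= M by apply: le_trans (pf_bound _ _ _ _ _ pfA 0 0 0 0).
apply: (linear_ode_unique (fun i j p => along_line A i j q b p) (fun i => Y i k)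
  (fun i => Y' i k) M (- L) M0) => //.
- by move=> i' j' t; exact: (pf_bound _ _ _ _ _ pfA).
- by move=> i'; rewrite iY iY'.
Qed.

(** Skewness makes Y^T Y constant, hence the identity. The conclusion concerns Y Y^T, which follows
    because a left inverse of a square matrix is a right inverse. *)
Lemma line_solution_orthogonal q b (Y : 'I_3 -> 'I_3 -> R -> R) i j p :
  line_solution A L q b Y -> \sum_k Y i k p * Y j k p = (i == j)%:R.
Proof.
move=> [dY iY].
have h1 k l : \sum_m Y m k p * Y m l p = (k == l)%:R.
  have d s : is_derive s 1 (fun s => \sum_m Y m k s * Y m l s) 0.
    der.
    rewrite big_split /= addrC.
    have := sum_skew _ (fun m n => along_line A m n q b s) (fun m => Y m k s) (fun m => Y m l s).
    move=> ->; last by move=> m n; exact: (pf_skew _ _ _ _ _ pfA).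
    by rewrite addNr.
  rewrite (@is_derive_0_is_cst _ (fun s => \sum_m Y m k s * Y m l s) p (- L) d).
  rewrite (bigD1 k) //= big1 => [|m mk].
    by rewrite !iY eqxx mul1r addr0.
  by rewrite iY (negbTE mk) mul0r.
pose S := \matrix_(m < 3, k < 3) Y m k p.
have SS : S^T *m S = 1%:M.
  by apply/matrixP => k l; rewrite !mxE -h1; apply: eq_bigr => m _; rewrite !mxE.
have /matrixP/(_ i j) := mulmx1C SS.
by rewrite !mxE => <-; apply: eq_bigr => m _; rewrite !mxE.
Qed.

(** At a fixed direction, moving the point changes only the offset [q] and the time [p]; so [Z], the
    derivative in [q], is all that is required besides the equation itself. *)
Lemma line_solution_family : exists Y Z : 'I_3 -> 'I_3 -> R -> R -> R -> R,
  [/\ forall i k, continuous (fun z : R * R * R => Y i k z.1.1 z.1.2 z.2),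
      forall i k, continuous (fun z : R * R * R => Z i k z.1.1 z.1.2 z.2),
      forall i k q b p, is_derive q 1 (fun q => Y i k q b p) (Z i k q b p) &
      forall q b, line_solution A L q b (fun i k => Y i k q b)].
Proof.
have cA := pf_cont _ _ _ _ _ pfA.
have cAx := pf_cont_x _ _ _ _ _ pfA.
have cAy := pf_cont_y _ _ _ _ _ pfA.
have M0 : 0 <= M by apply: le_trans (pf_bound _ _ _ _ _ pfA 0 0 0 0).
pose Aq i j q b p := sin b * Ax i j (p * cos b + q * sin b) (p * sin b - q * cos b) +
  (- cos b) * Ay i j (p * cos b + q * sin b) (p * sin b - q * cos b).
have cL i j : continuous (fun z : R * R * R => along_line A i j z.1.1 z.1.2 z.2).
  by rewrite /along_line; cont.
have cLq i j : continuous (fun z : R * R * R => Aq i j z.1.1 z.1.2 z.2).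
  by rewrite /Aq; cont.
have dL i j q b p : is_derive q 1 (fun q => along_line A i j q b p) (Aq i j q b p).
  have := is_derive_affine2 _ _ _ (sin b) (p * cos b) (- cos b) (p * sin b) q
    (pf_dx _ _ _ _ _ pfA i j) (pf_dy _ _ _ _ _ pfA i j) (cAx i j).
  rewrite /along_line /Aq.
  have -> : sin b * q + p * cos b = p * cos b + q * sin b by ring.
  have -> : - cos b * q + p * sin b = p * sin b - q * cos b by ring.
  rewrite (_ : (fun x => A i j (sin b * x + p * cos b) (- cos b * x + p * sin b)) =
    (fun q => A i j (p * cos b + q * sin b) (p * sin b - q * cos b))) //.
  by apply/funext => x; congr (A i j _ _); ring.
have bL i j q b p : `|along_line A i j q b p| <= 2 * M.
  by rewrite (le_trans (pf_bound _ _ _ _ _ pfA _ _ _ _)) // ler_peMl // ler1n.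
have bLq i j q b p : `|Aq i j q b p| <= 2 * M.
  rewrite mulr2n mulrDl mul1r /Aq (le_trans (ler_normD _ _)) // lerD // normrM -[leRHS]mul1r.
    by rewrite ler_pM // ?norm_sin_le1 // (pf_bound_x _ _ _ _ _ pfA).
  by rewrite ler_pM // ?normrN ?norm_cos_le1 // (pf_bound_y _ _ _ _ _ pfA).
have sL i j q b p : L <= `|p| -> along_line A i j q b p = 0.
  by move=> h; apply: along_line_outside; left.
have ex k := linear_ode_family (fun i j => along_line A i j) Aq (2 * M) L (- L)
  (fun i => (i == k)%:R) cL cLq dL bL bLq sL.
pose Y i k := sval (cid (ex k)) i.
have exZ k := svalP (cid (ex k)).
pose Z i k := sval (cid (exZ k)) i.
have H k := svalP (cid (exZ k)).
exists Y, Z; split.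
- by move=> i k; have [h _ _ _ _] := H k; exact: h.
- by move=> i k; have [_ h _ _ _] := H k; exact: h.
- by move=> i k; have [_ _ _ h _] := H k; exact: h.
- move=> q b; split; first by move=> i k; have [_ _ h _ _] := H k; exact: h.
  by move=> i k; have [_ _ _ _ h] := H k; exact: h.
Qed.

End OneField.

Section TwoFields.
Variables (M L : R) (A Ax Ay A' Ax' Ay' : 'I_3 -> 'I_3 -> R -> R -> R).
Hypothesis L0 : 0 < L.
Hypothesis pfA : plane_field M L A Ax Ay.
Hypothesis pfA' : plane_field M L A' Ax' Ay'.
Hypothesis same_data : forall q b (Y Y' : 'I_3 -> 'I_3 -> R -> R),
  line_solution A L q b Y -> line_solution A' L q b Y' ->
  forall i k, Y i k L = Y' i k L.

(* [G = Y Y'^T] satisfies [dG/dp = A G - G A'], equals [1] before the support,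
   and, by equality of the data, also after it. *)
Lemma plane_field_unique : forall i j x y, A i j x y = A' i j x y.
Proof.
have [Y [Z [cY cZ dZ sY]]] := line_solution_family _ _ _ _ _ L0 pfA.
have [Y' [Z' [cY' cZ' dZ' sY']]] := line_solution_family _ _ _ _ _ L0 pfA'.
have M0 : 0 <= M by apply: le_trans (pf_bound _ _ _ _ _ pfA 0 0 0 0).
pose G i j q b p := \sum_k Y i k q b p * Y' j k q b p.
pose Gq i j q b p := \sum_k (Z i k q b p * Y' j k q b p + Y i k q b p * Z' j k q b p).
pose Gp i j q b p := \sum_k
  ((\sum_l along_line A i l q b p * Y l k q b p) * Y' j k q b p +
   Y i k q b p * (\sum_l along_line A' j l q b p * Y' l k q b p)).
have cA := pf_cont _ _ _ _ _ pfA; have cA' := pf_cont _ _ _ _ _ pfA'.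
have cL i j : continuous (fun z : R * R * R => along_line A i j z.1.1 z.1.2 z.2).
  by rewrite /along_line; cont.
have cL' i j : continuous (fun z : R * R * R => along_line A' i j z.1.1 z.1.2 z.2).
  by rewrite /along_line; cont.
have cG i j : continuous (fun z : R * R * R => G i j z.1.1 z.1.2 z.2) by rewrite /G; cont.
have cGq i j : continuous (fun z : R * R * R => Gq i j z.1.1 z.1.2 z.2) by rewrite /Gq; cont.
have cGp i j : continuous (fun z : R * R * R => Gp i j z.1.1 z.1.2 z.2) by rewrite /Gp; cont.
have dGq i j q b p : is_derive q 1 (fun q => G i j q b p) (Gq i j q b p) by rewrite /G; der.
have dGp i j q b p : is_derive p 1 (fun p => G i j q b p) (Gp i j q b p).
  have dY k := (sY q b).1 k; have dY' k := (sY' q b).1 k.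
  by rewrite /G; der.
have GpE i j q b p : Gp i j q b p =
    \sum_l along_line A i l q b p * G l j q b p + \sum_l along_line A' j l q b p * G i l q b p.
  rewrite /Gp big_split /=; congr (_ + _).
    under eq_bigr => k _ do rewrite mulr_suml.
    rewrite exchange_big; apply: eq_bigr => l _ /=.
    by rewrite /G mulr_sumr; apply: eq_bigr => k _; ring.
  under eq_bigr => k _ do rewrite mulr_sumr.
  rewrite exchange_big; apply: eq_bigr => l _ /=.
  by rewrite /G mulr_sumr; apply: eq_bigr => k _; ring.
have per (c : R) : cos (c + tau) = cos c /\ sin (c + tau) = sin c.
  by split; [exact: cosD2pi|exact: sinD2pi].
(* The angles [b] and [b] + 2 pi describe the same line, so uniqueness applies. *)
have GT i j q b p : G i j q (b + tau) p = G i j q b p.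
  have [c1 s1] := per b.
  have sh (F : 'I_3 -> 'I_3 -> R -> R -> R) W : line_solution F L q (b + tau) W -> line_solution F L q b W.
    move=> [h1 h2]; split => // i' k' p'; have := h1 i' k' p'.
    by rewrite /along_line c1 s1.
  apply: eq_bigr => k _.
  rewrite (line_solution_unique _ _ _ _ _ pfA _ _ _ _ (sh _ _ (sY q (b + tau))) (sY q b)).
  by rewrite (line_solution_unique _ _ _ _ _ pfA' _ _ _ _ (sh _ _ (sY' q (b + tau))) (sY' q b)).
have Gout i j q b p : L <= `|p| \/ L <= `|q| -> G i j q b p = (i == j)%:R.
  move=> h.
  have [h'|h'] : (L <= `|q| \/ p <= - L) \/ L <= p.
    case: h => [|h]; last by left; left.
    rewrite ler_normr => /orP[h|h]; first by right.
    by left; right; lra.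
    rewrite /G (bigD1 i) //= big1 => [|k ki].
      rewrite (line_solution_outside _ _ _ _ _ L0 pfA _ _ _ _ _ _ (sY q b) h').
      rewrite (line_solution_outside _ _ _ _ _ L0 pfA' _ _ _ _ _ _ (sY' q b) h').
      by rewrite eqxx mul1r addr0 eq_sym.
    rewrite (line_solution_outside _ _ _ _ _ L0 pfA _ _ _ _ _ _ (sY q b) h').
    by rewrite eq_sym (negbTE ki) mul0r.
  (* After the support both solutions are frozen at their values at [L], which agree by equality of
     the data, so [G] is Y Y^T there. *)
  rewrite /G -(line_solution_orthogonal _ _ _ _ _ pfA q b _ i j L (sY q b)).
  apply: eq_bigr => k _.
  rewrite (line_solution_after _ _ _ _ _ L0 pfA _ _ _ _ _ _ (sY q b) h').
  rewrite (line_solution_after _ _ _ _ _ L0 pfA' _ _ _ _ _ _ (sY' q b) h').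
  by rewrite -(same_data _ _ _ _ (sY q b) (sY' q b)).
pose I := ('I_3 * 'I_3)%type.
pose dl (a b : 'I_3) : R := (a == b)%:R.
(* [u] at (x, y) in direction [t] reads [G] in line coordinates: q = x sin t - y cos t is the offset
   and p = x cos t + y sin t the position on the line. *)
pose u (c : I) x y t := G c.1 c.2 (x * sin t - y * cos t) t (x * cos t + y * sin t) - dl c.1 c.2.
pose ux (c : I) x y t := sin t * Gq c.1 c.2 (x * sin t - y * cos t) t (x * cos t + y * sin t) +
  cos t * Gp c.1 c.2 (x * sin t - y * cos t) t (x * cos t + y * sin t).
pose uy (c : I) x y t := - cos t * Gq c.1 c.2 (x * sin t - y * cos t) t (x * cos t + y * sin t) +
  sin t * Gp c.1 c.2 (x * sin t - y * cos t) t (x * cos t + y * sin t).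
(* For the fields this is the operator u |-> -(A u - u A') on matrices, written on pairs of indices;
   the second sign reflects skewness of A'. The same formula applied to the derivatives of the
   fields gives those of the operator. *)
pose PhiOf (F F' : 'I_3 -> 'I_3 -> R -> R -> R) (c d : I) x y : R :=
  - (F c.1 d.1 x y * dl c.2 d.2 + F' c.2 d.2 x y * dl c.1 d.1).
have cPhiOf F F' : (forall i j, continuous (fun z : R * R => F i j z.1 z.2)) ->
    (forall i j, continuous (fun z : R * R => F' i j z.1 z.2)) ->
    forall c d, continuous (fun z : R * R => PhiOf F F' c d z.1 z.2).
  by move=> cF cF' c d; rewrite /PhiOf; cont.
have bPhiOf F F' : (forall i j x y, `|F i j x y| <= M) -> (forall i j x y, `|F' i j x y| <= M) ->
    forall c d x y, `|PhiOf F F' c d x y| <= 2 * M.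
  move=> bF bF' c d x' y'; rewrite /PhiOf normrN mulr2n mulrDl mul1r.
  rewrite (le_trans (ler_normD _ _)) // lerD // normrM -[leRHS]mulr1 ler_pM //;
  by rewrite /dl; case: eqP; rewrite ?normr1 ?normr0.
have dU c x y t : is_derive x 1 (fun x => u c x y t) (ux c x y t).
  have cGqt : continuous (fun z : R * R => Gq c.1 c.2 z.1 t z.2) by cont.
  have := is_derive_affine2 _ _ _ (sin t) (- (y * cos t)) (cos t) (y * sin t) x
    (fun s p => dGq c.1 c.2 s t p) (fun s p => dGp c.1 c.2 s t p) cGqt.
  have -> : sin t * x + - (y * cos t) = x * sin t - y * cos t by ring.
  have -> : cos t * x + y * sin t = x * cos t + y * sin t by ring.
  move=> d; have {}d := is_derive_add _ _ _ _ _ d (is_derive_const (- dl c.1 c.2) x).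
  rewrite addr0 in d.
  rewrite /u /ux (_ : (fun _ => _) = (fun x => G c.1 c.2 (sin t * x + - (y * cos t)) t (cos t * x + y * sin t) + - dl c.1 c.2)) //.
  by apply/funext => z; congr (G _ _ _ _ _ - _); ring.
have dU' c x y t : is_derive y 1 (fun y => u c x y t) (uy c x y t).
  have cGqt : continuous (fun z : R * R => Gq c.1 c.2 z.1 t z.2) by cont.
  have := is_derive_affine2 _ _ _ (- cos t) (x * sin t) (sin t) (x * cos t) y
    (fun s p => dGq c.1 c.2 s t p) (fun s p => dGp c.1 c.2 s t p) cGqt.
  have -> : - cos t * y + x * sin t = x * sin t - y * cos t by ring.
  have -> : sin t * y + x * cos t = x * cos t + y * sin t by ring.
  move=> d; have {}d := is_derive_add _ _ _ _ _ d (is_derive_const (- dl c.1 c.2) y).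
  rewrite addr0 in d.
  rewrite /u /uy (_ : (fun _ => _) = (fun y => G c.1 c.2 (- cos t * y + x * sin t) t (sin t * y + x * cos t) + - dl c.1 c.2)) //.
  by apply/funext => z; congr (G _ _ _ _ _ - _); ring.
pose f (c : I) x y := A c.1 c.2 x y - A' c.1 c.2 x y.
have transport c x y t : cos t * ux c x y t + sin t * uy c x y t +
    \sum_d PhiOf A A' c d x y * u d x y t = f c x y.
  (* Along the line the offset is constant: the [Gq] terms cancel and only the derivative in [p]
     survives. *)
  have -> : cos t * ux c x y t + sin t * uy c x y t =
      Gp c.1 c.2 (x * sin t - y * cos t) t (x * cos t + y * sin t) * (cos t ^+ 2 + sin t ^+ 2).
    by rewrite /ux /uy; ring.
  rewrite cos2Dsin2 mulr1 GpE.
  set q := x * sin t - y * cos t; set p := x * cos t + y * sin t.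
  have ex : p * cos t + q * sin t = x.
    transitivity (x * (cos t ^+ 2 + sin t ^+ 2)); last by rewrite cos2Dsin2 mulr1.
    by rewrite /p /q; ring.
  have ey : p * sin t - q * cos t = y.
    transitivity (y * (cos t ^+ 2 + sin t ^+ 2)); last by rewrite cos2Dsin2 mulr1.
    by rewrite /p /q; ring.
  rewrite /along_line ex ey.
  have pick (a : 'I_3) (F : 'I_3 -> R) : \sum_l F l * dl a l = F a.
    rewrite (bigD1 a) //= /dl eqxx mulr1 big1 ?addr0 // => l la.
    by rewrite eq_sym (negbTE la) mulr0.
  have -> : \sum_d PhiOf A A' c d x y * u d x y t =
      - (\sum_l A c.1 l x y * (G l c.2 q t p - dl l c.2)) - \sum_l A' c.2 l x y * (G c.1 l q t p - dl c.1 l).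
    rewrite -(pair_bigA _ (fun k l => PhiOf A A' c (k, l) x y * u (k, l) x y t)) /=.
    transitivity (\sum_k (- (A c.1 k x y * (G k c.2 q t p - dl k c.2)) -
       (\sum_l A' c.2 l x y * (G k l q t p - dl k l)) * dl c.1 k)).
      apply: eq_bigr => k _.
      rewrite -(pick c.2 (fun l => A c.1 k x y * (G k l q t p - dl k l))).
      rewrite mulr_suml -sumrN -sumrB; apply: eq_bigr => l _.
      rewrite /PhiOf /u /= -/q -/p; ring.
    rewrite sumrB sumrN; congr (_ - _).
    exact: (pick c.1 (fun k => \sum_l A' c.2 l x y * (G k l q t p - dl k l))).
  have e1 : \sum_l A c.1 l x y * (G l c.2 q t p - dl l c.2) =
      \sum_l A c.1 l x y * G l c.2 q t p - A c.1 c.2 x y.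
    rewrite -(pick c.2 (fun l => A c.1 l x y)) -sumrB; apply: eq_bigr => l _.
    by rewrite mulrBr /dl [l == _]eq_sym.
  have e2 : \sum_l A' c.2 l x y * (G c.1 l q t p - dl c.1 l) =
      \sum_l A' c.2 l x y * G c.1 l q t p - A' c.2 c.1 x y.
    rewrite -(pick c.1 (fun l => A' c.2 l x y)) -sumrB; apply: eq_bigr => l _.
    by rewrite mulrBr.
  rewrite e1 e2 (pf_skew _ _ _ _ _ pfA' c.2 c.1) /f; ring.
have cu c : continuous (fun z : R * R * R => u c z.1.1 z.1.2 z.2) by rewrite /u; cont.
have cux c : continuous (fun z : R * R * R => ux c z.1.1 z.1.2 z.2) by rewrite /ux; cont.
have cuy c : continuous (fun z : R * R * R => uy c z.1.1 z.1.2 z.2) by rewrite /uy; cont.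
have r0 : 0 <= 2 * L by rewrite mulr_ge0 // ltW.
have M20 : 0 <= 2 * M by rewrite mulr_ge0.
(* Since p^2 + q^2 = x^2 + y^2 >= 4 L^2 here, |p| or |q| is at least [L], so the point lies in the
   region where [G] is the identity. *)
have su c x y t : 2 * L <= `|x| \/ 2 * L <= `|y| -> u c x y t = 0.
  move=> h; rewrite /u Gout ?subrr //.
  set p := x * cos t + y * sin t; set q := x * sin t - y * cos t.
  have [hp|hp] := leP L `|p|; first by left.
  right; rewrite leNgt; apply/negP => hq.
  have epq : p ^+ 2 + q ^+ 2 = x ^+ 2 + y ^+ 2.
    by rewrite (sqr_norm_rot x y t) /p /q; ring.
  have sq (a : R) : `|a| < L -> a ^+ 2 < L ^+ 2.
    by move=> aL; rewrite -(real_normK (num_real a)) ltr_pXn2r // nnegrE // ltW.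
  have sq' (a : R) : 2 * L <= `|a| -> (2 * L) ^+ 2 <= a ^+ 2.
    by move=> aL; rewrite -(real_normK (num_real a)) ler_pXn2r // nnegrE.
  have := sq _ hp; have := sq _ hq; have := sqr_ge0 x; have := sqr_ge0 y.
  by have := sqr_ge0 L; case: h => /sq'; nra.
have pu c x y t : u c x y (t + tau) = u c x y t.
  by have [c1 s1] := per t; rewrite /u c1 s1 GT.
have dPhi (F F' Fx Fx' : 'I_3 -> 'I_3 -> R -> R) c d s :
    (forall i j s, is_derive s 1 (F i j) (Fx i j s)) ->
    (forall i j s, is_derive s 1 (F' i j) (Fx' i j s)) ->
    is_derive s 1 (fun s => - (F c.1 d.1 s * dl c.2 d.2 + F' c.2 d.2 s * dl c.1 d.1))
      (- (Fx c.1 d.1 s * dl c.2 d.2 + Fx' c.2 d.2 s * dl c.1 d.1)).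
  by move=> dF dF'; der; rewrite !mulr0 !addr0.
have := linear_transport_source_eq0 (2 * L) (2 * M) u ux uy f
  (PhiOf A A') (PhiOf Ax Ax') (PhiOf Ay Ay') r0 cu cux cuy dU dU' su pu.
move=> /(_ (cPhiOf _ _ cA cA')).
move=> /(_ (cPhiOf _ _ (pf_cont_x _ _ _ _ _ pfA) (pf_cont_x _ _ _ _ _ pfA'))).
move=> /(_ (cPhiOf _ _ (pf_cont_y _ _ _ _ _ pfA) (pf_cont_y _ _ _ _ _ pfA'))).
move=> H i j x y; apply/eqP; rewrite -subr_eq0; apply/eqP.
apply: (H _ _ _ M20 _ _ _ transport (i, j) x y).
- move=> c d s w; apply: (dPhi (fun i j s => A i j s w) (fun i j s => A' i j s w)
    (fun i j s => Ax i j s w) (fun i j s => Ax' i j s w)).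
    by move=> *; exact: (pf_dx _ _ _ _ _ pfA).
  by move=> *; exact: (pf_dx _ _ _ _ _ pfA').
- move=> c d s w; apply: (dPhi (fun i j w => A i j s w) (fun i j w => A' i j s w)
    (fun i j w => Ay i j s w) (fun i j w => Ay' i j s w)).
    by move=> *; exact: (pf_dy _ _ _ _ _ pfA).
  by move=> *; exact: (pf_dy _ _ _ _ _ pfA').
- move=> c d s w; rewrite /PhiOf (pf_skew _ _ _ _ _ pfA d.1) (pf_skew _ _ _ _ _ pfA' d.2).
  by rewrite /dl [c.1 == _]eq_sym [c.2 == _]eq_sym; ring.
- by apply: bPhiOf; [exact: (pf_bound _ _ _ _ _ pfA)|exact: (pf_bound _ _ _ _ _ pfA')].
- by apply: bPhiOf; [exact: (pf_bound_x _ _ _ _ _ pfA)|exact: (pf_bound_x _ _ _ _ _ pfA')].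
- by apply: bPhiOf; [exact: (pf_bound_y _ _ _ _ _ pfA)|exact: (pf_bound_y _ _ _ _ _ pfA')].
Qed.

End TwoFields.
End LineODE.

(** * The plane in three-dimensional space *)

Section Frame.
Context {R : realType}.
Implicit Types (u v w eta : 'cV[R]_3).

Lemma dotE u v : dot u v = u 0 0 * v 0 0 + u 1 0 * v 1 0 + u 2 0 * v 2 0.
Proof.
rewrite /dot !big_ord_recl big_ord0 addr0 addrA.
by congr (_ + u _ _ * v _ _ + u _ _ * v _ _); apply/val_inj.
Qed.

Lemma dotC u v : dot u v = dot v u.
Proof. by rewrite !dotE; ring. Qed.

Lemma dotDl u v w : dot (u + v) w = dot u w + dot v w.
Proof. by rewrite !dotE !mxE; ring. Qed.

Lemma dotZl (a : R) u v : dot (a *: u) v = a * dot u v.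
Proof. by rewrite !dotE !mxE; ring. Qed.

Lemma enorm_eq1 u : (enorm u == 1) = (dot u u == 1).
Proof.
have d0 : 0 <= dot u u.
  by rewrite dotE -!expr2 !addr_ge0 // sqr_ge0.
by rewrite /enorm -[X in _ == X]sqrtr1 eqr_sqrt.
Qed.

Lemma col3_eq u v : u 0 0 = v 0 0 -> u 1 0 = v 1 0 -> u 2 0 = v 2 0 -> u = v.
Proof.
move=> h0 h1 h2; apply/matrixP => i j; rewrite ord1.
case: i => [[|[|[|//]]] hi].
- by rewrite (_ : Ordinal hi = 0) //; apply/val_inj.
- by rewrite (_ : Ordinal hi = 1) //; apply/val_inj.
- by rewrite (_ : Ordinal hi = 2) //; apply/val_inj.
Qed.

Definition col3 (a b c : R) : 'cV[R]_3 := \col_(i < 3) nth 0 [:: a; b; c] i.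

(** If [eta] is vertical the horizontal coordinate vectors serve; otherwise normalize the horizontal
    vector (-b, a, 0). The last clause is completeness, giving coordinates to every point. *)
Lemma plane_frame eta : enorm eta = 1 -> exists e1 e2 : 'cV[R]_3,
  [/\ dot e1 e1 = 1 /\ dot e2 e2 = 1, dot e1 e2 = 0, dot e1 eta = 0 /\ dot e2 eta = 0 &
      forall w, w = dot w eta *: eta + dot w e1 *: e1 + dot w e2 *: e2].
Proof.
move=> /eqP; rewrite enorm_eq1 dotE => /eqP.
set a := eta 0 0; set b := eta 1 0; set c := eta 2 0 => abc.
pose N := a * a + b * b.
have N0 : 0 <= N by rewrite /N -!expr2 addr_ge0 ?sqr_ge0.
have [Nz|Nz] := eqVneq N 0.
  have a0 : a = 0.
    by apply/eqP; rewrite -sqrf_eq0; have := sqr_ge0 a; have := sqr_ge0 b; move: Nz; rewrite /N => ? ? ?; apply/eqP; nra.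
  have b0 : b = 0.
    by apply/eqP; rewrite -sqrf_eq0; have := sqr_ge0 a; have := sqr_ge0 b; move: Nz; rewrite /N => ? ? ?; apply/eqP; nra.
  have c1 : c * c = 1 by move: abc; rewrite a0 b0; lra.
  exists (col3 1 0 0), (col3 0 1 0); split.
  - by rewrite !dotE !mxE /=; split; ring.
  - by rewrite !dotE !mxE /=; ring.
  - by rewrite !dotE !mxE /= -/a -/b -/c a0 b0; split; ring.
  - move=> w; apply: col3_eq; rewrite !dotE !mxE /= -/a -/b -/c a0 b0; try by ring.
    by transitivity (w 2 0 * (c * c)); [rewrite c1 mulr1|ring].
pose d := (Num.sqrt N)^-1.
have Np : 0 < N by rewrite lt_def Nz.
have Nd : N * (d * d) = 1.
  have s0 : Num.sqrt N != 0 by rewrite gt_eqF // sqrtr_gt0.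
  rewrite /d -{1}(sqr_sqrtr N0); field.
  by rewrite s0.
(* [E1] and [E2] vanish; each identity below is certified by an explicit combination of them. *)
pose E1 := a * a + b * b + c * c - 1.
pose E2 := N * (d * d) - 1.
have E10 : E1 = 0 by rewrite /E1 abc subrr.
have E20 : E2 = 0 by rewrite /E2 Nd subrr.
(* The second vector is the cross product of [eta] with the first. *)
exists (col3 (- b * d) (a * d) 0), (col3 (- c * a * d) (- c * b * d) (N * d)); split.
- rewrite !dotE !mxE /=; split; apply/eqP; rewrite -subr_eq0; apply/eqP.
    by transitivity E2 => //; rewrite /E2 /N; ring.
  transitivity (N * (d * d) * E1 + E2); last by rewrite E10 E20 mulr0 addr0.
  by rewrite /E1 /E2 /N; ring.
- by rewrite !dotE !mxE /=; ring.
- rewrite !dotE !mxE /= -/a -/b -/c; split; first by ring.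
  by rewrite /N; ring.
- move=> w; apply: col3_eq; rewrite !dotE !mxE /= -/a -/b -/c;
  apply/esym/eqP; rewrite -subr_eq0; apply/eqP.
  + transitivity (w 0 0 * (a * a * (d * d) * E1 + (1 - a * a) * E2) +
      w 1 0 * (a * b * (d * d) * E1 - a * b * E2) - w 2 0 * (c * a * E2)).
      by rewrite /E1 /E2 /N; ring.
    by rewrite E10 E20; ring.
  + transitivity (w 0 0 * (a * b * (d * d) * E1 - a * b * E2) +
      w 1 0 * (b * b * (d * d) * E1 + (1 - b * b) * E2) - w 2 0 * (c * b * E2)).
      by rewrite /E1 /E2 /N; ring.
    by rewrite E10 E20; ring.
  + transitivity (- (w 0 0 * (c * a * E2)) - w 1 0 * (c * b * E2) + w 2 0 * (E1 + N * E2)).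
      by rewrite /E1 /E2 /N; ring.
    by rewrite E10 E20; ring.
Qed.

Lemma Hmx_skew (b : 'cV[R]_3) i j : Hmx b i j = - Hmx b j i.
Proof.
rewrite !mxE; case: i => [[|[|[|//]]] hi]; case: j => [[|[|[|//]]] hj] /=;
by rewrite ?opprK ?oppr0.
Qed.

Lemma Hmx_linear (b : 'cV[R]_3) i j :
  Hmx b i j = \sum_k Hmx (delta_mx k 0 : 'cV[R]_3) i j * b k 0.
Proof.
rewrite !big_ord_recl big_ord0 addr0.
rewrite (_ : lift ord0 (lift ord0 ord0) = 2); last exact/val_inj.
rewrite (_ : lift ord0 ord0 = 1); last exact/val_inj.
rewrite (_ : ord0 = 0); last exact/val_inj.
rewrite !mxE; case: i => [[|[|[|//]]] hi]; case: j => [[|[|[|//]]] hj] /=;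
rewrite ?mul1r ?mul0r ?oppr0 ?mulN1r ?mul0r ?addr0 ?add0r //.
Qed.

Lemma Hmx_inj (b b' : 'cV[R]_3) : Hmx b = Hmx b' -> b = b'.
Proof.
move=> /matrixP h; apply: col3_eq.
- by have := h 1 2; rewrite !mxE.
- by have := h 2 0; rewrite !mxE.
- by have := h 0 1; rewrite !mxE.
Qed.

End Frame.

(** * From the transport problem in space to systems along plane lines *)

Section TransportLink.
Context {R : realType}.
Implicit Types (s t x y q b p : R).

Lemma is_derive_mx (S : R -> 'M[R]_3) (D : 'M[R]_3) s :
  is_derive s 1 S D <-> forall i k, is_derive s 1 (fun s => S s i k) (D i k).
Proof.
split=> [[dS <-] i k|h].
  rewrite (derive_mx dS) mxE; apply: DeriveDef => //.
  by move/derivable_mxP: dS; apply.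
have dS : derivable S s 1.
  by apply/derivable_mxP => i k; have [] := h i k.
apply: DeriveDef => //; rewrite (derive_mx dS); apply/matrixP => i k; rewrite mxE.
by have [_ ->] := h i k.
Qed.

Section Line.
Variables (M L q b : R) (A Ax Ay : 'I_3 -> 'I_3 -> R -> R -> R).
Variables (F : 'cV[R]_3 -> 'M[R]_3) (x xi : 'cV[R]_3).
Hypothesis L0 : 0 < L.
Hypothesis pfA : plane_field M L A Ax Ay.
Hypothesis FA : forall s i j, F (x + s *: xi) i j = along_line A i j q b s.

(** [Sigma] is constant for s <= - L, so its limit at minus infinity is its value at [- L]. *)
Lemma line_solution_transport (Sigma : R -> 'M[R]_3) :
  is_transport F x xi Sigma -> line_solution A L q b (fun i k s => Sigma s i k).
Proof.
move=> [dS lS].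
have dY i k s : is_derive s 1 (fun s => Sigma s i k)
    (\sum_j along_line A i j q b s * Sigma s j k).
  have /is_derive_mx/(_ i k) := dS s; rewrite mxE.
  by under eq_bigr => j _ do rewrite FA.
split=> // i k.
have c1 : Sigma s i k @[s --> -oo] --> (1%:M : 'M[R]_3) i k.
  exact: (cvg_comp _ _ lS (@coord_continuous R 3 3 i k 1%:M)).
have c2 : Sigma s i k @[s --> -oo] --> Sigma (- L) i k.
  apply: cvg_near_cst; near=> s.
  have sL : s <= - L by near: s; apply: nbhs_ninfty_le; exact: num_real.
  apply: (zero_derive_eq _ _ _ _ (dY i k)) => t t1 t2; apply: big1 => j _.
  rewrite (along_line_outside _ _ _ _ _ L0 pfA) ?mul0r //; left.
  rewrite ler_normr; apply/orP; right.
  by move: t2; rewrite le_max => /orP[]; lra.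
have -> : Sigma (- L) i k = (1%:M : 'M[R]_3) i k.
  exact: (cvg_unique (@Rhausdorff R) c2 c1).
by rewrite mxE.
Unshelve. all: by end_near. Qed.

Lemma transport_line_solution (Y : 'I_3 -> 'I_3 -> R -> R) :
  line_solution A L q b Y -> is_transport F x xi (fun s => \matrix_(i, k) Y i k s).
Proof.
move=> sY; have [dY _] := sY; split=> [s|].
  apply/is_derive_mx => i k; rewrite mxE.
  under eq_bigr => j _ do rewrite FA mxE.
  by under eq_fun do rewrite mxE; exact: dY.
apply: cvg_near_cst; near=> s.
have sL : s <= - L by near: s; apply: nbhs_ninfty_le; exact: num_real.
apply/matrixP => i k; rewrite !mxE.
by rewrite (line_solution_outside _ _ _ _ _ L0 pfA _ _ _ _ _ _ sY) //; right.
Unshelve. all: by end_near. Qed.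

(** Existence, witnessed by [Y], makes the function chosen by [get] a genuine solution; uniqueness
    identifies it with [Y], whose limit is already attained at [L]. *)
Lemma nonabelian_radonE (Y : 'I_3 -> 'I_3 -> R -> R) : line_solution A L q b Y ->
  nonabelian_radon F x xi = \matrix_(i, k) Y i k L.
Proof.
move=> sY.
have hT : is_transport F x xi (transport F x xi).
  by apply: (@getPex _ [set S | is_transport F x xi S]); eexists; exact: transport_line_solution sY.
have sT := line_solution_transport _ hT.
apply: cvg_lim; first exact: norm_hausdorff.
apply: cvg_near_cst; near=> s.
have sL : L <= s by near: s; apply: nbhs_pinfty_ge; exact: num_real.
apply/matrixP => i k; rewrite mxE.
rewrite (line_solution_unique _ _ _ _ _ pfA _ _ _ _ sT sY).
exact: (line_solution_after _ _ _ _ _ L0 pfA _ _ _ _ _ _ sY).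
Unshelve. all: by end_near. Qed.

End Line.

Section PlaneRestriction.
Variables (eta e1 e2 : 'cV[R]_3) (z c : R) (B : 'cV[R]_3 -> 'cV[R]_3).
Hypothesis eta1 : dot eta eta = 1.
Hypothesis e1e : dot e1 eta = 0.
Hypothesis e2e : dot e2 eta = 0.
Hypothesis smoothB : smooth_on_plane eta z B.
Hypothesis suppB : compact_support_on_plane eta z B.

Definition plane_point (x y : R) : 'cV[R]_3 := z *: eta + x *: e1 + y *: e2.

Definition plane_matrix (i j : 'I_3) (x y : R) : R := c * Hmx (B (plane_point x y)) i j.

Definition plane_matrix_derive (u : 'cV[R]_3) (i j : 'I_3) (x y : R) : R :=
  c * Hmx ('D_u B (plane_point x y)) i j.

Lemma plane_pointP x y : plane eta z (plane_point x y).
Proof. by rewrite /plane /= /plane_point !dotDl !dotZl eta1 e1e e2e; ring. Qed.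

Lemma continuous_plane_point : continuous (fun w : R * R => plane_point w.1 w.2).
Proof.
move=> w; rewrite /plane_point; apply: cvgD; first apply: cvgD.
- exact: cvg_cst.
- by apply: cvgZr_tmp; exact: cvg_fst.
- by apply: cvgZr_tmp; exact: cvg_snd.
Qed.

(** Continuity within the plane is enough because [plane_point] takes all its values there. *)
Lemma continuous_on_plane (f : 'cV[R]_3 -> 'cV[R]_3) k :
  {within plane eta z, continuous f} ->
  continuous (fun w : R * R => f (plane_point w.1 w.2) k 0).
Proof.
move=> /subspace_continuousP cf w.
apply: (@cvg_comp _ _ _ (fun w : R * R => f (plane_point w.1 w.2)) (fun v : 'cV[R]_3 => v k 0) _
  (nbhs (f (plane_point w.1 w.2)))); last exact: coord_continuous.
apply: (cvg_comp _ _ _ (cf (plane_point w.1 w.2) (plane_pointP _ _))).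
move=> P; rewrite /within /= => hP.
have h : \forall v \near w, plane eta z (plane_point v.1 v.2) -> P (plane_point v.1 v.2).
  exact: (continuous_plane_point w _ hP).
suff : \forall v \near w, P (plane_point v.1 v.2) by [].
by apply: filterS h => v; apply; exact: plane_pointP.
Qed.

Lemma is_derive_directional (f : 'cV[R]_3 -> 'cV[R]_3) (a u : 'cV[R]_3) s k :
  derivable f (a + s *: u) u ->
  is_derive s 1 (fun s => f (a + s *: u) k 0) ('D_u f (a + s *: u) k 0).
Proof.
move=> df.
have H := cvg_comp _ _ df (@coord_continuous R 3 1 k 0 _).
have {}H : h^-1 *: (f (a + (h *: 1 + s) *: u) k 0 - f (a + s *: u) k 0) @[h --> 0^'] -->
    ('D_u f (a + s *: u) k 0 : R).
  apply: cvg_trans H; apply: near_eq_cvg; near=> h => /=.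
  rewrite !mxE; congr (_ *: (f _ _ _ - _)).
  rewrite addrCA scalerDl; congr (_ + (_ *: _ + _)); exact/esym/mulr1.
by apply: DeriveDef; [apply/cvg_ex; exists ('D_u f (a + s *: u) k 0)|exact: (cvg_lim _ H)].
Unshelve. all: by end_near. Qed.

Lemma continuous_plane_Hmx (f : 'cV[R]_3 -> 'cV[R]_3) i j :
  {within plane eta z, continuous f} ->
  continuous (fun w : R * R => c * Hmx (f (plane_point w.1 w.2)) i j).
Proof.
move=> cf; under eq_fun do rewrite Hmx_linear.
have h k := continuous_on_plane f k cf.
apply: continuous_mul; first exact: continuous_const.
apply: continuous_big => k; apply: continuous_mul; [exact: continuous_const|exact: h].
Qed.

Lemma is_derive_Hmx (g : R -> 'cV[R]_3) (dg : 'cV[R]_3) s i j :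
  (forall k, is_derive s 1 (fun s => g s k 0) (dg k 0)) ->
  is_derive s 1 (fun s => c * Hmx (g s) i j) (c * Hmx dg i j).
Proof.
move=> d; under eq_fun do rewrite Hmx_linear.
rewrite (Hmx_linear dg); der; rewrite mul0r add0r; congr (_ * _).
by apply: eq_bigr => k _; rewrite mul0r add0r.
Qed.

Lemma plane_support_bound : exists2 L, 0 < L &
  forall x y, dot e1 e1 = 1 -> dot e2 e2 = 1 -> dot e1 e2 = 0 ->
    L ^+ 2 <= x ^+ 2 + y ^+ 2 -> B (plane_point x y) = 0.
Proof.
have /compact_bounded[K [_ hK]] := suppB.
pose N := `|K| + 1.
have KN : K < N by rewrite /N (le_lt_trans (ler_norm K)) // ltrDl.
have N0 : 0 < N by rewrite ltr_wpDl.
(* The sup norm bound [N] gives Euclidean square at most 3 N^2, strictly less than (2 N)^2. *)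
exists (2 * N) => [|x y e11 e22 e12 xy]; first by rewrite mulr_gt0.
apply/eqP/negPn/negP => nz.
have hb : `|plane_point x y| <= N.
  by apply: (hK N KN); apply: subset_closure; split; [exact: plane_pointP|exact: nz].
have hc k : `|plane_point x y k 0| <= N.
  apply: le_trans hb; rewrite [leRHS]/Num.Def.normr /= mx_normrE.
  exact: (le_bigmax _ (fun i : 'I_3 * 'I_1 => `|plane_point x y i.1 i.2|) (k, 0)).
have e : dot (plane_point x y) (plane_point x y) = z ^+ 2 + x ^+ 2 + y ^+ 2.
  rewrite {1}/plane_point !dotDl !dotZl !(dotC _ (plane_point x y)) /plane_point !dotDl !dotZl.
  by rewrite eta1 e11 e22 e12 e1e e2e (dotC eta e1) (dotC eta e2) (dotC e2 e1) e1e e2e e12; ring.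
move: e; rewrite dotE.
have sq k : plane_point x y k 0 * plane_point x y k 0 <= N * N.
  have h := hc k; rewrite -!expr2 -(real_normK (num_real (plane_point x y k 0))).
  by rewrite ler_pXn2r // nnegrE // ltW.
by have := sq 0; have := sq 1; have := sq 2; have := sqr_ge0 z; nra.
Qed.

Lemma compact_support_bound (g : R -> R -> R) (L : R) : 0 <= L ->
  continuous (fun w : R * R => g w.1 w.2) ->
  (forall x y, L < `|x| \/ L < `|y| -> g x y = 0) ->
  exists2 K, 0 <= K & forall x y, `|g x y| <= K.
Proof.
move=> L1 cg sg.
have cK : compact (`[- L, L]%classic `*` `[- L, L]%classic : set (R * R)).
  by apply: compact_setX; exact: segment_compact.
have [K K0 hK] := compact_norm_bounded _ _ _ cK cg.
exists K => // x y.
have [xL|xL] := ltP L `|x|; first by rewrite sg ?normr0 //; left.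
have [yL|yL] := ltP L `|y|; first by rewrite sg ?normr0 //; right.
by apply: (hK (x, y)); split; rewrite /= in_itv /= -ler_norml.
Qed.

(** Thresholds instead of fixed constants let both fields be described with common [M] and [L]. *)
Lemma plane_field_of : dot e1 e1 = 1 -> dot e2 e2 = 1 -> dot e1 e2 = 0 ->
  exists L0 M0, forall M L, M0 <= M -> L0 <= L ->
    0 < L /\ plane_field M L plane_matrix (plane_matrix_derive e1) (plane_matrix_derive e2).
Proof.
move=> e11 e22 e12.
have [L L0 sB] := plane_support_bound.
(* The empty sequence gives continuity of [B] and its tangential derivatives; the one-element
   sequences give continuity of these derivatives. *)
have [cB dB] := smoothB [::] (fun u => ltac:(by [])).
have [cB1 _] := smoothB [:: e1] (fun u => ltac:(by rewrite inE => /eqP ->)).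
have [cB2 _] := smoothB [:: e2] (fun u => ltac:(by rewrite inE => /eqP ->)).
have cA i j := continuous_plane_Hmx B i j cB.
have cA1 i j := continuous_plane_Hmx _ i j cB1.
have cA2 i j := continuous_plane_Hmx _ i j cB2.
have dA1 i j x y : is_derive x 1 (fun x => plane_matrix i j x y) (plane_matrix_derive e1 i j x y).
  apply: is_derive_Hmx => k.
  have pE x' : plane_point x' y = (z *: eta + y *: e2) + x' *: e1 by rewrite /plane_point addrAC.
  under eq_fun do rewrite pE.
  by rewrite pE; apply: is_derive_directional; rewrite -pE; apply: dB => //; exact: plane_pointP.
have dA2 i j x y : is_derive y 1 (fun y => plane_matrix i j x y) (plane_matrix_derive e2 i j x y).
  apply: is_derive_Hmx => k.
  rewrite /plane_point; apply: is_derive_directional; apply: dB => //; exact: plane_pointP.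
have H0 i j : Hmx (0 : 'cV[R]_3) i j = 0.
  by rewrite Hmx_linear big1 // => k _; rewrite [X in _ * X]mxE mulr0.
have sA i j x y : L ^+ 2 <= x ^+ 2 + y ^+ 2 -> plane_matrix i j x y = 0.
  by move=> h; rewrite /plane_matrix sB // H0 mulr0.
have sq (a : R) : L < `|a| -> L ^+ 2 <= a ^+ 2.
  by move=> La; rewrite -(real_normK (num_real a)) ler_pXn2r // ?nnegrE // ltW.
have sA' i j x y : L < `|x| \/ L < `|y| -> plane_matrix i j x y = 0.
  by move=> h; apply: sA; have := sqr_ge0 x; have := sqr_ge0 y; case: h => /sq; lra.
have near_norm (a : R) : L < `|a| -> \forall a' \near a, L < `|a'|.
  move=> La; have ca : `|a'| @[a' --> a] --> `|a| by apply: cvg_norm; exact: cvg_id.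
  exact: (ca _ (lt_nbhsr La)).
have der0 (g : R -> R) (a d : R) : is_derive a 1 g d -> (\forall a' \near a, g a' = 0) -> d = 0.
  move=> dg hg.
  have hg' : \forall a' \near a, g a' = (fun=> 0) a' by [].
  have [_ <-] := @near_eq_is_derive R R^o R^o g (fun=> 0) a 1 d hg' dg.
  by have [_ ->] := is_derive_const (0 : R) a.
have sA1 i j x y : L < `|x| \/ L < `|y| -> plane_matrix_derive e1 i j x y = 0.
  move=> h; apply: (der0 _ _ _ (dA1 i j x y)); case: h => h.
    by apply: filterS (near_norm _ h) => x' h'; apply: sA'; left.
  by near=> x'; apply: sA'; right.
have sA2 i j x y : L < `|x| \/ L < `|y| -> plane_matrix_derive e2 i j x y = 0.
  move=> h; apply: (der0 _ _ _ (dA2 i j x y)); case: h => h.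
    by near=> x'; apply: sA'; left.
  by apply: filterS (near_norm _ h) => x' h'; apply: sA'; right.
have bd (g : 'I_3 -> 'I_3 -> R -> R -> R) :
    (forall i j, continuous (fun w : R * R => g i j w.1 w.2)) ->
    (forall i j x y, L < `|x| \/ L < `|y| -> g i j x y = 0) ->
    exists K, forall i j x y, `|g i j x y| <= K.
  move=> cg sg.
  have h i j := compact_support_bound (g i j) L (ltW L0) (cg i j) (sg i j).
  pose K i j := s2val (cid2 (h i j)).
  have K0 i j : 0 <= K i j by exact: (s2valP (cid2 (h i j))).
  exists (\sum_i \sum_j K i j) => i j x y.
  apply: (le_trans (s2valP' (cid2 (h i j)) x y)); rewrite -/(K i j).
  rewrite (bigD1 i) //= (bigD1 j) //= -addrA lerDl addr_ge0 //.
    by apply: sumr_ge0 => k _; exact: K0.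
  by apply: sumr_ge0 => k _; apply: sumr_ge0 => l _; exact: K0.
have [K b0] := bd _ cA sA'.
have [K1 b1] := bd _ cA1 sA1.
have [K2 b2] := bd _ cA2 sA2.
exists L, (`|K| + `|K1| + `|K2|) => M L' hM hL.
have L'0 : 0 < L' by apply: lt_le_trans hL.
have k0 := ler_norm K; have k1 := ler_norm K1; have k2 := ler_norm K2.
have k0' := normr_ge0 K; have k1' := normr_ge0 K1; have k2' := normr_ge0 K2.
split; first exact: L'0.
apply: (PlaneField _ _ _ _ _ cA cA1 cA2 dA1 dA2).
- by move=> i j x y; rewrite /plane_matrix Hmx_skew mulrN.
- by move=> i j x y; apply: le_trans (b0 i j x y) _; lra.
- by move=> i j x y; apply: le_trans (b1 i j x y) _; lra.
- by move=> i j x y; apply: le_trans (b2 i j x y) _; lra.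
- move=> i j x y h; apply: sA; apply: le_trans h.
  by rewrite ler_pXn2r // ?nnegrE // ltW.
Unshelve. all: by end_near. Qed.

End PlaneRestriction.
End TransportLink.

Theorem theorem2 (R : realType) (gammaN v : R) (hgamma : gammaN != 0)
    (hv : 0 < v) (eta : 'cV[R]_3) (heta : enorm eta = 1) (z : R)
    (B B' : 'cV[R]_3 -> 'cV[R]_3)
    (smoothB : smooth_on_plane eta z B)
    (suppB : compact_support_on_plane eta z B)
    (smoothB' : smooth_on_plane eta z B')
    (suppB' : compact_support_on_plane eta z B')
    (data : forall x xi : 'cV[R]_3,
        plane eta z x -> enorm xi = 1 -> dot eta xi = 0 ->
        nonabelian_radon (fun y => (gammaN / v) *: Hmx (B y)) x xi =
        nonabelian_radon (fun y => (gammaN / v) *: Hmx (B' y)) x xi) :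
  forall x : 'cV[R]_3, plane eta z x -> B x = B' x.
Proof.
have [e1 [e2 [[e11 e22] e12 [e1e e2e] dec]]] := plane_frame eta heta.
have eta1 : dot eta eta = 1 by apply/eqP; rewrite -enorm_eq1; apply/eqP.
pose c := gammaN / v.
have c0 : c != 0 by rewrite mulf_neq0 // invr_neq0 // gt_eqF.
have [L1 [M1 h1]] := plane_field_of eta e1 e2 z c B eta1 e1e e2e smoothB suppB e11 e22 e12.
have [L2 [M2 h2]] := plane_field_of eta e1 e2 z c B' eta1 e1e e2e smoothB' suppB' e11 e22 e12.
pose L := Num.max L1 L2; pose M := Num.max M1 M2.
have lM1 : M1 <= M by rewrite le_max lexx.
have lM2 : M2 <= M by rewrite le_max lexx orbT.
have lL1 : L1 <= L by rewrite le_max lexx.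
have lL2 : L2 <= L by rewrite le_max lexx orbT.
have [L0 pf1] := h1 M L lM1 lL1.
have [_ pf2] := h2 M L lM2 lL2.
have same q b (Y Y' : 'I_3 -> 'I_3 -> R -> R) :
    line_solution (plane_matrix eta e1 e2 z c B) L q b Y ->
    line_solution (plane_matrix eta e1 e2 z c B') L q b Y' ->
    forall i k, Y i k L = Y' i k L.
  move=> sY sY'.
  pose xi := cos b *: e1 + sin b *: e2.
  (* The base point is the point of parameter 0 on the line with offset [q] and angle [b], so the
     parameter [s] of the data is the position [p]. *)
  pose x := plane_point eta e1 e2 z (q * sin b) (- (q * cos b)).
  have lineE s : x + s *: xi = plane_point eta e1 e2 z (s * cos b + q * sin b) (s * sin b - q * cos b).
    by apply/matrixP => i j; rewrite !mxE; ring.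
  have xi1 : enorm xi = 1.
    apply/eqP; rewrite enorm_eq1 /xi dotDl !dotZl !(dotC _ (_ + _)) !dotDl !dotZl.
    rewrite e11 e22 e12 (dotC e2 e1) e12; apply/eqP.
    by transitivity (cos b ^+ 2 + sin b ^+ 2); [ring|exact: cos2Dsin2].
  have xie : dot eta xi = 0 by rewrite dotC dotDl !dotZl e1e e2e !mulr0 addr0.
  have xP : plane eta z x by exact: plane_pointP.
  have := data x xi xP xi1 xie.
  rewrite (nonabelian_radonE M L q b _ _ _ _ x xi L0 pf1 _ Y sY); last first.
    by move=> s i j; rewrite mxE lineE.
  rewrite (nonabelian_radonE M L q b _ _ _ _ x xi L0 pf2 _ Y' sY'); last first.
    by move=> s i j; rewrite mxE lineE.
  by move=> /matrixP h i k; have := h i k; rewrite !mxE.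
have eqA := plane_field_unique M L _ _ _ _ _ _ L0 pf1 pf2 same.
move=> x xz; have -> : x = plane_point eta e1 e2 z (dot x e1) (dot x e2).
  by rewrite {1}(dec x) (_ : dot x eta = z).
apply: Hmx_inj; apply/matrixP => i j.
exact: (mulfI c0 (eqA i j (dot x e1) (dot x e2))).
Qed.
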